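(* An affine finite space is schematic if and only if it is semi-separated. Consequently, a finite space $X$ is schematic if and only if $U_p$ is semi-separated for any $p\in X$.
   Context: All rings are commutative with unit. A ringed finite space is a ringed space $(X,\mathcal O)$ with $X$ a finite topological space. For $p\in X$, $U_p$ is the smallest open subset containing $p$ (with the restricted sheaf of rings); $p\le q$ means $q\in U_p$. The stalk is $\mathcal O_p=\mathcal O(U_p)$, with restriction morphisms $\mathcal O_p\to\mathcal O_q$ for $p\le q$. A finite space is a ringed finite space all of whose restriction morphisms are flat. An $\mathcal O$-module is quasi-coherent if it is locally a cokernel of a morphism between free modules of arbitrary rank. All spaces and morphisms are over a fixed commutative base ring $k$ (i.e. over the one-point ringed space $( *,k)$; $k=\mathbb Z$ imposes no restriction, and the notions below do not depend on $k$). $X\times X=X\times_kX$ is the product topological space with $\mathcal O_{(x,y)}=\mathcal O_x\otimes_k\mathcal O_y$, and $\delta\colon X\to X\times X$ is the diagonal morphism. A finite space $X$ is schematic if $R^i\delta_*\mathcal O$ is quasi-coherent for all $i\ge0$; it is semi-separated if $\delta_*\mathcal O$ is quasi-coherent and $R^i\delta_*\mathcal O=0$ for $i>0$. A finite space $X$ with $A=\mathcal O(X)$ is affine if $H^i(X,\mathcal O)=0$ for $i>0$ and the global sections functor is an equivalence from quasi-coherent $\mathcal O$-modules to $A$-modules. *)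

(* Defs.v *)
From HB Require Import structures.
From mathcomp Require Import all_boot all_algebra.
From mathcomp Require Import generic_quotient.
From mathcomp Require Import boolp classical_sets functions cardinality.

Set Implicit Arguments.
Unset Strict Implicit.
Unset Printing Implicit Defensive.

Import GRing.Theory.
Local Open Scope ring_scope.
Local Open Scope quotient_scope.

Section Tensor.
Variables (R : comPzRingType) (M N : lmodType R).

(* A list [:: (m1, n1); ..; (mr, nr)] stands for the formal sum of the mi (x) ni. *)
Inductive tensor_eq : seq (M * N) -> seq (M * N) -> Prop :=
| teq_sym s t : tensor_eq s t -> tensor_eq t s
| teq_trans s t u : tensor_eq s t -> tensor_eq t u -> tensor_eq s u
| teq_perm s t : perm_eq s t -> tensor_eq s t
| teq_cat s s' t t' : tensor_eq s s' -> tensor_eq t t' ->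
    tensor_eq (s ++ t) (s' ++ t')
| teq_addl m m' n : tensor_eq [:: (m + m', n)] [:: (m, n); (m', n)]
| teq_addr m n n' : tensor_eq [:: (m, n + n')] [:: (m, n); (m, n')]
| teq_scale a m n : tensor_eq [:: (a *: m, n)] [:: (m, a *: n)]
| teq_zero n : tensor_eq [:: (0, n)] [::].

Lemma teq_refl s : tensor_eq s s. Proof. exact: teq_perm. Qed.

Definition tensor_rel : rel (seq (M * N)) := fun s t => `[< tensor_eq s t >].

Lemma tensor_rel_equiv : equiv_class_of tensor_rel.
Proof.
split=> [s|s t|t s u]; first by apply/asboolP; exact: teq_refl.
  by apply/asboolP/asboolP; exact: teq_sym.
by move=> /asboolP st /asboolP tu; apply/asboolP; exact: teq_trans tu.
Qed.
Canonical tensor_equiv := EquivRelPack tensor_rel_equiv.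

Definition tensor : Type := {eq_quot tensor_rel}.
HB.instance Definition _ := Choice.on tensor.

Definition tcls (s : seq (M * N)) : tensor := \pi_({eq_quot tensor_rel}) s.
Definition tens (m : M) (n : N) : tensor := tcls [:: (m, n)].
Definition trep (t : tensor) : seq (M * N) := repr (t : {eq_quot tensor_rel}).

Lemma tclsP s t : tcls s = tcls t <-> tensor_eq s t.
Proof.
rewrite /tcls; split; first by move/eqP; rewrite piE => /asboolP.
by move=> st; apply/eqP; rewrite piE; apply/asboolP.
Qed.

Lemma trepK t : tcls (trep t) = t. Proof. exact: reprK. Qed.

Lemma trep_cls s : tensor_eq (trep (tcls s)) s.
Proof. by apply/tclsP; rewrite trepK. Qed.

Definition neg_sum (s : seq (M * N)) := [seq (- p.1, p.2) | p <- s].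
Definition tensor_zero : tensor := tcls [::].
Definition tensor_opp (t : tensor) : tensor := tcls (neg_sum (trep t)).
Definition tensor_add (t u : tensor) : tensor := tcls (trep t ++ trep u).

Lemma tensor_addE s t : tensor_add (tcls s) (tcls t) = tcls (s ++ t).
Proof. by apply/tclsP; apply: teq_cat; exact: trep_cls. Qed.

Lemma teq_neg s t : tensor_eq s t -> tensor_eq (neg_sum s) (neg_sum t).
Proof.
elim=> {s t} [s t _|s t u _ IH _|s t st|s s' t t' _ IH _ IH'|m m' n|m n n'|a m n|n].
- exact: teq_sym.
- exact: teq_trans.
- by apply: teq_perm; exact: perm_map.
- by rewrite /neg_sum !map_cat; exact: teq_cat.
- by rewrite /= opprD; exact: teq_addl.
- exact: teq_addr.
- by rewrite /= -scalerN; exact: teq_scale.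
- by rewrite /= oppr0; exact: teq_zero.
Qed.

Lemma tensor_oppE s : tensor_opp (tcls s) = tcls (neg_sum s).
Proof. by apply/tclsP; apply: teq_neg; exact: trep_cls. Qed.

Lemma tensor_addA : associative tensor_add.
Proof. by move=> t u v; rewrite -[t]trepK -[u]trepK -[v]trepK !tensor_addE catA. Qed.

Lemma tensor_addC : commutative tensor_add.
Proof.
move=> t u; rewrite -[t]trepK -[u]trepK !tensor_addE.
by apply/tclsP/teq_perm; rewrite perm_catC.
Qed.

Lemma tensor_add0 : left_id tensor_zero tensor_add.
Proof. by move=> t; rewrite -[t]trepK tensor_addE. Qed.

Lemma tensor_addN : left_inverse tensor_zero tensor_opp tensor_add.
Proof.
move=> t; rewrite -[t]trepK tensor_oppE tensor_addE; apply/tclsP.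
elim: (trep t) => [|[m n] s IH] /=; first exact: teq_refl.
apply: (@teq_trans _ ([:: (- m, n); (m, n)] ++ (neg_sum s ++ s))).
  by apply: teq_perm; rewrite /= perm_cons -[(m, n) :: s]cat1s perm_catCA.
rewrite -[X in tensor_eq _ X]/([::] ++ [::]); apply: teq_cat IH.
apply: teq_trans (teq_sym (teq_addl _ _ _)) _.
by rewrite addNr; exact: teq_zero.
Qed.

HB.instance Definition _ := GRing.isZmodule.Build tensor
  tensor_addA tensor_addC tensor_add0 tensor_addN.

Lemma tcls_sum s : tcls s = \sum_(p <- s) tens p.1 p.2.
Proof.
elim: s => [|[m n] s IH]; first by rewrite big_nil.
by rewrite big_cons -IH; symmetry; exact: tensor_addE.
Qed.

Lemma tensDl m m' n : tens (m + m') n = tens m n + tens m' n.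
Proof. by symmetry; rewrite /tens [LHS]tensor_addE; apply/tclsP/teq_sym/teq_addl. Qed.

Lemma tensDr m n n' : tens m (n + n') = tens m n + tens m n'.
Proof. by symmetry; rewrite /tens [LHS]tensor_addE; apply/tclsP/teq_sym/teq_addr. Qed.

Lemma tensZ a m n : tens (a *: m) n = tens m (a *: n).
Proof. by apply/tclsP/teq_scale. Qed.

Lemma tensor_ind (P : tensor -> Prop) :
  P 0 -> (forall m n, P (tens m n)) -> (forall t u, P t -> P u -> P (t + u)) ->
  forall t, P t.
Proof.
move=> P0 Pt PD t; rewrite -[t]trepK tcls_sum.
by elim/big_ind: _.
Qed.

Definition balanced (G : zmodType) (b : M -> N -> G) : Prop :=
  [/\ forall m m' n, b (m + m') n = b m n + b m' n,
      forall m n n', b m (n + n') = b m n + b m n'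
    & forall a m n, b (a *: m) n = b m (a *: n)].

Definition tensor_lift (G : zmodType) (b : M -> N -> G) (t : tensor) : G :=
  \sum_(p <- trep t) b p.1 p.2.

Section Lift.
Variables (G : zmodType) (b : M -> N -> G).
Hypothesis hb : balanced b.

Lemma tensor_lift_cls s : tensor_lift b (tcls s) = \sum_(p <- s) b p.1 p.2.
Proof.
case: hb => bDl bDr bZ; rewrite /tensor_lift.
have := trep_cls s; move: (trep (tcls s)) => t0; elim=> {t0 s}
    [s t _ -> //|s t u _ -> _ -> //|s t st|s s' t t' _ IH _ IH'|m m' n|m n n'|a m n|n].
- exact: perm_big.
- by rewrite !big_cat /= IH IH'.
- by rewrite !big_cons !big_nil /= bDl !addr0.
- by rewrite !big_cons !big_nil /= bDr !addr0.
- by rewrite !big_cons !big_nil /= bZ.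
- by rewrite big_cons !big_nil addr0; apply: (addrI (b 0 n)); rewrite -bDl !addr0.
Qed.

Lemma tensor_lift_tens m n : tensor_lift b (tens m n) = b m n.
Proof. by rewrite tensor_lift_cls big_cons big_nil addr0. Qed.

Lemma tensor_liftD t u : tensor_lift b (t + u) = tensor_lift b t + tensor_lift b u.
Proof.
by rewrite -[t]trepK -[u]trepK [_ + _ in LHS]tensor_addE !tensor_lift_cls big_cat.
Qed.

Lemma tensor_lift0 : tensor_lift b 0 = 0.
Proof. by apply: (addrI (tensor_lift b 0)); rewrite -tensor_liftD !addr0. Qed.
End Lift.

End Tensor.

Definition restr (R S : pzRingType) (f : {rmorphism R -> S}) (M : lmodType S) : Type := M.

Section Restr.
Variables (R S : pzRingType) (f : {rmorphism R -> S}) (M : lmodType S).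
HB.instance Definition _ := GRing.Zmodule.on (restr f M).
Definition restr_scale (a : R) (m : restr f M) : restr f M := f a *: (m : M).
Lemma restr_scaleA a b m : restr_scale a (restr_scale b m) = restr_scale (a * b) m.
Proof. by rewrite /restr_scale scalerA rmorphM. Qed.
Lemma restr_scale1 : left_id 1 restr_scale.
Proof. by move=> m; rewrite /restr_scale rmorph1 scale1r. Qed.
Lemma restr_scaleDr : right_distributive restr_scale +%R.
Proof. by move=> a m n; rewrite /restr_scale scalerDr. Qed.
Lemma restr_scaleDl m : {morph restr_scale^~ m : a b / a + b}.
Proof. by move=> a b; rewrite /restr_scale rmorphD scalerDl. Qed.
HB.instance Definition _ := GRing.Zmodule_isLmodule.Build R (restr f M)
  restr_scaleA restr_scale1 restr_scaleDr restr_scaleDl.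
End Restr.

Definition tensor_mapl (R : comPzRingType) (M M' N : lmodType R)
    (u : {linear M -> M'}) : tensor M N -> tensor M' N :=
  tensor_lift (fun m n => tens (u m) n).

Definition flat (A B : comPzRingType) (f : {rmorphism A -> B}) : Prop :=
  forall (M N : lmodType A) (u : {linear M -> N}), injective u ->
    injective (tensor_mapl u : tensor M (restr f B^o) -> tensor N (restr f B^o)).

Definition rtensor (k A B : comPzRingType)
    (f : {rmorphism k -> A}) (g : {rmorphism k -> B}) : Type :=
  tensor (restr f A^o) (restr g B^o).

Section RTensor.
Variables (k A B : comPzRingType).
Variables (f : {rmorphism k -> A}) (g : {rmorphism k -> B}).

HB.instance Definition _ := GRing.Zmodule.on (rtensor f g).
Definition rtens (a : A) (b : B) : rtensor f g :=
  @tens k (restr f A^o) (restr g B^o) a b.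

Lemma rtensDl a a' b : rtens (a + a') b = rtens a b + rtens a' b.
Proof. exact: (@tensDl k (restr f A^o) (restr g B^o)). Qed.
Lemma rtensDr a b b' : rtens a (b + b') = rtens a b + rtens a b'.
Proof. exact: (@tensDr k (restr f A^o) (restr g B^o)). Qed.
Lemma rtensZ c a b : rtens (f c * a) b = rtens a (g c * b).
Proof. exact: (@tensZ k (restr f A^o) (restr g B^o)). Qed.

Lemma rtensor_ind (P : rtensor f g -> Prop) :
  P 0 -> (forall a b, P (rtens a b)) -> (forall t u, P t -> P u -> P (t + u)) ->
  forall t, P t.
Proof. exact: (@tensor_ind k (restr f A^o) (restr g B^o)). Qed.

Definition rlift (G : zmodType) (b : A -> B -> G) : rtensor f g -> G :=
  @tensor_lift k (restr f A^o) (restr g B^o) G b.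

Definition rbalanced (G : zmodType) (b : A -> B -> G) : Prop :=
  [/\ forall a a' x, b (a + a') x = b a x + b a' x,
      forall a x x', b a (x + x') = b a x + b a x'
    & forall c a x, b (f c * a) x = b a (g c * x)].

Section RLiftTheory.
Variables (G : zmodType) (b : A -> B -> G).
Hypothesis hb : rbalanced b.

Lemma rbalancedP : @balanced k (restr f A^o) (restr g B^o) G b.
Proof. by case: hb => h1 h2 h3; split; [exact: h1|exact: h2|exact: h3]. Qed.
Lemma rliftE a x : rlift b (rtens a x) = b a x.
Proof. exact: (tensor_lift_tens rbalancedP). Qed.
Lemma rliftD t u : rlift b (t + u) = rlift b t + rlift b u.
Proof. exact: (tensor_liftD rbalancedP). Qed.
Lemma rlift0 : rlift b 0 = 0.
Proof. exact: (tensor_lift0 rbalancedP). Qed.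
End RLiftTheory.

Definition rtensor_mul (t u : rtensor f g) : rtensor f g :=
  rlift (fun a b => rlift (fun a' b' => rtens (a * a') (b * b')) u) t.

Lemma rtensor_mul_bal a b : rbalanced (fun a' b' => rtens (a * a') (b * b')).
Proof.
split=> [m m' n|m n n'|c m n]; first by rewrite mulrDr rtensDl.
  by rewrite mulrDr rtensDr.
by rewrite mulrCA rtensZ mulrCA.
Qed.

Lemma rtensor_mul_bal2 u :
  rbalanced (fun a b => rlift (fun a' b' => rtens (a * a') (b * b')) u).
Proof.
split=> [m m' n|m n n'|c m n]; elim/rtensor_ind: u => [|a' b'|t u IHt IHu].
- by rewrite !(rlift0 (rtensor_mul_bal _ _)) addr0.
- by rewrite !(rliftE (rtensor_mul_bal _ _)) mulrDl rtensDl.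
- by rewrite !(rliftD (rtensor_mul_bal _ _)) IHt IHu addrACA.
- by rewrite !(rlift0 (rtensor_mul_bal _ _)) addr0.
- by rewrite !(rliftE (rtensor_mul_bal _ _)) mulrDl rtensDr.
- by rewrite !(rliftD (rtensor_mul_bal _ _)) IHt IHu addrACA.
- by rewrite !(rlift0 (rtensor_mul_bal _ _)).
- by rewrite !(rliftE (rtensor_mul_bal _ _)) -!mulrA rtensZ.
- by rewrite !(rliftD (rtensor_mul_bal _ _)) IHt IHu.
Qed.

Lemma rtensor_mulDl : left_distributive rtensor_mul +%R.
Proof. by move=> t t' u; exact: (rliftD (rtensor_mul_bal2 u)). Qed.

Lemma rtensor_mul0 u : rtensor_mul 0 u = 0.
Proof. exact: (rlift0 (rtensor_mul_bal2 u)). Qed.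

Lemma rtensor_mulE a b a' b' :
  rtensor_mul (rtens a b) (rtens a' b') = rtens (a * a') (b * b').
Proof.
rewrite /rtensor_mul (rliftE (rtensor_mul_bal2 _)).
by rewrite (rliftE (rtensor_mul_bal _ _)).
Qed.

Lemma rtensor_mulDr : right_distributive rtensor_mul +%R.
Proof.
move=> t u u'; elim/rtensor_ind: t => [|a b|t t' IH IH'].
- by rewrite !rtensor_mul0 addr0.
- rewrite /rtensor_mul !(rliftE (rtensor_mul_bal2 _)).
  exact: (rliftD (rtensor_mul_bal _ _)).
- by rewrite !rtensor_mulDl IH IH' addrACA.
Qed.

Lemma rtensor_mulC : commutative rtensor_mul.
Proof.
have mul0 t : rtensor_mul t 0 = 0.
  by apply: (addrI (rtensor_mul t 0)); rewrite -rtensor_mulDr !addr0.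
move=> t u; elim/rtensor_ind: t => [|a b|t t' IH IH'].
- by rewrite rtensor_mul0 mul0.
- elim/rtensor_ind: u => [|a' b'|u u' IH IH'].
  + by rewrite rtensor_mul0 mul0.
  + by rewrite !rtensor_mulE mulrC [b * _]mulrC.
  + by rewrite rtensor_mulDl rtensor_mulDr IH IH'.
- by rewrite rtensor_mulDl rtensor_mulDr IH IH'.
Qed.

Lemma rtensor_mulA : associative rtensor_mul.
Proof.
move=> t u v.
elim/rtensor_ind: t => [|a b|t t' IH IH']; first by rewrite !rtensor_mul0.
  elim/rtensor_ind: u => [|a' b'|u u' IH IH'].
  - by rewrite ![rtensor_mul _ 0]rtensor_mulC !rtensor_mul0 rtensor_mulC rtensor_mul0.
  - elim/rtensor_ind: v => [|a'' b''|v v' IH IH'].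
    + by rewrite ![rtensor_mul _ 0]rtensor_mulC !rtensor_mul0 rtensor_mulC rtensor_mul0.
    + by rewrite !rtensor_mulE !mulrA.
    + by rewrite !rtensor_mulDr IH IH'.
  - by rewrite rtensor_mulDl !rtensor_mulDr rtensor_mulDl IH IH'.
by rewrite !rtensor_mulDl IH IH'.
Qed.

Lemma rtensor_mul1 : left_id (rtens 1 1) rtensor_mul.
Proof.
move=> t; elim/rtensor_ind: t => [|a b|t u IH IH'].
- by rewrite rtensor_mulC rtensor_mul0.
- by rewrite rtensor_mulE !mul1r.
- by rewrite rtensor_mulDr IH IH'.
Qed.

HB.instance Definition _ := GRing.Zmodule_isComPzRing.Build (rtensor f g)
  rtensor_mulA rtensor_mulC rtensor_mul1 rtensor_mulDl.

Lemma rtensM a b a' b' : rtens a b * rtens a' b' = rtens (a * a') (b * b').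
Proof. exact: rtensor_mulE. Qed.

Section RLift.
Variables (C : comPzRingType) (u : {rmorphism A -> C}) (v : {rmorphism B -> C}).
Hypothesis uv : forall c, u (f c) = v (g c).

Definition rtensor_lift (_ : forall c, u (f c) = v (g c)) : rtensor f g -> C :=
  rlift (fun a b => u a * v b).

Lemma rtensor_lift_bal : rbalanced (fun a b => u a * v b).
Proof.
split=> [m m' n|m n n'|c m n]; first by rewrite rmorphD mulrDl.
  by rewrite rmorphD mulrDr.
by rewrite !rmorphM uv mulrCA mulrA.
Qed.

Lemma rtensor_liftE a b : rtensor_lift uv (rtens a b) = u a * v b.
Proof. exact: (rliftE rtensor_lift_bal). Qed.

Lemma rtensor_liftD t t' :
  rtensor_lift uv (t + t') = rtensor_lift uv t + rtensor_lift uv t'.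
Proof. exact: (rliftD rtensor_lift_bal). Qed.

Lemma rtensor_lift_zmod : zmod_morphism (rtensor_lift uv).
Proof.
move=> t t'; apply: (addIr (rtensor_lift uv t')).
by rewrite -rtensor_liftD !subrK.
Qed.

HB.instance Definition _ :=
  GRing.isZmodMorphism.Build _ _ (rtensor_lift uv) rtensor_lift_zmod.

Lemma rtensor_lift_monoid : monoid_morphism (rtensor_lift uv).
Proof.
split=> [|t t']; first by rewrite rtensor_liftE !rmorph1 mulr1.
elim/rtensor_ind: t => [|a b|t s IH IH']; first by rewrite mul0r raddf0 mul0r.
  elim/rtensor_ind: t' => [|a' b'|t s IH IH']; first by rewrite mulr0 raddf0 mulr0.
    by rewrite rtensM !rtensor_liftE !rmorphM mulrACA.
  by rewrite mulrDr !raddfD mulrDr /= IH IH'.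
by rewrite mulrDl !raddfD mulrDl /= IH IH'.
Qed.

HB.instance Definition _ :=
  GRing.isMonoidMorphism.Build _ _ (rtensor_lift uv) rtensor_lift_monoid.
End RLift.

Definition rinl (a : A) : rtensor f g := rtens a 1.
Definition rinr (b : B) : rtensor f g := rtens 1 b.

Lemma rinl_zmod : zmod_morphism rinl.
Proof. by move=> a a'; apply: (addIr (rinl a')); rewrite /rinl -rtensDl !subrK. Qed.
HB.instance Definition _ := GRing.isZmodMorphism.Build _ _ rinl rinl_zmod.
Lemma rinl_monoid : monoid_morphism rinl.
Proof. by split=> // a a'; rewrite /rinl rtensM mulr1. Qed.
HB.instance Definition _ := GRing.isMonoidMorphism.Build _ _ rinl rinl_monoid.

Lemma rinr_zmod : zmod_morphism rinr.
Proof. by move=> b b'; apply: (addIr (rinr b')); rewrite /rinr -rtensDr !subrK. Qed.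
HB.instance Definition _ := GRing.isZmodMorphism.Build _ _ rinr rinr_zmod.
Lemma rinr_monoid : monoid_morphism rinr.
Proof. by split=> // b b'; rewrite /rinr rtensM mulr1. Qed.
HB.instance Definition _ := GRing.isMonoidMorphism.Build _ _ rinr rinr_monoid.

Lemma rinlr c : rinl (f c) = rinr (g c).
Proof. by have := rtensZ c 1 1; rewrite !mulr1. Qed.

End RTensor.

(* A finite topological space is a finite preordered set (p <= q iff q lies in
   the smallest open set U_p containing p; the open sets are the upward closed
   sets), and a sheaf F on it is the functor of its stalks F_p = F(U_p) and of the
   restrictions F_p -> F_q for p <= q. The preorder need not be antisymmetric, and
   the rings may be zero. The morphisms kst give the structure morphism to the
   one-point space with ring k. *)
Record rspace (k : comPzRingType) := RSpace {
  pt :> finType;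
  le : rel pt;
  le_refl : reflexive le;
  le_trans : transitive le;
  stalk : pt -> comPzRingType;
  res : forall p q, le p q -> {rmorphism stalk p -> stalk q};
  res_id : forall p (h : le p p) a, res h a = a;
  res_comp : forall p q r (h : le p q) (h' : le q r) (h'' : le p r) a,
    res h' (res h a) = res h'' a;
  kst : forall p, {rmorphism k -> stalk p};
  kst_res : forall p q (h : le p q) c, res h (kst p c) = kst q c
}.
Arguments le {k r} x y : rename.
Arguments le_refl {k r} x : rename.
Arguments res {k r p q} h : rename.
Arguments kst {k r} p : rename.

Definition finite_space (k : comPzRingType) (X : rspace k) : Prop :=
  forall (p q : X) (h : le p q), flat (res h).

Definition is_open (k : comPzRingType) (X : rspace k) (U : {set X}) : Prop :=
  forall p q, le p q -> p \in U -> q \in U.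

Definition min_open (k : comPzRingType) (X : rspace k) (p : X) : {set X} :=
  [set q | le p q].

(* Only meant for open U. *)
Section Subspace.
Variables (k : comPzRingType) (X : rspace k) (U : {set X}).

Definition subspace : rspace k := {|
  pt := {p : X | p \in U};
  le := fun p q => le (val p) (val q);
  le_refl := fun p => le_refl (val p);
  le_trans := fun q p r => @le_trans k X (val q) (val p) (val r);
  stalk := fun p => stalk (val p);
  res := fun p q h => @res k X (val p) (val q) h;
  res_id := fun p => @res_id k X (val p);
  res_comp := fun p q r => @res_comp k X (val p) (val q) (val r);
  kst := fun p => kst (val p);
  kst_res := fun p q => @kst_res k X (val p) (val q)
|}.
End Subspace.

Section Product.
Variables (k : comPzRingType) (X Y : rspace k).

Let le2 : rel (X * Y) := fun p q => le p.1 q.1 && le p.2 q.2.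
Let stalk2 (p : X * Y) : comPzRingType := rtensor (kst p.1) (kst p.2).

Lemma prod_le_refl : reflexive le2.
Proof. by move=> p; rewrite /le2 !le_refl. Qed.

Lemma prod_le_trans : transitive le2.
Proof.
move=> q p r /andP[h1 h2] /andP[h1' h2']; apply/andP.
by split; [exact: le_trans h1' | exact: le_trans h2'].
Qed.

Lemma le2l p q : le2 p q -> le p.1 q.1. Proof. by case/andP. Qed.
Lemma le2r p q : le2 p q -> le p.2 q.2. Proof. by case/andP. Qed.

Lemma prod_res_subproof p q (h : le2 p q) c :
  (rinl (kst q.1) (kst q.2) \o res (le2l h)) (kst p.1 c) =
  (rinr (kst q.1) (kst q.2) \o res (le2r h)) (kst p.2 c).
Proof. by rewrite /= !kst_res rinlr. Qed.

Definition prod_res p q (h : le2 p q) : {rmorphism stalk2 p -> stalk2 q} :=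
  rtensor_lift (prod_res_subproof h).

Lemma prod_resE p q (h : le2 p q) a b :
  prod_res h (rtens _ _ a b) = rtens _ _ (res (le2l h) a) (res (le2r h) b).
Proof. by rewrite /prod_res /= rtensor_liftE /= rtensM mulr1 mul1r. Qed.

Lemma prod_res_id p (h : le2 p p) a : prod_res h a = a.
Proof.
elim/rtensor_ind: a => [|a b|s t IH IH']; first exact: raddf0.
  by rewrite prod_resE !res_id.
by rewrite raddfD /= IH IH'.
Qed.

Lemma prod_res_comp p q r (h : le2 p q) (h' : le2 q r) (h'' : le2 p r) a :
  prod_res h' (prod_res h a) = prod_res h'' a.
Proof.
elim/rtensor_ind: a => [|a b|s t IH IH']; first by rewrite !raddf0.
  by rewrite !prod_resE !(res_comp _ _ (le2l h'')) !(res_comp _ _ (le2r h'')).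
by rewrite !raddfD /= IH IH'.
Qed.

Definition prod_kst (p : X * Y) : {rmorphism k -> stalk2 p} :=
  rinl (kst p.1) (kst p.2) \o kst p.1.

Lemma prod_kst_res p q (h : le2 p q) c : prod_res h (prod_kst p c) = prod_kst q c.
Proof. by rewrite /prod_kst /= /rinl prod_resE kst_res rmorph1. Qed.

Definition prod_space : rspace k := {|
  pt := (X * Y)%type;
  le := le2;
  le_refl := prod_le_refl;
  le_trans := prod_le_trans;
  stalk := stalk2;
  res := prod_res;
  res_id := prod_res_id;
  res_comp := prod_res_comp;
  kst := prod_kst;
  kst_res := prod_kst_res
|}.
End Product.

(* The morphism of sheaves O_Y -> f_* O_X is given by its adjoint f^-1 O_Y -> O_X. *)
Record rmap (k : comPzRingType) (X Y : rspace k) := RMap {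
  rmap_pt :> X -> Y;
  rmap_mono : forall x x', le x x' -> le (rmap_pt x) (rmap_pt x');
  rmap_st : forall x, {rmorphism stalk (rmap_pt x) -> stalk x};
  rmap_res : forall x x' (h : le x x') a,
    res h (rmap_st x a) = rmap_st x' (res (rmap_mono h) a);
  rmap_kst : forall x c, rmap_st x (kst (rmap_pt x) c) = kst x c
}.

Section Diagonal.
Variables (k : comPzRingType) (X : rspace k).

Definition diag_pt (x : X) : prod_space X X := (x, x).

Lemma diag_mono x x' : le x x' -> le (diag_pt x) (diag_pt x').
Proof. by move=> h; apply/andP. Qed.

Definition diag_st (x : X) : {rmorphism stalk (diag_pt x) -> stalk x} :=
  @rtensor_lift k (stalk x) (stalk x) (kst x) (kst x) (stalk x) idfun idfun
    (fun=> erefl).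

Lemma diag_stE (x : X) a b : diag_st x (rtens _ _ a b) = a * b.
Proof. exact: rtensor_liftE. Qed.

Lemma diag_res x x' (h : le x x') a :
  res h (diag_st x a) = diag_st x' (res (diag_mono h) a).
Proof.
elim/rtensor_ind: a => [|a b|s t IH IH']; first by rewrite !raddf0.
  rewrite [res (diag_mono h) _]prod_resE !diag_stE rmorphM.
  by congr (_ * _); congr (res _ _); exact: bool_irrelevance.
by rewrite !raddfD /= IH IH'.
Qed.

Lemma diag_kst x c : diag_st x (kst (diag_pt x) c) = kst x c.
Proof. by rewrite [kst _ _]/(rtens _ _ _ _) diag_stE mulr1. Qed.

Definition diag : rmap X (prod_space X X) :=
  RMap diag_res diag_kst.
End Diagonal.

Definition semilinear (R S : pzRingType) (sigma : {rmorphism R -> S})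
    (M : lmodType R) (N : lmodType S) (phi : M -> N) : Prop :=
  forall a x y, phi (a *: x + y) = sigma a *: phi x + phi y.

Section SemilinearTheory.
Variables (R S : pzRingType) (sigma : {rmorphism R -> S}).
Variables (M : lmodType R) (N : lmodType S) (phi : M -> N).
Hypothesis h : semilinear sigma phi.

Lemma semilinD x y : phi (x + y) = phi x + phi y.
Proof. by have := h 1 x y; rewrite rmorph1 !scale1r. Qed.
Lemma semilin0 : phi 0 = 0.
Proof. by apply: (addrI (phi 0)); rewrite -semilinD !addr0. Qed.
Lemma semilinN x : phi (- x) = - phi x.
Proof. by apply: (addrI (phi x)); rewrite -semilinD !subrr semilin0. Qed.
Lemma semilinZ a x : phi (a *: x) = sigma a *: phi x.
Proof. by have := h a x 0; rewrite semilin0 !addr0. Qed.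
End SemilinearTheory.

Lemma linear_ext (R : pzRingType) (M N : lmodType R) (u v : {linear M -> N}) :
  u =1 v -> u = v.
Proof.
move: u v => [u cu] [v cv] /= /funext uv.
move: cu cv; rewrite uv => cu cv; congr (GRing.Linear.Pack _).
case: cu cv => [[a1] [b1]] [[a2] [b2]].
by rewrite (Prop_irrelevance a1 a2) (Prop_irrelevance b1 b2).
Qed.

Record omodule (k : comPzRingType) (X : rspace k) := OModule {
  mst :> forall p : X, lmodType (stalk p);
  mres : forall p q (h : le p q), mst p -> mst q;
  mres_lin : forall p q (h : le p q), semilinear (res h) (mres h);
  mres_id : forall p (h : le p p) m, mres h m = m;
  mres_comp : forall p q r (h : le p q) (h' : le q r) (h'' : le p r) m,
    mres h' (mres h m) = mres h'' m
}.
Arguments mres {k X} o {p q} h m : rename.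

Record omhom (k : comPzRingType) (X : rspace k) (M N : omodule X) := OMHom {
  hfun :> forall p : X, {linear M p -> N p};
  hfun_res : forall p q (h : le p q) m, mres N h (hfun p m) = hfun q (mres M h m)
}.

Lemma omhom_ext (k : comPzRingType) (X : rspace k) (M N : omodule X) (u v : omhom M N) :
  (forall p, u p =1 v p) -> u = v.
Proof.
case: u v => [u hu] [v hv] /= uv.
have {}uv : u = v by apply: functional_extensionality_dep => p; exact: (linear_ext (uv p)).
by rewrite -{}uv in hv *; rewrite (Prop_irrelevance hu hv).
Qed.

Section OMCategory.
Variables (k : comPzRingType) (X : rspace k).

Lemma om_id_res (M : omodule X) (p q : X) (h : le p q) m :
  mres M h (idfun m) = (idfun : {linear M q -> M q}) (mres M h m).
Proof. by []. Qed.
Definition om_id (M : omodule X) : omhom M M :=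
  OMHom (hfun := fun p => idfun : {linear M p -> M p}) (@om_id_res M).

Lemma om_comp_res (M N P : omodule X) (v : omhom N P) (u : omhom M N) p q
    (h : le p q) m : mres P h ((v p \o u p) m) = (v q \o u q) (mres M h m).
Proof. by rewrite /= !hfun_res. Qed.
Definition om_comp (M N P : omodule X) (v : omhom N P) (u : omhom M N) : omhom M P :=
  OMHom (hfun := fun p => (v p \o u p : {linear M p -> P p})) (om_comp_res v u).
End OMCategory.

Section StructModule.
Variables (k : comPzRingType) (X : rspace k).

Lemma struct_lin (p q : X) (h : le p q) :
  @semilinear _ _ (res h) (stalk p)^o (stalk q)^o (res h).
Proof. by move=> a x y; rewrite rmorphD rmorphM. Qed.

Definition struct_module : omodule X := {|
  mst := fun p => (stalk p)^o;
  mres := fun p q h => res h : (stalk p)^o -> (stalk q)^o;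
  mres_lin := struct_lin;
  mres_id := fun p h => res_id h;
  mres_comp := fun p q r h h' h'' => res_comp h h' h''
|}.
End StructModule.

Definition mod_restr (k : comPzRingType) (X : rspace k) (M : omodule X) (U : {set X}) :
    omodule (subspace U) := {|
  mst := fun p : subspace U => M (val p) : lmodType (@stalk k (subspace U) p);
  mres := fun p q h => @mres k X M (val p) (val q) h;
  mres_lin := fun p q h => @mres_lin k X M (val p) (val q) h;
  mres_id := fun p h => @mres_id k X M (val p) h;
  mres_comp := fun p q r h h' h'' => @mres_comp k X M (val p) (val q) (val r) h h' h''
|}.

Section FreeModule.
Variables (R : pzRingType) (I : Type).

Definition fin_supp : {pred I -> R^o} := fun f => `[< finite_set [set i | f i != 0] >].

Lemma fin_supp_closed : submod_closed fin_supp.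
Proof.
split.
  apply/asboolP; rewrite (_ : mkset _ = set0); first exact: finite_set0.
  by apply/seteqP; split=> i //=; rewrite eqxx.
move=> a f g /asboolP hf /asboolP hg; apply/asboolP.
apply: (sub_finite_set _ (B := [set i | f i != 0] `|` [set i | g i != 0])%classic).
  move=> i /=; case: (eqVneq (f i) 0) => [f0|]; last by left.
  case: (eqVneq (g i) 0) => [g0|]; last by right.
  have -> : (a *: f + g) i = a * f i + g i :> R by [].
  by rewrite f0 g0 mulr0 addr0 eqxx.
by rewrite finite_setU.
Qed.
HB.instance Definition _ := GRing.isSubmodClosed.Build R (I -> R^o) fin_supp
  fin_supp_closed.

Record free_mod := FreeMod { free_val :> I -> R^o; _ : free_val \in fin_supp }.
HB.instance Definition _ := [isSub for free_val].
HB.instance Definition _ := [Choice of free_mod by <:].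
HB.instance Definition _ := [SubChoice_isSubLmodule of free_mod by <:].
End FreeModule.

Section FreeSheaf.
Variables (k : comPzRingType) (X : rspace k) (I : Type).

Lemma free_res_subproof (p q : X) (h : le p q) (f : free_mod (stalk p) I) :
  (fun i => res h (f i)) \in @fin_supp (stalk q) I.
Proof.
case: f => f /= /asboolP hf; apply/asboolP.
apply: sub_finite_set hf => i /=.
by case: (eqVneq (f i) 0) => // ->; rewrite rmorph0 eqxx.
Qed.

Definition free_res (p q : X) (h : le p q) (f : free_mod (stalk p) I) : free_mod (stalk q) I :=
  FreeMod (free_res_subproof h f).

Lemma free_res_lin (p q : X) (h : le p q) : semilinear (res h) (free_res h).
Proof.
by move=> a f g; apply/val_inj/funext => i; rewrite /= [LHS]rmorphD [res h (_ * _)]rmorphM.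
Qed.
Lemma free_res_id (p : X) (h : le p p) f : free_res h f = f.
Proof. by apply/val_inj/funext => i; exact: res_id. Qed.
Lemma free_res_comp (p q r : X) (h : le p q) (h' : le q r) (h'' : le p r) f :
  free_res h' (free_res h f) = free_res h'' f.
Proof. by apply/val_inj/funext => i; exact: res_comp. Qed.

Definition free_module : omodule X := {|
  mst := fun p => free_mod (stalk p) I : lmodType (stalk p);
  mres := free_res;
  mres_lin := free_res_lin;
  mres_id := free_res_id;
  mres_comp := free_res_comp
|}.
End FreeSheaf.

(* N -u-> P -v-> Q -> 0 is exact; exactness of sheaves is checked on stalks. *)
Definition is_cokernel (k : comPzRingType) (X : rspace k) (N P Q : omodule X)
    (u : omhom N P) (v : omhom P Q) : Prop :=
  forall p : X, (forall y, exists x, v p x = y) /\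
                (forall x, v p x = 0 <-> exists z, u p z = x).

Definition quasi_coherent (k : comPzRingType) (X : rspace k) (M : omodule X) : Prop :=
  forall p : X, exists U : {set X}, [/\ is_open U, p \in U &
    exists (I J : Type) (u : omhom (free_module (subspace U) J) (free_module (subspace U) I))
      (v : omhom (free_module (subspace U) I) (mod_restr M U)), is_cokernel u v].

(* F(U) is the limit of the stalks F_p, p in U. *)
Record sections (k : comPzRingType) (X : rspace k) (M : omodule X) (U : {set X}) :=
  Sections {
    sec :> forall p : X, p \in U -> M p;
    sec_res : forall p q (h : le p q) (hp : p \in U) (hq : q \in U),
      mres M h (sec hp) = sec hq
  }.

Section SectionsZmod.
Variables (k : comPzRingType) (X : rspace k) (M : omodule X) (U : {set X}).

Lemma sections_ext (s t : sections M U) :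
  (forall p (hp : p \in U), s p hp = t p hp) -> s = t.
Proof.
case: s t => s hs [t ht] /= st.
have {}st : s = t.
  apply: functional_extensionality_dep => p.
  by apply: functional_extensionality_dep => hp; exact: st.
by rewrite -{}st in ht *; rewrite (Prop_irrelevance hs ht).
Qed.

HB.instance Definition _ := gen_eqMixin (sections M U).
HB.instance Definition _ := gen_choiceMixin (sections M U).

Lemma sec0_res (p q : X) (h : le p q) (hp : p \in U) (hq : q \in U) :
  mres M h 0 = 0.
Proof. exact: semilin0 (mres_lin h). Qed.
Definition sec0 : sections M U := Sections (sec := fun p hp => 0) sec0_res.

Lemma secN_res (s : sections M U) (p q : X) (h : le p q) (hp : p \in U) (hq : q \in U) :
  mres M h (- s p hp) = - s q hq.
Proof. by rewrite (semilinN (mres_lin h)) (sec_res s h hp hq). Qed.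
Definition secN (s : sections M U) : sections M U :=
  Sections (sec := fun p hp => - s p hp) (secN_res s).

Lemma secD_res (s t : sections M U) (p q : X) (h : le p q) (hp : p \in U) (hq : q \in U) :
  mres M h (s p hp + t p hp) = s q hq + t q hq.
Proof.
by rewrite (semilinD (mres_lin h)) (sec_res s h hp hq) (sec_res t h hp hq).
Qed.
Definition secD (s t : sections M U) : sections M U :=
  Sections (sec := fun p hp => s p hp + t p hp) (secD_res s t).

Lemma secDA : associative secD.
Proof. by move=> s t u; apply: sections_ext => p hp; exact: addrA. Qed.
Lemma secDC : commutative secD.
Proof. by move=> s t; apply: sections_ext => p hp; exact: addrC. Qed.
Lemma secD0 : left_id sec0 secD.
Proof. by move=> s; apply: sections_ext => p hp; exact: add0r. Qed.
Lemma secDN : left_inverse sec0 secN secD.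
Proof. by move=> s; apply: sections_ext => p hp; exact: addNr. Qed.
HB.instance Definition _ := GRing.isZmodule.Build (sections M U) secDA secDC secD0 secDN.
End SectionsZmod.

Definition osec (k : comPzRingType) (X : rspace k) (U : {set X}) : Type :=
  sections (struct_module X) U.

Section SectionsRing.
Variables (k : comPzRingType) (X : rspace k) (U : {set X}).
HB.instance Definition _ := GRing.Zmodule.on (osec U).

Definition osec_val (p : X) (hp : p \in U) (s : osec U) : stalk p := s p hp.

Lemma osec1_res (p q : X) (h : le p q) (hp : p \in U) (hq : q \in U) :
  mres (struct_module X) h 1 = 1.
Proof. exact: rmorph1. Qed.
Definition osec1 : osec U := Sections (M := struct_module X) (U := U) (sec := fun p _ => 1) osec1_res.

Lemma osecM_res (s t : osec U) (p q : X) (h : le p q) (hp : p \in U) (hq : q \in U) :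
  mres (struct_module X) h (osec_val hp s * osec_val hp t) =
  osec_val hq s * osec_val hq t.
Proof.
rewrite /= rmorphM; congr (_ * _).
  exact: (sec_res s h hp hq).
exact: (sec_res t h hp hq).
Qed.
Definition osecM (s t : osec U) : osec U :=
  Sections (M := struct_module X) (U := U)
    (sec := fun p hp => osec_val hp s * osec_val hp t) (osecM_res s t).

Lemma osecMA : associative osecM.
Proof. by move=> s t u; apply: sections_ext => p hp; exact: mulrA. Qed.
Lemma osecMC : commutative osecM.
Proof. by move=> s t; apply: sections_ext => p hp; exact: mulrC. Qed.
Lemma osecM1 : left_id osec1 osecM.
Proof. by move=> s; apply: sections_ext => p hp; exact: mul1r. Qed.
Lemma osecMDl : left_distributive osecM +%R.
Proof. by move=> s t u; apply: sections_ext => p hp; exact: mulrDl. Qed.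
HB.instance Definition _ := GRing.Zmodule_isComPzRing.Build (osec U)
  osecMA osecMC osecM1 osecMDl.

Lemma osec_val_zmod p (hp : p \in U) : zmod_morphism (osec_val hp).
Proof. by []. Qed.
HB.instance Definition _ p (hp : p \in U) :=
  GRing.isZmodMorphism.Build _ _ (osec_val hp) (osec_val_zmod hp).
Lemma osec_val_monoid p (hp : p \in U) : monoid_morphism (osec_val hp).
Proof. by []. Qed.
HB.instance Definition _ p (hp : p \in U) :=
  GRing.isMonoidMorphism.Build _ _ (osec_val hp) (osec_val_monoid hp).
End SectionsRing.

Section SectionsModule.
Variables (k : comPzRingType) (X : rspace k) (M : omodule X) (U : {set X}).

Lemma secZ_res (a : osec U) (s : sections M U) (p q : X) (h : le p q)
    (hp : p \in U) (hq : q \in U) :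
  mres M h (osec_val hp a *: s p hp) = osec_val hq a *: s q hq.
Proof.
rewrite (semilinZ (mres_lin h)) (sec_res s h hp hq).
by congr (_ *: _); exact: (sec_res a h hp hq).
Qed.
Definition secZ (a : osec U) (s : sections M U) : sections M U :=
  Sections (sec := fun p hp => osec_val hp a *: s p hp) (secZ_res a s).

Lemma secZA a b s : secZ a (secZ b s) = secZ (a * b) s.
Proof. by apply: sections_ext => p hp; exact: scalerA. Qed.
Lemma secZ1 : left_id 1 secZ.
Proof. by move=> s; apply: sections_ext => p hp; exact: scale1r. Qed.
Lemma secZDr : right_distributive secZ +%R.
Proof. by move=> a s t; apply: sections_ext => p hp; exact: scalerDr. Qed.
Lemma secZDl s : {morph secZ^~ s : a b / a + b}.
Proof. by move=> a b; apply: sections_ext => p hp; exact: scalerDl. Qed.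
HB.instance Definition _ := GRing.Zmodule_isLmodule.Build (osec U) (sections M U)
  secZA secZ1 secZDr secZDl.
End SectionsModule.

Section SectionsMap.
Variables (k : comPzRingType) (X : rspace k) (M N : omodule X) (u : omhom M N).
Variable U : {set X}.

Lemma sec_map_res (s : sections M U) (p q : X) (h : le p q) (hp : p \in U) (hq : q \in U) :
  mres N h (u p (s p hp)) = u q (s q hq).
Proof. by rewrite hfun_res (sec_res s h hp hq). Qed.
Definition sec_map (s : sections M U) : sections N U :=
  Sections (sec := fun p hp => u p (s p hp)) (sec_map_res s).

Lemma sec_map_linear : linear sec_map.
Proof. by move=> a s t; apply: sections_ext => p hp; exact: linearP. Qed.
HB.instance Definition _ :=
  GRing.isLinear.Build (osec U) (sections M U) (sections N U) _ sec_map sec_map_linear.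
End SectionsMap.

Section Pushforward.
Variables (k : comPzRingType) (X Y : rspace k) (f : rmap X Y).

Definition pre_open (y : Y) : {set X} := [set x | le y (f x)].

(* O_{Y,y} -> O_X(f^-1 U_y) *)
Lemma sharp_le y x : x \in pre_open y -> le y (f x).
Proof. by rewrite inE. Qed.

Lemma sharp_res y (a : stalk y) (p q : X) (h : le p q)
    (hp : p \in pre_open y) (hq : q \in pre_open y) :
  mres (struct_module X) h (rmap_st f p (res (sharp_le hp) a)) =
  rmap_st f q (res (sharp_le hq) a).
Proof. by rewrite [LHS]rmap_res (res_comp _ _ (sharp_le hq)). Qed.

Definition sharp y (a : stalk y) : osec (pre_open y) :=
  Sections (M := struct_module X) (U := pre_open y)
    (sec := fun p hp => rmap_st f p (res (sharp_le hp) a))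
    (sharp_res a).

Lemma sharp_zmod y : zmod_morphism (@sharp y).
Proof. by move=> a b; apply: sections_ext => p hp; rewrite /= !rmorphB. Qed.
HB.instance Definition _ y := GRing.isZmodMorphism.Build _ _ (@sharp y) (@sharp_zmod y).
Lemma sharp_monoid y : monoid_morphism (@sharp y).
Proof.
split=> [|a b]; apply: sections_ext => p hp; rewrite /= ?rmorph1 //.
by rewrite !rmorphM.
Qed.
HB.instance Definition _ y :=
  GRing.isMonoidMorphism.Build _ _ (@sharp y) (@sharp_monoid y).

Lemma pre_open_sub y y' x : le y y' -> x \in pre_open y' -> x \in pre_open y.
Proof. by rewrite !inE; exact: le_trans. Qed.

Section PushModule.
Variable M : omodule X.

(* (f_* M)_y = M(f^-1 U_y) *)
Definition push_st (y : Y) : lmodType (stalk y) :=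
  restr (@sharp y) (sections M (pre_open y)).

Lemma push_res_subproof y y' (h : le y y') (s : sections M (pre_open y)) p q
    (hpq : le p q) (hp : p \in pre_open y') (hq : q \in pre_open y') :
  mres M hpq (s p (pre_open_sub h hp)) = s q (pre_open_sub h hq).
Proof. exact: sec_res. Qed.
Definition push_res y y' (h : le y y') (s : push_st y) : push_st y' :=
  Sections (sec := fun p hp => sec s (pre_open_sub h hp)) (push_res_subproof h s).

Lemma push_res_lin y y' (h : le y y') : semilinear (res h) (push_res h).
Proof.
move=> a s t; apply: sections_ext => p hp /=.
by congr (_ *: _ + _); rewrite /osec_val /= (res_comp h _ (sharp_le (pre_open_sub h hp))).
Qed.
Lemma push_res_id y (h : le y y) s : push_res h s = s.
Proof.
apply: sections_ext => p hp /=.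
by rewrite (bool_irrelevance (pre_open_sub h hp) hp).
Qed.
Lemma push_res_comp (p q r : Y) (h : le p q) (h' : le q r) (h'' : le p r) s :
  push_res h' (push_res h s) = push_res h'' s.
Proof.
apply: sections_ext => x hx /=.
by rewrite (bool_irrelevance (pre_open_sub h _) (pre_open_sub h'' hx)).
Qed.

Definition pushforward : omodule Y := {|
  mst := push_st;
  mres := push_res;
  mres_lin := push_res_lin;
  mres_id := push_res_id;
  mres_comp := push_res_comp
|}.
End PushModule.

Section PushMap.
Variables (M N : omodule X) (u : omhom M N).

Definition push_fun y : push_st M y -> push_st N y := sec_map u (U := pre_open y).
Lemma push_fun_linear y : linear (@push_fun y).
Proof. by move=> a s t; exact: (linearP (sec_map u (U := pre_open y))). Qed.
HB.instance Definition _ y := GRing.isLinear.Build (stalk y) (push_st M y) (push_st N y)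
  _ (@push_fun y) (@push_fun_linear y).

Lemma push_fun_res y y' (h : le y y') m :
  mres (pushforward N) h (push_fun m) = push_fun (mres (pushforward M) h m).
Proof. exact: sections_ext. Qed.

Definition push_map : omhom (pushforward M) (pushforward N) :=
  OMHom (hfun := fun y => @push_fun y : {linear pushforward M y -> pushforward N y})
    push_fun_res.
End PushMap.

End Pushforward.

(* The term before C 0 is the zero module. The condition d o d = 0 is not needed to
   form ker / (ker :&: im); it holds wherever the construction is used. *)
Section Cohomology.
Variables (R : pzRingType) (C : nat -> lmodType R).
Variable d : forall n, {linear C n -> C n.+1}.

Definition boundary (i : nat) : C i -> Prop :=
  match i return C i -> Prop with
  | 0%N => fun z => z = 0
  | j.+1 => fun z => exists y, d j y = z
  end.

Lemma boundary_lin i a (x y : C i) : boundary x -> boundary y -> boundary (a *: x + y).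
Proof.
case: i x y => [x y -> ->|i x y [x' <-] [y' <-]] /=; first by rewrite scaler0 addr0.
by exists (a *: x' + y'); rewrite linearP.
Qed.
Lemma boundary0 i : @boundary i 0.
Proof. by case: i => //= i; exists 0; rewrite linear0. Qed.

Variable i : nat.

Definition cocycle_pred : {pred C i} := fun z => d i z == 0.
Lemma cocycle_closed : submod_closed cocycle_pred.
Proof.
split=> [|a x y /eqP hx /eqP hy]; apply/eqP; first exact: linear0.
by rewrite linearP hx hy scaler0 addr0.
Qed.
HB.instance Definition _ := GRing.isSubmodClosed.Build R (C i) cocycle_pred cocycle_closed.

Record cocycle := Cocycle { cocycle_val :> C i; _ : cocycle_val \in cocycle_pred }.
HB.instance Definition _ := [isSub for cocycle_val].
HB.instance Definition _ := [Choice of cocycle by <:].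
HB.instance Definition _ := [SubChoice_isSubLmodule of cocycle by <:].

Definition coboundary_pred : {pred cocycle} := fun z => `[< boundary (val z) >].
Lemma coboundary_closed : submod_closed coboundary_pred.
Proof.
split=> [|a x y /asboolP hx /asboolP hy]; apply/asboolP; first exact: boundary0.
exact: boundary_lin.
Qed.
HB.instance Definition _ :=
  GRing.isSubmodClosed.Build R cocycle coboundary_pred coboundary_closed.

Definition cohomology : Type := Quotient.quot coboundary_pred.
HB.instance Definition _ := GRing.Zmodule.on cohomology.

Definition hcls (z : cocycle) : cohomology := \pi_(Quotient.quot coboundary_pred) z.
Definition hrep (x : cohomology) : cocycle :=
  repr (x : Quotient.quot coboundary_pred).

Lemma hrepK x : hcls (hrep x) = x. Proof. exact: reprK. Qed.
Lemma hclsP z z' : hcls z = hcls z' <-> boundary (val z - val z').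
Proof.
have -> : (hcls z = hcls z') = (z - z' \in coboundary_pred) :> Prop.
  rewrite Quotient.idealrBE; apply/propext; split=> [zz'|/eqP //].
  by apply/eqP.
by rewrite -[val z - _]/(val (z - z')); split=> /asboolP.
Qed.
Lemma hclsD z z' : hcls (z + z') = hcls z + hcls z'.
Proof. exact: Quotient.pi_add. Qed.

Definition hscale (a : R) (x : cohomology) : cohomology := hcls (a *: hrep x).
Lemma hscaleE a z : hscale a (hcls z) = hcls (a *: z).
Proof.
apply/hclsP; rewrite /= -scalerBr -[_ *: _]addr0; apply: boundary_lin (boundary0 _).
by apply/hclsP; rewrite hrepK.
Qed.
Lemma hscaleA a b x : hscale a (hscale b x) = hscale (a * b) x.
Proof. by rewrite -[x]hrepK !hscaleE scalerA. Qed.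
Lemma hscale1 : left_id 1 hscale.
Proof. by move=> x; rewrite -[x]hrepK hscaleE scale1r. Qed.
Lemma hscaleDr : right_distributive hscale +%R.
Proof.
by move=> a x y; rewrite -[x]hrepK -[y]hrepK -hclsD !hscaleE scalerDr hclsD.
Qed.
Lemma hscaleDl x : {morph hscale^~ x : a b / a + b}.
Proof. by move=> a b; rewrite -[x]hrepK !hscaleE scalerDl hclsD. Qed.
HB.instance Definition _ := GRing.Zmodule_isLmodule.Build R cohomology
  hscaleA hscale1 hscaleDr hscaleDl.
Lemma hclsZ a z : hcls (a *: z) = a *: hcls z.
Proof. by symmetry; exact: hscaleE. Qed.
End Cohomology.

Section CohomologyMap.
Variables (R S : pzRingType) (sigma : {rmorphism R -> S}).
Variables (C : nat -> lmodType R) (d : forall n, {linear C n -> C n.+1}).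
Variables (C' : nat -> lmodType S) (d' : forall n, {linear C' n -> C' n.+1}).
Variable phi : forall n, C n -> C' n.
Hypothesis phi_lin : forall n, semilinear sigma (@phi n).
Hypothesis phi_d : forall n x, phi (d n x) = d' n (phi x).
Variable i : nat.

Lemma cocycle_map_subproof (z : cocycle d i) : phi (val z) \in @cocycle_pred _ _ d' i.
Proof.
case: z => z /= /eqP hz; apply/eqP.
by rewrite -phi_d hz (semilin0 (@phi_lin _)).
Qed.
Definition cocycle_map (z : cocycle d i) : cocycle d' i :=
  Cocycle (cocycle_map_subproof z).

Lemma boundary_map z : boundary d z -> @boundary _ _ d' i (phi z).
Proof.
case: i z => [z ->|j z [y <-]] /=; first exact: (semilin0 (@phi_lin _)).
by exists (phi y); rewrite phi_d.
Qed.

Definition cohomology_map (x : cohomology d i) : cohomology d' i :=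
  hcls (cocycle_map (hrep x)).

Lemma cohomology_mapE z : cohomology_map (hcls z) = hcls (cocycle_map z).
Proof.
apply/hclsP; rewrite /= -(semilinN (@phi_lin _)) -(semilinD (@phi_lin _)).
by apply: boundary_map; apply/hclsP; rewrite hrepK.
Qed.

Lemma cohomology_map_lin : semilinear sigma cohomology_map.
Proof.
move=> a x y; rewrite -[x]hrepK -[y]hrepK -hclsZ -hclsD !cohomology_mapE.
by rewrite -hclsZ -hclsD; congr (hcls _); apply: val_inj; exact: phi_lin.
Qed.
End CohomologyMap.

Section CohomologySheaf.
Variables (k : comPzRingType) (X : rspace k) (C : nat -> omodule X).
Variables (d : forall n, omhom (C n) (C n.+1)) (i : nat).

Let dst (p : X) n : {linear C n p -> C n.+1 p} := d n p.

Lemma cohom_sheaf_d (p q : X) (h : le p q) n (m : C n p) :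
  mres (C n.+1) h (dst p n m) = dst q n (mres (C n) h m).
Proof. exact: hfun_res. Qed.

Definition cohom_sheaf_res (p q : X) (h : le p q) :
    cohomology (dst p) i -> cohomology (dst q) i :=
  cohomology_map (fun n => @mres_lin k X (C n) p q h) (@cohom_sheaf_d p q h) (i := i).

Lemma cohom_sheaf_res_lin (p q : X) (h : le p q) : semilinear (res h) (cohom_sheaf_res h).
Proof. exact: cohomology_map_lin. Qed.
Lemma cohom_sheaf_res_id (p : X) (h : le p p) x : cohom_sheaf_res h x = x.
Proof.
rewrite -[x]hrepK /cohom_sheaf_res cohomology_mapE; congr (hcls _).
by apply: val_inj; exact: mres_id.
Qed.
Lemma cohom_sheaf_res_comp (p q r : X) (h : le p q) (h' : le q r) (h'' : le p r) x :
  cohom_sheaf_res h' (cohom_sheaf_res h x) = cohom_sheaf_res h'' x.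
Proof.
rewrite -[x]hrepK /cohom_sheaf_res !cohomology_mapE; congr (hcls _).
by apply: val_inj; exact: mres_comp.
Qed.

Definition cohomology_sheaf : omodule X := {|
  mst := fun p => cohomology (dst p) i : lmodType (stalk p);
  mres := cohom_sheaf_res;
  mres_lin := cohom_sheaf_res_lin;
  mres_id := cohom_sheaf_res_id;
  mres_comp := cohom_sheaf_res_comp
|}.
End CohomologySheaf.

Section Injective.
Variables (k : comPzRingType) (X : rspace k).

(* The monomorphisms of sheaves of modules are those injective on stalks. *)
Definition om_mono (M N : omodule X) (u : omhom M N) : Prop :=
  forall p, injective (u p).

Definition om_injective (E : omodule X) : Prop :=
  forall (M N : omodule X) (u : omhom M N), om_mono u ->
    forall g : omhom M E, exists h : omhom N E, om_comp h u = g.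

(* 0 -> M -> E^0 -> E^1 -> .. exact, with every E^n injective *)
Record injective_resolution (M : omodule X) := InjRes {
  ir_obj : nat -> omodule X;
  ir_d : forall n, omhom (ir_obj n) (ir_obj n.+1);
  ir_aug : omhom M (ir_obj 0);
  ir_inj : forall n, om_injective (ir_obj n);
  ir_mono : om_mono ir_aug;
  ir_exact0 : forall (p : X) x, ir_d 0 p x = 0 <-> exists m, ir_aug p m = x;
  ir_exact : forall n (p : X) x, ir_d n.+1 p x = 0 <-> exists y, ir_d n p y = x
}.
End Injective.

(* H^i(X, M), computed from the injective resolution E of M, as an O(X)-module *)
Definition Hcoh (k : comPzRingType) (X : rspace k) (M : omodule X)
    (E : injective_resolution M) (i : nat) : lmodType (osec [set: X]) :=
  cohomology (fun n => sec_map (ir_d E n) (U := [set: X])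
    : {linear sections (ir_obj E n) [set: X] -> sections (ir_obj E n.+1) [set: X]}) i.

(* R^i f_* M, computed from the injective resolution E of M *)
Definition Rpush (k : comPzRingType) (X Y : rspace k) (f : rmap X Y) (M : omodule X)
    (E : injective_resolution M) (i : nat) : omodule Y :=
  cohomology_sheaf (fun n => push_map f (ir_d E n)) i.

Definition zero_module (k : comPzRingType) (X : rspace k) (M : omodule X) : Prop :=
  forall (p : X) (m : M p), m = 0.

(* Derived functors do not depend on the injective resolution, so in the next
   definitions one resolution is as good as all of them. *)

Definition schematic (k : comPzRingType) (X : rspace k) : Prop :=
  exists E : injective_resolution (struct_module X),
    forall i, quasi_coherent (Rpush (diag X) E i).

Definition semi_separated (k : comPzRingType) (X : rspace k) : Prop :=
  quasi_coherent (pushforward (diag X) (struct_module X)) /\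
  exists E : injective_resolution (struct_module X),
    forall i, (0 < i)%N -> zero_module (Rpush (diag X) E i).

Definition acyclic (k : comPzRingType) (X : rspace k) : Prop :=
  exists E : injective_resolution (struct_module X),
    forall i, (0 < i)%N -> forall x : Hcoh E i, x = 0.

Record category := Category {
  obj :> Type;
  hom : obj -> obj -> Type;
  idm : forall a, hom a a;
  compm : forall a b c, hom b c -> hom a b -> hom a c;
  compmA : forall a b c e (h : hom c e) (g : hom b c) (f : hom a b),
    compm h (compm g f) = compm (compm h g) f;
  comp1m : forall a b (f : hom a b), compm (idm b) f = f;
  compm1 : forall a b (f : hom a b), compm f (idm a) = f
}.
Arguments idm {c} a : rename.
Arguments compm {c a b c0} _ _ : rename.

Record functor (C D : category) := Functor {
  fobj :> C -> D;
  fmap : forall a b, hom a b -> hom (fobj a) (fobj b);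
  fmap_id : forall a, fmap (idm a) = idm (fobj a);
  fmap_comp : forall a b c (g : hom b c) (f : hom a b),
    fmap (compm g f) = compm (fmap g) (fmap f)
}.

Definition id_functor (C : category) : functor C C :=
  @Functor C C id (fun a b f => f) (fun a => erefl) (fun a b c g f => erefl).

Section CompFunctor.
Variables (C D E : category) (G : functor D E) (F : functor C D).
Lemma comp_functor_id (a : C) : fmap G (fmap F (idm a)) = idm (G (F a)).
Proof. by rewrite !fmap_id. Qed.
Lemma comp_functor_comp (a b c : C) (g : hom b c) (f : hom a b) :
  fmap G (fmap F (compm g f)) = compm (fmap G (fmap F g)) (fmap G (fmap F f)).
Proof. by rewrite !fmap_comp. Qed.
Definition comp_functor : functor C E :=
  @Functor C E (fun a => G (F a)) (fun a b f => fmap G (fmap F f))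
    comp_functor_id comp_functor_comp.
End CompFunctor.

Definition nat_isomorphic (C D : category) (F G : functor C D) : Prop :=
  exists (t : forall a : C, hom (F a) (G a)) (t' : forall a : C, hom (G a) (F a)),
    [/\ forall (a b : C) (f : hom a b), compm (t b) (fmap F f) = compm (fmap G f) (t a),
        forall a, compm (t' a) (t a) = idm (F a)
      & forall a, compm (t a) (t' a) = idm (G a)].

Definition is_equivalence (C D : category) (F : functor C D) : Prop :=
  exists G : functor D C, nat_isomorphic (comp_functor G F) (id_functor C) /\
                          nat_isomorphic (comp_functor F G) (id_functor D).

Section ModuleCategory.
Variable A : pzRingType.
Definition lin_comp (M N P : lmodType A) (v : {linear N -> P}) (u : {linear M -> N}) :
  {linear M -> P} := v \o u.
Lemma lin_compA (M N P Q : lmodType A) (w : {linear P -> Q}) (v : {linear N -> P})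
    (u : {linear M -> N}) : lin_comp w (lin_comp v u) = lin_comp (lin_comp w v) u.
Proof. exact: linear_ext. Qed.
Lemma lin_comp1 (M N : lmodType A) (u : {linear M -> N}) : lin_comp idfun u = u.
Proof. exact: linear_ext. Qed.
Lemma lin_1comp (M N : lmodType A) (u : {linear M -> N}) : lin_comp u idfun = u.
Proof. exact: linear_ext. Qed.
Definition Mod : category :=
  Category lin_compA lin_comp1 lin_1comp.
End ModuleCategory.

Section QuasiCoherentCategory.
Variables (k : comPzRingType) (X : rspace k).

Record qc_module := QCModule { qc_val :> omodule X; qc_valP : quasi_coherent qc_val }.

Lemma om_compA (M N P Q : qc_module) (w : omhom P Q) (v : omhom N P) (u : omhom M N) :
  om_comp w (om_comp v u) = om_comp (om_comp w v) u.
Proof. exact: omhom_ext. Qed.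
Lemma om_comp1 (M N : qc_module) (u : omhom M N) : om_comp (om_id N) u = u.
Proof. exact: omhom_ext. Qed.
Lemma om_1comp (M N : qc_module) (u : omhom M N) : om_comp u (om_id M) = u.
Proof. exact: omhom_ext. Qed.
Definition QCoh : category :=
  @Category qc_module (fun M N => omhom M N) (fun M => om_id M)
    (fun M N P v u => om_comp v u) om_compA om_comp1 om_1comp.

Definition gamma_map (M N : qc_module) (u : omhom M N) :
    {linear sections M [set: X] -> sections N [set: X]} := sec_map u (U := [set: X]).
Lemma gamma_id (M : qc_module) :
  gamma_map (om_id M) = (idfun : {linear sections M [set: X] -> sections M [set: X]}).
Proof. by apply: linear_ext => s; exact: sections_ext. Qed.
Lemma gamma_comp (M N P : qc_module) (v : omhom N P) (u : omhom M N) :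
  gamma_map (om_comp v u) = lin_comp (gamma_map v) (gamma_map u).
Proof. by apply: linear_ext => s; exact: sections_ext. Qed.

Definition global_sections : functor QCoh (Mod (osec [set: X])) :=
  @Functor QCoh (Mod (osec [set: X]))
    (fun M : qc_module => sections M [set: X] : lmodType (osec [set: X]))
    gamma_map gamma_id gamma_comp.
End QuasiCoherentCategory.

Definition affine (k : comPzRingType) (X : rspace k) : Prop :=
  acyclic X /\ is_equivalence (global_sections X).

(* Main.v *)
(** Everything is computed with the standard resolution attached to the embedding of a module [M]
    into the product [god M] of the skyscrapers of its stalks; [gquo M] is the cokernel. Retracts
    of modules [god M] are acyclic, and so are injectives, so that both kinds of resolution compute
    the same cohomology. A module is quasi-coherent if and only if its restriction maps
    [M_p -> M_q] are base changes along [O_p -> O_q], and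
    [(R^i delta_* O)_(p,q) = H^i(U_p inter U_q, O)].

    Let [X] be affine and schematic, and fix [p]. The restriction of [R^i delta_* O] to
    [{p} x X = X] is the [i]-th cohomology of the complex of acyclic modules [j_* j^* E^n], where
    [E] is an injective resolution of [O] and [j] the inclusion of [U_p]. These cohomology modules
    are quasi-coherent, hence acyclic since [X] is affine, so their global sections are the
    cohomology of the complex of global sections, that is, [H^i(U_p, O) = 0] for [i > 0]. A
    quasi-coherent module without global sections on an affine space is zero.

    If [X] is schematic, then [R^i delta_* O] at [(x,y)] with [x, y >= p] is a base change of its
    stalk at [(p,p)], which is [H^i(U_p, O)]; so [U_p] is semi-separated. Conversely, if the [U_p]
    are semi-separated and [p <= p'], then the direct image of [O] from [U_p'] to [U_p] is
    the base change of [O] to [O_p'] and has no higher direct images; as [O_p -> O_p'] is flat,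
    the standard resolution gives
    [H^i(U_p inter U_q, O) (x) O_p' = H^i(U_p' inter U_q, O)], and [X] is schematic. *)

From HB Require Import structures.
From mathcomp Require Import all_boot all_algebra.
From mathcomp Require Import generic_quotient ring.
From mathcomp Require Import boolp classical_sets functions cardinality.
Require Import Defs.

Set Implicit Arguments.
Unset Strict Implicit.
Unset Printing Implicit Defensive.

Import GRing.Theory.
Local Open Scope ring_scope.

(** * Standard resolution *)

Section OmoduleTheory.
Variables (k : comPzRingType) (X : rspace k) (M : omodule X).
Lemma mresD (p q : X) (h : le p q) (m n : M p) : mres M h (m + n) = mres M h m + mres M h n.
Proof. exact: semilinD (mres_lin h) _ _. Qed.
Lemma mres0 (p q : X) (h : le p q) : mres M h 0 = 0.
Proof. exact: semilin0 (mres_lin h). Qed.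
Lemma mresN (p q : X) (h : le p q) (m : M p) : mres M h (- m) = - mres M h m.
Proof. exact: semilinN (mres_lin h) _. Qed.
Lemma mresB (p q : X) (h : le p q) (m n : M p) : mres M h (m - n) = mres M h m - mres M h n.
Proof. by rewrite mresD mresN. Qed.
Lemma mresZ (p q : X) (h : le p q) a (m : M p) : mres M h (a *: m) = res h a *: mres M h m.
Proof. exact: semilinZ (mres_lin h) _ _. Qed.
Lemma mres_irr (p q : X) (h h' : le p q) (m : M p) : mres M h m = mres M h' m.
Proof. by rewrite (bool_irrelevance h h'). Qed.
End OmoduleTheory.

Section Representative.
Variables (k : comPzRingType) (X : rspace k).

(* [le] is only a preorder, so each class of [le x y && le y x] gets a representative;
   otherwise [gquo] below would not be nilpotent. *)
Definition rep (x : X) : X := odflt x [pick y : X | le x y && le y x].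

Lemma repP x : le x (rep x) && le (rep x) x.
Proof.
rewrite /rep; case: pickP => [y //|/(_ x)]; by rewrite le_refl.
Qed.
Lemma le_rep x : le x (rep x). Proof. by case/andP: (repP x). Qed.
Lemma rep_le x : le (rep x) x. Proof. by case/andP: (repP x). Qed.
Lemma rep_eq x y : le x y -> le y x -> rep x = rep y.
Proof.
move=> xy yx; rewrite /rep.
have e : (fun z : X => le x z && le z x) =1 (fun z => le y z && le z y).
  move=> z; apply/andP/andP => -[h1 h2]; split.
  - exact: le_trans yx h1.
  - exact: le_trans h2 xy.
  - exact: le_trans xy h1.
  - exact: le_trans h2 yx.
by rewrite (eq_pick e); case: pickP => // /(_ y); rewrite le_refl.
Qed.
Lemma rep_rep x : rep (rep x) = rep x.
Proof. exact/esym/rep_eq/rep_le/le_rep. Qed.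

Definition isrep : pred X := fun y => rep y == y.
Lemma isrep_rep x : isrep (rep x). Proof. by rewrite /isrep rep_rep. Qed.
End Representative.

(* The product over the [y >= x] with [S y] of the skyscraper modules [J y]. *)
Section Coinduced.
Variables (k : comPzRingType) (X : rspace k).
Variables (J : forall y : X, lmodType (stalk y)) (S : pred X).

Definition cofam (x : X) : Type := forall y : X, le x y && S y -> J y.
HB.instance Definition _ x := gen_eqMixin (cofam x).
HB.instance Definition _ x := gen_choiceMixin (cofam x).

Lemma cofam_ext x (m n : cofam x) : (forall y h, m y h = n y h) -> m = n.
Proof.
by move=> e; apply: functional_extensionality_dep => y;
  apply: functional_extensionality_dep => h.
Qed.

Definition cofam0 x : cofam x := fun=> fun=> 0.
Definition cofamN x (m : cofam x) : cofam x := fun y h => - m y h.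
Definition cofamD x (m n : cofam x) : cofam x := fun y h => m y h + n y h.
Lemma cofamDA x : associative (@cofamD x).
Proof. by move=> m n l; apply: cofam_ext => y h; exact: addrA. Qed.
Lemma cofamDC x : commutative (@cofamD x).
Proof. by move=> m n; apply: cofam_ext => y h; exact: addrC. Qed.
Lemma cofamD0 x : left_id (@cofam0 x) (@cofamD x).
Proof. by move=> m; apply: cofam_ext => y h; exact: add0r. Qed.
Lemma cofamDN x : left_inverse (@cofam0 x) (@cofamN x) (@cofamD x).
Proof. by move=> m; apply: cofam_ext => y h; exact: addNr. Qed.
HB.instance Definition _ x := GRing.isZmodule.Build (cofam x)
  (@cofamDA x) (@cofamDC x) (@cofamD0 x) (@cofamDN x).

Lemma cof_le (x y : X) : le x y && S y -> le x y. Proof. by case/andP. Qed.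
Definition cofamZ x (a : stalk x) (m : cofam x) : cofam x :=
  fun y h => res (cof_le h) a *: m y h.
Lemma cofamZA x a b m : @cofamZ x a (cofamZ b m) = cofamZ (a * b) m.
Proof. by apply: cofam_ext => y h; rewrite /cofamZ scalerA rmorphM. Qed.
Lemma cofamZ1 x : left_id 1 (@cofamZ x).
Proof. by move=> m; apply: cofam_ext => y h; rewrite /cofamZ rmorph1 scale1r. Qed.
Lemma cofamZDr x : right_distributive (@cofamZ x) +%R.
Proof. by move=> a m n; apply: cofam_ext => y h; exact: scalerDr. Qed.
Lemma cofamZDl x m : {morph (@cofamZ x)^~ m : a b / a + b}.
Proof. by move=> a b; apply: cofam_ext => y h; rewrite /cofamZ rmorphD; exact: scalerDl. Qed.
HB.instance Definition _ x := GRing.Zmodule_isLmodule.Build (stalk x) (cofam x)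
  (@cofamZA x) (@cofamZ1 x) (@cofamZDr x) (@cofamZDl x).

Lemma cofam_linE x (a : stalk x) (m n : cofam x) y h :
  (a *: m + n) y h = res (cof_le h) a *: m y h + n y h.
Proof. by []. Qed.
Lemma cofamDE x (m n : cofam x) y h : (m + n) y h = m y h + n y h.
Proof. by []. Qed.
Lemma cofamNE x (m : cofam x) y h : (- m) y h = - m y h.
Proof. by []. Qed.

Lemma cof_up (x x' y : X) : le x x' -> le x' y && S y -> le x y && S y.
Proof. by move=> xx' /andP[x'y ->]; rewrite (le_trans xx' x'y). Qed.
Definition cofam_res x x' (h : le x x') (m : cofam x) : cofam x' :=
  fun y hy => m y (cof_up h hy).
Lemma cofam_res_lin x x' (h : le x x') : semilinear (res h) (cofam_res h).
Proof.
move=> a m n; apply: cofam_ext => y hy; congr (_ *: _ + _).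
by rewrite (res_comp h _ (cof_le (cof_up h hy))).
Qed.
Lemma cofam_res_id x (h : le x x) m : cofam_res h m = m.
Proof. by apply: cofam_ext => y hy; congr (m y _); exact: bool_irrelevance. Qed.
Lemma cofam_res_comp x x' x'' (h : le x x') (h' : le x' x'') (h'' : le x x'') m :
  cofam_res h' (cofam_res h m) = cofam_res h'' m.
Proof. by apply: cofam_ext => y hy; congr (m y _); exact: bool_irrelevance. Qed.

Definition coind : omodule X := {|
  mst := fun x => cofam x : lmodType (stalk x);
  mres := cofam_res;
  mres_lin := cofam_res_lin;
  mres_id := cofam_res_id;
  mres_comp := cofam_res_comp
|}.
End Coinduced.

Section Godement.
Variables (k : comPzRingType) (X : rspace k).
Implicit Types M N : omodule X.

Definition god M : omodule X := coind M (@isrep k X).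

Lemma rep_up (x : X) : le x (rep x) && isrep (rep x).
Proof. by rewrite le_rep isrep_rep. Qed.

Lemma god_irr M (x : X) (m : god M x) y (h h' : le x y && isrep y) : m y h = m y h'.
Proof. by rewrite (bool_irrelevance h h'). Qed.

Section Unit.
Variable M : omodule X.
Definition unit_fun (x : X) (m : M x) : god M x := fun y h => mres M (cof_le h) m.
Lemma unit_lin x : linear (@unit_fun x).
Proof. by move=> a m n; apply: cofam_ext => y h; exact: mres_lin. Qed.
HB.instance Definition _ x := GRing.isLinear.Build (stalk x) (M x) (god M x) _
  (@unit_fun x) (@unit_lin x).
Lemma unit_res (x x' : X) (h : le x x') m :
  mres (god M) h (unit_fun m) = unit_fun (mres M h m).
Proof.
by apply: cofam_ext => y hy; rewrite /unit_fun (mres_comp h _ (cof_le (cof_up h hy))).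
Qed.
Definition unit : omhom M (god M) :=
  OMHom (hfun := fun x => @unit_fun x : {linear M x -> god M x}) unit_res.

Lemma unit_inj x : injective (unit x).
Proof.
move=> m n /(congr1 (fun f : god M x => f _ (rep_up x))) /=.
move/(congr1 (mres M (rep_le x))).
by rewrite /unit_fun !(mres_comp _ _ (le_refl x)) !mres_id.
Qed.
End Unit.

Section Quotient.
Variable M : omodule X.

Definition gquo_pred x : {pred cofam M (@isrep k X) x} := fun m => m (rep x) (rep_up x) == 0.
Lemma gquo_closed x : submod_closed (@gquo_pred x).
Proof.
split=> [|a m n /eqP hm /eqP hn]; apply/eqP => //.
have -> : (a *: m + n) (rep x) (rep_up x) =
  res (cof_le (rep_up x)) a *: m (rep x) (rep_up x) + n (rep x) (rep_up x) by [].
by rewrite hm hn scaler0 addr0.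
Qed.
HB.instance Definition _ x := GRing.isSubmodClosed.Build (stalk x)
  (cofam M (@isrep k X) x) (@gquo_pred x) (@gquo_closed x).

(* Subtracting from a family the image of its component at [rep x] identifies the cokernel of
   [unit] at [x] with the families that vanish at [rep x]. *)
Record gquo_st x := GQuo { gquo_val :> cofam M (@isrep k X) x; _ : gquo_val \in @gquo_pred x }.
Arguments gquo_val {x} _ y h : rename.
HB.instance Definition _ x := [isSub for @gquo_val x].
HB.instance Definition _ x := [Choice of gquo_st x by <:].
HB.instance Definition _ x := [SubChoice_isSubLmodule of gquo_st x by <:].

Lemma gquo_rep x (m : gquo_st x) h : gquo_val m (rep x) h = 0.
Proof. by case: m => m /= /eqP <-; congr (m _ _); exact: bool_irrelevance. Qed.

Lemma gquo_ext x (m n : gquo_st x) :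
  (forall y h, gquo_val m y h = gquo_val n y h) -> m = n.
Proof. by move=> e; apply/val_inj/cofam_ext. Qed.

Lemma le_rep_up (x y : X) : le x y && isrep y -> le (rep x) y.
Proof. by case/andP=> xy _; exact: le_trans (rep_le x) xy. Qed.

Definition gproj_fam x (m : cofam M (@isrep k X) x) : cofam M (@isrep k X) x :=
  fun y h => m y h - mres M (le_rep_up h) (m (rep x) (rep_up x)).
Lemma gproj_subproof x m : @gproj_fam x m \in @gquo_pred x.
Proof. by apply/eqP; rewrite /gproj_fam mres_id subrr. Qed.
Definition gproj_fun x (m : cofam M (@isrep k X) x) : gquo_st x := GQuo (gproj_subproof m).
Lemma gproj_lin x : linear (@gproj_fun x).
Proof.
move=> a m n; apply: gquo_ext => y h /=; rewrite /gproj_fam.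
rewrite !cofam_linE /= mres_lin opprD addrACA (res_comp _ _ (cof_le h)) /gproj_fam.
by rewrite -scalerBr.
Qed.
HB.instance Definition _ x := GRing.isLinear.Build (stalk x) (cofam M (@isrep k X) x)
  (gquo_st x) _ (@gproj_fun x) (@gproj_lin x).

Definition gquo_res x x' (h : le x x') (m : gquo_st x) : gquo_st x' :=
  gproj_fun (cofam_res h (gquo_val m)).
Lemma gproj_res x x' (h : le x x') m : gquo_res h (gproj_fun m) = gproj_fun (cofam_res h m).
Proof.
apply: gquo_ext => y hy /=; rewrite /gproj_fam /cofam_res /=.
rewrite mresB (mres_comp _ _ (le_rep_up (cof_up h hy))).
rewrite opprB addrA subrK.
congr (_ - _); exact: mres_irr.
Qed.

Lemma gproj_id x (m : gquo_st x) : gproj_fun (gquo_val m) = m.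
Proof. by apply: gquo_ext => y h; rewrite /= /gproj_fam gquo_rep mres0 subr0. Qed.

Lemma gquo_res_lin x x' (h : le x x') : semilinear (res h) (gquo_res h).
Proof. by move=> a m n; rewrite /gquo_res /= cofam_res_lin linearP. Qed.
Lemma gquo_res_id x (h : le x x) m : gquo_res h m = m.
Proof. by rewrite /gquo_res cofam_res_id gproj_id. Qed.
Lemma gquo_res_comp (x x' x'' : X) (h : le x x') (h' : le x' x'') (h'' : le x x'') m :
  gquo_res h' (gquo_res h m) = gquo_res h'' m.
Proof. by rewrite {2}/gquo_res gproj_res (cofam_res_comp _ _ h''). Qed.

Definition gquo : omodule X := {|
  mst := fun x => gquo_st x : lmodType (stalk x);
  mres := gquo_res;
  mres_lin := gquo_res_lin;
  mres_id := gquo_res_id;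
  mres_comp := gquo_res_comp
|}.

Definition gproj : omhom (god M) gquo :=
  OMHom (N := gquo) (hfun := fun x => @gproj_fun x : {linear god M x -> gquo x}) gproj_res.

Lemma gproj_unit x m : gproj x (unit M x m) = 0.
Proof.
apply: gquo_ext => y h; rewrite /= /gproj_fam /= /unit_fun.
by rewrite (mres_comp _ _ (cof_le h)) subrr.
Qed.
Lemma gproj_ker x m : gproj x m = 0 -> exists n, unit M x n = m.
Proof.
move=> e; exists (mres M (rep_le x) (m (rep x) (rep_up x))).
apply: cofam_ext => y h; rewrite /= /unit_fun (mres_comp _ _ (le_rep_up h)).
have := congr1 (fun f : gquo_st x => gquo_val f y h) e.
by rewrite /= /gproj_fam => /eqP; rewrite subr_eq0 => /eqP.
Qed.
Lemma gproj_surj x m : exists n, gproj x n = m.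
Proof. by exists (gquo_val m); exact: gproj_id. Qed.
End Quotient.

Section Maps.
Variables (M N : omodule X) (u : omhom M N).

Definition god_map_fun (x : X) (m : god M x) : god N x := fun y h => u y (m y h).
Lemma god_map_lin x : linear (@god_map_fun x).
Proof.
by move=> a m n; apply: cofam_ext => y h; rewrite /god_map_fun !cofam_linE linearP.
Qed.
HB.instance Definition _ x := GRing.isLinear.Build (stalk x) (god M x) (god N x) _
  (@god_map_fun x) (@god_map_lin x).
Lemma god_map_res (x x' : X) (h : le x x') m :
  mres (god N) h (god_map_fun m) = god_map_fun (mres (god M) h m).
Proof. by []. Qed.
Definition god_map : omhom (god M) (god N) :=
  OMHom (hfun := fun x => @god_map_fun x : {linear god M x -> god N x}) god_map_res.

Lemma gquo_map_subproof (x : X) (m : gquo_st M x) :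
  god_map_fun (gquo_val m) \in @gquo_pred N x.
Proof. by apply/eqP; rewrite /god_map_fun gquo_rep linear0. Qed.
Definition gquo_map_fun (x : X) (m : gquo M x) : gquo N x := GQuo (gquo_map_subproof m).
Lemma gquo_map_lin x : linear (@gquo_map_fun x).
Proof. by move=> a m n; apply/val_inj; exact: god_map_lin. Qed.
HB.instance Definition _ x := GRing.isLinear.Build (stalk x) (gquo M x) (gquo N x) _
  (@gquo_map_fun x) (@gquo_map_lin x).
Lemma gquo_map_gproj (x : X) m : gquo_map_fun (gproj M x m) = gproj N x (god_map_fun m).
Proof.
by apply: gquo_ext => y h; rewrite /= /god_map_fun /= /gproj_fam linearB hfun_res.
Qed.
Lemma gquo_map_res (x x' : X) (h : le x x') m :
  mres (gquo N) h (gquo_map_fun m) = gquo_map_fun (mres (gquo M) h m).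
Proof. by rewrite [RHS]gquo_map_gproj. Qed.
Definition gquo_map : omhom (gquo M) (gquo N) :=
  OMHom (hfun := fun x => @gquo_map_fun x : {linear gquo M x -> gquo N x}) gquo_map_res.
End Maps.

Lemma unit_nat M N (u : omhom M N) (x : X) m : unit N x (u x m) = god_map u x (unit M x m).
Proof. by apply: cofam_ext => y h; rewrite /= /unit_fun /god_map_fun hfun_res. Qed.

Fixpoint gquon (n : nat) M : omodule X := if n is n'.+1 then gquo (gquon n' M) else M.
Fixpoint gquon_map (n : nat) M N (u : omhom M N) : omhom (gquon n M) (gquon n N) :=
  match n with 0 => u | n'.+1 => gquo_map (gquon_map n' u) end.
End Godement.
Arguments gproj {k X} M.
Arguments unit {k X} M.
Arguments gquo_val {k X M x} _ y h : rename.

Section SectionTheory.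
Variables (k : comPzRingType) (X : rspace k) (V : {set X}).
Hypothesis Vop : is_open V.
Implicit Types A B C M N : omodule X.

Lemma secDE M (s t : sections M V) x (hx : x \in V) : (s + t) x hx = s x hx + t x hx.
Proof. by []. Qed.

Lemma sec_eq M (s t : sections M V) : s = t -> forall x (hx : x \in V), s x hx = t x hx.
Proof. by move=> ->. Qed.
Lemma sec_irr M (s : sections M V) x (h h' : x \in V) : s x h = s x h'.
Proof. by rewrite (bool_irrelevance h h'). Qed.

Definition gsec M (t : forall y, y \in V -> isrep y -> M y) : sections (god M) V :=
  @Sections k X (god M) V
    (fun x hx y h => t y (Vop (cof_le h) hx) (proj2 (andP h)))
    (fun p q h hp hq => cofam_ext (fun y hy =>
       congr2 (t y) (bool_irrelevance _ _) (bool_irrelevance _ _))).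

Lemma gsecE M t x (hx : x \in V) y (h : le x y && isrep y) (hy : y \in V) (ry : isrep y) :
  gsec (M := M) t x hx y h = t y hy ry.
Proof. by congr (t y); exact: bool_irrelevance. Qed.

Lemma le_repn (y : X) (ry : isrep y) : le y y && isrep y.
Proof. by rewrite le_refl ry. Qed.

Lemma god_sec M (s : sections (god M) V) x (hx : x \in V) y (h : le x y && isrep y)
    (hy : y \in V) (ry : isrep y) :
  s x hx y h = s y hy y (le_repn ry).
Proof.
rewrite -(sec_res s (cof_le h) hx hy) /= /cofam_res; congr (s x hx y _).
exact: bool_irrelevance.
Qed.

(* The cocycle identity: sections of [gquo M] are 1-cocycles with values in [M]. *)
Lemma gquo_sec M (s : sections (gquo M) V) (x x' : X) (h : le x x') (hx : x \in V)
    (hx' : x' \in V) y (hy : le x' y && isrep y) (hxy : le x y && isrep y) :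
  gquo_val (s x' hx') y hy = gquo_val (s x hx) y hxy -
    mres M (le_rep_up hy) (gquo_val (s x hx) (rep x') (cof_up h (rep_up x'))).
Proof.
rewrite -(sec_res s h hx hx') /= /gproj_fam /cofam_res; congr (_ - _).
exact: god_irr.
Qed.

Section LeftExact.
Variables (A B C : omodule X) (u : omhom A B) (v : omhom B C).

Lemma sec_lift (s : sections B V) :
  (forall x, x \in V -> injective (u x)) ->
  (forall x (hx : x \in V), exists a, u x a = s x hx) ->
  exists t : sections A V, sec_map u t = s.
Proof.
move=> ui us; pose t x hx := projT1 (cid (us x hx)).
have tE x hx : u x (t x hx) = s x hx by exact: projT2 (cid (us x hx)).
have tres p q (h : le p q) (hp : p \in V) (hq : q \in V) : mres A h (t p hp) = t q hq.
  by apply: (ui q hq); rewrite tE -hfun_res tE; exact: sec_res.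
by exists (Sections tres); apply: sections_ext => x hx; exact: tE.
Qed.

Lemma god_epi :
  (forall x, x \in V -> forall c, exists b, v x b = c) ->
  forall s : sections (god C) V, exists t : sections (god B) V, sec_map (god_map v) t = s.
Proof.
move=> vs s; pose w y hy ry := projT1 (cid (vs y hy (s y hy y (le_repn ry)))).
have wE y hy ry : v y (w y hy ry) = s y hy y (le_repn ry).
  exact: projT2 (cid (vs y hy (s y hy y (le_repn ry)))).
exists (gsec w); apply: sections_ext => x hx; apply: cofam_ext => y h.
have hy := Vop (cof_le h) hx; have ry := proj2 (andP h).
rewrite -[LHS]/(v y (gsec w x hx y h)).
by rewrite (gsecE w hx h hy ry) wE (god_sec s hx h hy ry).
Qed.
End LeftExact.

Record ses A B C (u : omhom A B) (v : omhom B C) : Prop := Ses {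
  ses_mono : forall x, x \in V -> injective (u x);
  ses_comp : forall x, x \in V -> forall a, v x (u x a) = 0;
  ses_ker : forall x, x \in V -> forall b, v x b = 0 -> exists a, u x a = b;
  ses_epi : forall x, x \in V -> forall c, exists b, v x b = c
}.

Lemma ses_sec A B C (u : omhom A B) (v : omhom B C) (s : sections B V) :
  ses u v -> sec_map v s = 0 -> exists t, sec_map u t = s.
Proof.
move=> H e; apply: sec_lift; first exact: ses_mono H.
move=> x hx; apply: (ses_ker H) => //.
exact: (congr1 (fun s : sections C V => s x hx) e).
Qed.

Lemma unit_ses M : ses (unit M) (gproj M).
Proof.
split=> x _; first exact: unit_inj.
- exact: gproj_unit.
- exact: gproj_ker.
- exact: gproj_surj.
Qed.

Lemma gquo_ses A B C (u : omhom A B) (v : omhom B C) :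
  ses u v -> ses (gquo_map u) (gquo_map v).
Proof.
move=> H; split=> x hx.
- move=> m n e; apply: gquo_ext => y h.
  apply: (ses_mono H (Vop (cof_le h) hx)).
  exact: (congr1 (fun f : gquo_st B x => gquo_val f y h) e).
- move=> a; apply: gquo_ext => y h.
  exact: (ses_comp H (Vop (cof_le h) hx)).
- move=> b e.
  have bu y (h : le x y && isrep y) : exists a, u y a = gquo_val b y h.
    apply: (ses_ker H (Vop (cof_le h) hx)).
    exact: (congr1 (fun f : gquo_st C x => gquo_val f y h) e).
  pose a y h := projT1 (cid (bu y h)).
  have aE y h : u y (a y h) = gquo_val b y h by exact: projT2 (cid (bu y h)).
  have aP : (a : cofam A _ _) \in @gquo_pred _ _ A x.
    apply/eqP/(ses_mono H (Vop (le_rep x) hx)).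
    by rewrite aE gquo_rep linear0.
  by exists (GQuo aP); apply: gquo_ext => y h; exact: aE.
- move=> c.
  have cv y (h : le x y && isrep y) : exists b, v y b = gquo_val c y h.
    exact: (ses_epi H (Vop (cof_le h) hx)).
  pose b y h := projT1 (cid (cv y h)).
  have bE y h : v y (b y h) = gquo_val c y h by exact: projT2 (cid (cv y h)).
  exists (gproj B x (b : god B x)).
  rewrite [LHS](gquo_map_gproj v).
  rewrite -[RHS]gproj_id; congr (gproj C x _).
  by apply: cofam_ext => y h; exact: bE.
Qed.

Lemma gquon_ses n A B C (u : omhom A B) (v : omhom B C) :
  ses u v -> ses (gquon_map n u) (gquon_map n v).
Proof. by move=> H; elim: n => //= n IH; exact: gquo_ses. Qed.

Lemma sec_map_gquo A B (u : omhom A B) (s : sections (god A) V) :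
  sec_map (gquo_map u) (sec_map (gproj A) s) = sec_map (gproj B) (sec_map (god_map u) s).
Proof. by apply: sections_ext => x hx; exact: gquo_map_gproj. Qed.

Lemma sec_map_gproj_unit A (s : sections A V) : sec_map (gproj A) (sec_map (unit A) s) = 0.
Proof. by apply: sections_ext => x hx; exact: gproj_unit. Qed.

(* [h1 M] says that H^1(V, M) = 0, so that [h1 (gquon n M)] says H^(n+1)(V, M) = 0. *)
Definition h1 M : Prop := forall s : sections (gquo M) V, exists t, sec_map (gproj M) t = s.

Lemma h1_epi A B C (u : omhom A B) (v : omhom B C) (H : ses u v) :
  h1 A -> forall s : sections C V, exists t, sec_map v t = s.
Proof.
move=> hA s.
have [b bE] := god_epi (ses_epi H) (sec_map (unit C) s).
have [a aE] : exists a, sec_map (gquo_map u) a = sec_map (gproj B) b.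
  by apply: ses_sec (gquo_ses H) _; rewrite sec_map_gquo bE sec_map_gproj_unit.
have [a' a'E] := hA a.
have [b' b'E] : exists b', sec_map (unit B) b' = b - sec_map (god_map u) a'.
  apply: ses_sec (unit_ses B) _.
  by rewrite linearB /= -sec_map_gquo a'E aE subrr.
exists b'; apply: sections_ext => x hx.
apply: (@unit_inj k X C x).
have -> : unit C x (sec_map v b' x hx) = god_map v x (unit B x (b' x hx)) by exact: unit_nat.
have -> : unit B x (b' x hx) = b x hx - god_map u x (a' x hx) by exact: (sec_eq b'E hx).
have -> : unit C x (s x hx) = god_map v x (b x hx) by exact/esym/(sec_eq bE hx).
rewrite linearB (_ : god_map v x (god_map u x _) = 0) ?subr0 //.
by apply: cofam_ext => y h; exact: (ses_comp H (Vop (cof_le h) hx)).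
Qed.

Lemma god_ses A B C (u : omhom A B) (v : omhom B C) :
  ses u v -> ses (god_map u) (god_map v).
Proof.
move=> H; split=> x hx.
- move=> m n e; apply: cofam_ext => y h.
  apply: (ses_mono H (Vop (cof_le h) hx)).
  exact: (congr1 (fun f : god B x => f y h) e).
- by move=> a; apply: cofam_ext => y h; exact: (ses_comp H (Vop (cof_le h) hx)).
- move=> b e.
  have bu y (h : le x y && isrep y) : exists a, u y a = b y h.
    apply: (ses_ker H (Vop (cof_le h) hx)).
    exact: (congr1 (fun f : god C x => f y h) e).
  exists (fun y h => projT1 (cid (bu y h))); apply: cofam_ext => y h.
  exact: projT2 (cid (bu y h)).
- move=> c.
  have cv y (h : le x y && isrep y) : exists b, v y b = c y h.
    exact: (ses_epi H (Vop (cof_le h) hx)).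
  exists (fun y h => projT1 (cid (cv y h))); apply: cofam_ext => y h.
  exact: projT2 (cid (cv y h)).
Qed.

Lemma sec_inj A B (u : omhom A B) (s t : sections A V) :
  (forall x, x \in V -> injective (u x)) -> sec_map u s = sec_map u t -> s = t.
Proof.
move=> ui e; apply: sections_ext => x hx; apply: (ui x hx).
exact: (sec_eq e hx).
Qed.

Section LongExact.
Variables (A B C : omodule X) (u : omhom A B) (v : omhom B C).
Hypothesis H : ses u v.

Lemma h1_coker : h1 (gquo A) -> h1 B -> h1 C.
Proof.
move=> hA hB s.
have [b bE] := h1_epi (gquo_ses H) hA s.
have [t tE] := hB b.
by exists (sec_map (god_map v) t); rewrite -sec_map_gquo tE.
Qed.

Lemma h1_mid : h1 A -> h1 C -> h1 B.
Proof.
move=> hA hC s; have [c cE] := hC (sec_map (gquo_map v) s).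
have [b bE] := god_epi (ses_epi H) c.
have [a aE] : exists a, sec_map (gquo_map u) a = s - sec_map (gproj B) b.
  apply: ses_sec (gquo_ses H) _.
  by rewrite linearB /= sec_map_gquo bE cE subrr.
have [a' a'E] := hA a.
exists (sec_map (god_map u) a' + b).
by rewrite linearD /= -sec_map_gquo a'E aE subrK.
Qed.

End LongExact.

Definition acyc M : Prop := forall n, h1 (gquon n M).

Lemma acyc_epi A B C (u : omhom A B) (v : omhom B C) (H : ses u v) :
  acyc A -> forall s : sections C V, exists t, sec_map v t = s.
Proof. by move=> hA; exact: h1_epi H (hA 0). Qed.
Lemma acyc_coker A B C (u : omhom A B) (v : omhom B C) (H : ses u v) :
  acyc A -> acyc B -> acyc C.
Proof.
by move=> hA hB n; exact: (h1_coker (gquon_ses n H)) (hA n.+1) (hB n).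
Qed.
Lemma acyc_mid A B C (u : omhom A B) (v : omhom B C) (H : ses u v) :
  acyc A -> acyc C -> acyc B.
Proof. by move=> hA hB n; exact: (h1_mid (gquon_ses n H)) (hA n) (hB n). Qed.

Lemma h1_zero M : (forall x, x \in V -> forall m : M x, m = 0) -> h1 M.
Proof.
move=> M0 s; exists 0; apply: sections_ext => x hx; apply: gquo_ext => y h.
by rewrite [LHS]M0 ?[RHS]M0 //; exact: Vop (cof_le h) hx.
Qed.
Lemma gquon_zero n M : (forall x, x \in V -> forall m : M x, m = 0) ->
  forall x, x \in V -> forall m : gquon n M x, m = 0.
Proof.
move=> M0; elim: n => [|n IH] //= x hx m; apply: gquo_ext => y h.
by rewrite [LHS]IH ?[RHS]IH //; exact: Vop (cof_le h) hx.
Qed.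
Lemma acyc_zero M : (forall x, x \in V -> forall m : M x, m = 0) -> acyc M.
Proof. by move=> M0 n; exact/h1_zero/gquon_zero. Qed.
End SectionTheory.

(** * Acyclic modules *)

Section RelInjective.
Variables (k : comPzRingType) (X : rspace k).
Implicit Types M N : omodule X.

(* Weaker than injectivity, but still implies acyclicity, and, unlike injectivity, stable by
   restriction to open subsets for trivial reasons. *)
Definition rel_inj M : Prop :=
  exists r : omhom (god M) M, forall x m, r x (unit M x m) = m.

Lemma rel_inj_retract M N (i : omhom N M) (r : omhom M N) :
  (forall x n, r x (i x n) = n) -> rel_inj M -> rel_inj N.
Proof.
move=> ri [rM rMK]; exists (om_comp r (om_comp rM (god_map i))) => x n.
by rewrite -[LHS]/(r x (rM x (god_map i x (unit N x n)))) -unit_nat rMK.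
Qed.

Section RelInjGod.
Variable M : omodule X.
Definition god_mult_fun (x : X) (m : god (god M) x) : god M x :=
  fun y h => m y h y (le_repn (proj2 (andP h))).
Lemma god_mult_lin x : linear (@god_mult_fun x).
Proof.
move=> a m n; apply: cofam_ext => y h; rewrite /god_mult_fun !cofam_linE /=.
by rewrite res_id.
Qed.
HB.instance Definition _ x := GRing.isLinear.Build (stalk x) (god (god M) x) (god M x) _
  (@god_mult_fun x) (@god_mult_lin x).
Lemma god_mult_res (x x' : X) (h : le x x') m :
  mres (god M) h (god_mult_fun m) = god_mult_fun (mres (god (god M)) h m).
Proof.
apply: cofam_ext => y hy; rewrite /= /god_mult_fun /cofam_res.
exact: god_irr.
Qed.
Definition god_mult : omhom (god (god M)) (god M) :=
  OMHom (hfun := fun x => @god_mult_fun x : {linear god (god M) x -> god M x}) god_mult_res.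

Lemma rel_inj_god : rel_inj (god M).
Proof.
exists god_mult => x m; apply: cofam_ext => y h.
rewrite /= /god_mult_fun /unit_fun /= /cofam_res; exact: god_irr.
Qed.
End RelInjGod.

Section RelInjQuo.
Variables (M : omodule X) (r : omhom (god M) M).
Hypothesis rK : forall x m, r x (unit M x m) = m.

Definition gquo_split_fun (x : X) (q : gquo M x) : god M x :=
  gquo_val q - unit M x (r x (gquo_val q)).
Lemma gquo_split_lin x : linear (@gquo_split_fun x).
Proof.
move=> a m n; rewrite /gquo_split_fun.
rewrite -[gquo_val (_ + _)]/(a *: gquo_val m + gquo_val n : god M x).
by rewrite 2!linearP; rewrite scalerBr opprD addrACA.
Qed.
HB.instance Definition _ x := GRing.isLinear.Build (stalk x) (gquo M x) (god M x) _
  (@gquo_split_fun x) (@gquo_split_lin x).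
Lemma gquo_split_gproj x m : gquo_split_fun (gproj M x m) = m - unit M x (r x m).
Proof.
have -> : m - unit M x (r x m) =
    gquo_val (gproj M x m) - unit M x (r x (gquo_val (gproj M x m))).
  have -> : gquo_val (gproj M x m) =
      m - unit M x (mres M (rep_le x) (m (rep x) (rep_up x))) :> god M x.
    apply: cofam_ext => y h; rewrite [LHS]/= /gproj_fam cofamDE cofamNE.
    by rewrite /= /unit_fun (mres_comp _ _ (le_rep_up h)).
  by rewrite linearB /= rK linearB /= opprB addrA subrK.
by [].
Qed.
Lemma gquo_split_res (x x' : X) (h : le x x') m :
  mres (god M) h (gquo_split_fun m) = gquo_split_fun (mres (gquo M) h m).
Proof.
rewrite [RHS]gquo_split_gproj /gquo_split_fun mresB unit_res.
by congr (_ - unit M x' _); rewrite hfun_res.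
Qed.
Definition gquo_split : omhom (gquo M) (god M) :=
  OMHom (hfun := fun x => @gquo_split_fun x : {linear gquo M x -> god M x}) gquo_split_res.

Lemma gquo_splitK x q : gproj M x (gquo_split x q) = q.
Proof. by rewrite linearB gproj_unit subr0 [LHS]gproj_id. Qed.
End RelInjQuo.

Lemma rel_inj_gquo M : rel_inj M -> rel_inj (gquo M).
Proof. by case=> r rK; apply: rel_inj_retract (gquo_splitK rK) (rel_inj_god M). Qed.

Lemma rel_inj_gquon M n : rel_inj M -> rel_inj (gquon n M).
Proof. by move=> hM; elim: n => //= n IH; exact: rel_inj_gquo. Qed.

Lemma h1_god (V : {set X}) (Vop : is_open V) M : h1 V (god M).
Proof.
move=> s.
pose t (z : X) (hz : z \in V) (rz : isrep z) : god M z := fun y h =>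
  - gquo_val (s z hz) y h y (le_repn (proj2 (andP h))).
exists (gsec Vop (M := god M) t); apply: sections_ext => x hx.
apply: gquo_ext => z hz; apply: cofam_ext => y hy.
have zV := Vop _ _ (cof_le hz) hx; have rz := proj2 (andP hz).
have yV := Vop _ _ (cof_le hy) zV; have ry := proj2 (andP hy).
have hxy := cof_up (cof_le hz) hy.
rewrite /= /gproj_fam /= cofamDE cofamNE /cofam_res /t.
set p1 := Vop _ _ _ _; set p2 := Vop _ _ _ _.
have e1 := gquo_sec s (cof_le hz) hx p1 hy hxy.
have e2 := gquo_sec s (le_rep x) hx p2 (cof_up (le_rep_up hz) hy) hxy.
have z0 w h : w = rep x -> gquo_val (s x hx) w h = 0.
  by move=> e; move: h; rewrite e => h; exact: gquo_rep.
rewrite (z0 _ _ (rep_rep x)) mres0 subr0 in e2.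
rewrite e1 e2 cofamDE cofamNE opprB opprK /= /cofam_res.
rewrite (god_irr (gquo_val (s x hx) y hxy) (le_repn (proj2 (andP hy)))
  (le_repn (proj2 (andP (cof_up (le_rep_up hz) hy))))) subrK.
move: (cof_up (cof_le hz) (rep_up z)) (cof_up (le_rep_up hy) _).
rewrite (eqP rz) => h1 h2.
by rewrite (bool_irrelevance h1 hz) (bool_irrelevance h2 hy).
Qed.

Lemma rel_inj_h1 (V : {set X}) (Vop : is_open V) M : rel_inj M -> h1 V M.
Proof.
case=> r rK s.
have [t tE] := h1_god Vop (sec_map (gquo_map (unit M)) s).
exists (sec_map (god_map r) t); rewrite -sec_map_gquo tE.
apply: sections_ext => x hx; apply: gquo_ext => y h.
exact: rK.
Qed.

Lemma rel_inj_acyc (V : {set X}) (Vop : is_open V) M : rel_inj M -> acyc V M.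
Proof. by move=> hM n; exact/(rel_inj_h1 Vop)/rel_inj_gquon. Qed.

Lemma om_injective_rel_inj E : om_injective E -> rel_inj E.
Proof.
move=> hE; have [r rE] := hE _ _ (unit E) (@unit_inj _ _ E) (om_id E).
exists r => x m.
exact: (congr1 (fun f : omhom E E => f x m) rE).
Qed.
End RelInjective.

Section Submodule.
Variables (R : pzRingType) (M : lmodType R) (P : M -> Prop).

Definition lin_closed : Prop := P 0 /\ forall a m n, P m -> P n -> P (a *: m + n).
Hypothesis HP : lin_closed.

Definition subm_pred (_ : lin_closed) : {pred M} := fun m => `[< P m >].
Lemma subm_closed : submod_closed (subm_pred HP).
Proof.
case: (HP) => P0 PD; split=> [|a x y /asboolP hx /asboolP hy]; apply/asboolP => //.
exact: PD.
Qed.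
HB.instance Definition _ := GRing.isSubmodClosed.Build R M (subm_pred HP) subm_closed.

Record subm := Subm { subm_val :> M; _ : subm_val \in subm_pred HP }.
HB.instance Definition _ := [isSub for subm_val].
HB.instance Definition _ := [Choice of subm by <:].
HB.instance Definition _ := [SubChoice_isSubLmodule of subm by <:].
End Submodule.

Section SubmoduleInclusion.
Variables (R : pzRingType) (M : lmodType R) (P : M -> Prop) (HP : lin_closed P).
Lemma submP (m : subm HP) : P (val m).
Proof. by case: m => m /= /asboolP. Qed.
Lemma subm_in (m : M) : P m -> m \in subm_pred HP. Proof. by move=> h; apply/asboolP. Qed.
Definition mksubm (m : M) (h : P m) : subm HP := Subm (subm_in h).
Definition subm_inc (m : subm HP) : M := val m.
Lemma subm_inc_linear : linear subm_inc. Proof. by []. Qed.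
HB.instance Definition _ := GRing.isLinear.Build R (subm HP) M _ subm_inc subm_inc_linear.
End SubmoduleInclusion.

Section Subsheaf.
Variables (k : comPzRingType) (X : rspace k) (M : omodule X).
Variable P : forall x : X, M x -> Prop.
Hypothesis HP : forall x, lin_closed (@P x).
Hypothesis Pres : forall (x y : X) (h : le x y) m, P m -> P (mres M h m).

Definition sub_res (x y : X) (h : le x y) (m : subm (HP x)) : subm (HP y) :=
  mksubm (HP y) (Pres h (submP m)).
Lemma sub_res_lin (x y : X) (h : le x y) : semilinear (res h) (sub_res h).
Proof. by move=> a m n; apply/val_inj; exact: mres_lin. Qed.
Lemma sub_res_id (x : X) (h : le x x) m : sub_res h m = m.
Proof. by apply/val_inj; exact: mres_id. Qed.
Lemma sub_res_comp (x y z : X) (h : le x y) (h' : le y z) (h'' : le x z) m :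
  sub_res h' (sub_res h m) = sub_res h'' m.
Proof. by apply/val_inj; exact: mres_comp. Qed.

Definition subsheaf : omodule X := {|
  mst := fun x => subm (HP x) : lmodType (stalk x);
  mres := sub_res;
  mres_lin := sub_res_lin;
  mres_id := sub_res_id;
  mres_comp := sub_res_comp
|}.

Lemma sub_inc_res (x y : X) (h : le x y) (m : subsheaf x) :
  mres M h (subm_inc m) = subm_inc (mres subsheaf h m).
Proof. by []. Qed.
Definition sub_inc : omhom subsheaf M :=
  OMHom (M := subsheaf)
    (hfun := fun x => @subm_inc (stalk x) (M x) (@P x) (HP x) : {linear subsheaf x -> M x})
    sub_inc_res.

Lemma sub_inc_inj x : injective (sub_inc x). Proof. exact: val_inj. Qed.
Lemma sub_incP x m : P (sub_inc x m). Proof. exact: submP. Qed.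
Lemma sub_incS x m : P m -> exists n, sub_inc x n = m.
Proof. by move=> h; exists (mksubm (HP x) h). Qed.

Section Corestrict.
Variables (N : omodule X) (u : omhom N M).
Hypothesis uP : forall x n, P (u x n).
Definition sub_cor_fun (x : X) (n : N x) : subsheaf x := mksubm (HP x) (uP n).
Lemma sub_cor_lin x : linear (@sub_cor_fun x).
Proof. by move=> a m n; apply/val_inj; rewrite /= linearP. Qed.
HB.instance Definition _ x := GRing.isLinear.Build (stalk x) (N x) (subsheaf x) _
  (@sub_cor_fun x) (@sub_cor_lin x).
Lemma sub_cor_res (x y : X) (h : le x y) n :
  mres subsheaf h (sub_cor_fun n) = sub_cor_fun (mres N h n).
Proof. by apply/val_inj; exact: hfun_res. Qed.
Definition sub_cor : omhom N subsheaf :=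
  OMHom (hfun := fun x => @sub_cor_fun x : {linear N x -> subsheaf x}) sub_cor_res.
End Corestrict.
End Subsheaf.

Section KernelImage.
Variables (k : comPzRingType) (X : rspace k) (M N : omodule X) (u : omhom M N).

Lemma ker_closed x : lin_closed (fun m : M x => u x m = 0).
Proof.
by split=> [|a m n hm hn]; rewrite ?linear0 // linearP hm hn scaler0 addr0.
Qed.
Lemma ker_res (x y : X) (h : le x y) (m : M x) : u x m = 0 -> u y (mres M h m) = 0.
Proof. by move=> e; rewrite -hfun_res e mres0. Qed.
Definition kern : omodule X := subsheaf ker_closed ker_res.
Definition kern_inc : omhom kern M := sub_inc ker_closed ker_res.

Lemma im_closed x : lin_closed (fun n : N x => exists m, u x m = n).
Proof.
split=> [|a _ _ [m <-] [m' <-]]; first by exists 0; rewrite linear0.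
by exists (a *: m + m'); rewrite linearP.
Qed.
Lemma im_res (x y : X) (h : le x y) (n : N x) :
  (exists m, u x m = n) -> exists m, u y m = mres N h n.
Proof. by case=> m <-; exists (mres M h m); rewrite hfun_res. Qed.
Definition imag : omodule X := subsheaf im_closed im_res.
Definition imag_inc : omhom imag N := sub_inc im_closed im_res.
Definition imag_cor : omhom M imag := sub_cor im_closed im_res (u := u)
  (fun x m => ex_intro _ m erefl).
Lemma imag_cor_surj x m : exists n, imag_cor x n = m.
Proof.
case: (sub_incP m) => n e; exists n; apply: (@sub_inc_inj _ _ _ _ im_closed im_res).
by rewrite -e.
Qed.
End KernelImage.

Definition bnd (C : nat -> zmodType) (d : forall n, C n -> C n.+1) (i : nat) : C i -> Prop :=
  match i return C i -> Prop with
  | 0%N => fun z => z = 0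
  | j.+1 => fun z => exists y, d j y = z
  end.

Definition exact_cpx (C : nat -> zmodType) (d : forall n, C n -> C n.+1) : Prop :=
  forall i (z : C i), d i z = 0 -> bnd d z.

Definition exact_pos (C : nat -> zmodType) (d : forall n, C n -> C n.+1) : Prop :=
  forall i (z : C i.+1), d i.+1 z = 0 -> bnd d z.

Definition quasi_iso (C D : nat -> zmodType) (d : forall n, C n -> C n.+1)
    (e : forall n, D n -> D n.+1) (f : forall n, C n -> D n) : Prop :=
  forall i, (forall z, d i z = 0 -> bnd e (f i z) -> bnd d z) /\
            (forall w, e i w = 0 -> exists2 z, d i z = 0 & bnd e (w - f i z)).

Section Complexes.
Variables (k : comPzRingType) (X : rspace k) (V : {set X}).
Hypothesis Vop : is_open V.

Section AcyclicComplex.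
Variables (F : nat -> omodule X) (d : forall n, omhom (F n) (F n.+1)).
Hypothesis dd : forall n x (m : F n x), d n.+1 x (d n x m) = 0.
Hypothesis Fac : forall n, acyc V (F n).
Hypothesis Fex : forall x, x \in V -> exact_cpx (C := fun n => F n x) (fun n => d n x).

Let dk n : omhom (F n) (kern (d n.+1)) :=
  sub_cor (ker_closed (d n.+1)) (ker_res (u := d n.+1)) (@dd n).

Let dk_ses n : ses V (kern_inc (d n)) (dk n).
Proof.
split=> x hx.
- exact: sub_inc_inj.
- by move=> a; apply/val_inj; exact: (sub_incP a).
- by move=> b e; apply: sub_incS; exact: (congr1 val e).
- by move=> c; have [b e] := Fex hx (submP c); exists b; apply/val_inj.
Qed.

Let kern_acyc n : acyc V (kern (d n)).
Proof.
elim: n => [|n IH]; last exact (acyc_coker Vop (dk_ses n) IH (@Fac n)).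
apply: acyc_zero => // x hx m; apply/val_inj; exact: (Fex hx (submP m)).
Qed.

Lemma acyc_exact :
  exact_cpx (C := fun n => sections (F n) V) (fun n s => sec_map (d n) s).
Proof.
case=> [|n] s e.
  apply: sections_ext => x hx; exact: (@Fex x hx 0%N (s x hx) (sec_eq e hx)).
have [t tE] : exists t : sections (kern (d n.+1)) V, sec_map (kern_inc (d n.+1)) t = s.
  apply: sec_lift => x hx; first exact: sub_inc_inj.
  by apply: sub_incS; exact: (sec_eq e hx).
have [r rE] := acyc_epi Vop (dk_ses n) (@kern_acyc n) t.
by exists r; rewrite -tE -rE; apply: sections_ext.
Qed.
End AcyclicComplex.
End Complexes.

Section ProductModule.
Variables (k : comPzRingType) (X : rspace k) (M N : omodule X).

Definition pair_res (x y : X) (h : le x y) (m : (M x * N x)%type) : (M y * N y)%type :=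
  (mres M h m.1, mres N h m.2).
Lemma pair_res_lin (x y : X) (h : le x y) : semilinear (res h) (pair_res h).
Proof. by move=> a m n; rewrite /pair_res /= !mres_lin. Qed.
Lemma pair_res_id (x : X) (h : le x x) m : pair_res h m = m.
Proof. by case: m => m n; rewrite /pair_res !mres_id. Qed.
Lemma pair_res_comp (x y z : X) (h : le x y) (h' : le y z) (h'' : le x z) m :
  pair_res h' (pair_res h m) = pair_res h'' m.
Proof. by rewrite /pair_res /= !(mres_comp _ _ h''). Qed.

Definition prodmod : omodule X := {|
  mst := fun x => (M x * N x)%type : lmodType (stalk x);
  mres := pair_res;
  mres_lin := pair_res_lin;
  mres_id := pair_res_id;
  mres_comp := pair_res_comp
|}.

Definition om_fst : omhom prodmod M :=
  @OMHom k X prodmod M (fun x => fst : {linear prodmod x -> M x}) (fun x y h m => erefl).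
Definition om_snd : omhom prodmod N :=
  @OMHom k X prodmod N (fun x => snd : {linear prodmod x -> N x}) (fun x y h m => erefl).

Section Pairing.
Variables (A : omodule X) (u : omhom A M) (v : omhom A N).
Definition om_pair_fun (x : X) (a : A x) : prodmod x := (u x a, v x a).
Lemma om_pair_lin x : linear (@om_pair_fun x).
Proof. by move=> a m n; rewrite /om_pair_fun !linearP. Qed.
HB.instance Definition _ x := GRing.isLinear.Build (stalk x) (A x) (prodmod x) _
  (@om_pair_fun x) (@om_pair_lin x).
Lemma om_pair_res (x y : X) (h : le x y) a :
  mres prodmod h (om_pair_fun a) = om_pair_fun (mres A h a).
Proof. by rewrite /om_pair_fun /= /pair_res !hfun_res. Qed.
Definition om_pair : omhom A prodmod :=
  OMHom (hfun := fun x => @om_pair_fun x : {linear A x -> prodmod x}) om_pair_res.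
End Pairing.
End ProductModule.

Section Difference.
Variables (k : comPzRingType) (X : rspace k) (M N : omodule X) (u v : omhom M N).
Lemma om_sub_res (x y : X) (h : le x y) m :
  mres N h ((u x \- v x) m) = (u y \- v y) (mres M h m).
Proof. by rewrite /= mresB !hfun_res. Qed.
Definition om_sub : omhom M N :=
  OMHom (hfun := fun x => (u x \- v x : {linear M x -> N x})) om_sub_res.
End Difference.

Section ProductAcyclic.
Variables (k : comPzRingType) (X : rspace k) (V : {set X}) (Vop : is_open V).
Variables (M N : omodule X).

Lemma om0_res (A B : omodule X) (x y : X) (h : le x y) (m : A x) :
  mres B h ((\0 : {linear A x -> B x}) m) = (\0 : {linear A y -> B y}) (mres A h m).
Proof. exact: mres0. Qed.
Definition om0 (A B : omodule X) : omhom A B :=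
  OMHom (hfun := fun x => (\0 : {linear A x -> B x})) (@om0_res A B).

Lemma prodmod_ses : ses V (om_pair (om_id M) (om0 M N)) (om_snd M N).
Proof.
split=> x hx //=.
- by move=> m n [].
- by case=> m n /= ->; exists m.
- by move=> n; exists (0, n).
Qed.
Lemma prodmod_acyc : acyc V M -> acyc V N -> acyc V (prodmod M N).
Proof. by move=> hM hN; exact: acyc_mid prodmod_ses hM hN. Qed.
End ProductAcyclic.

Section Cone.
Variables (k : comPzRingType) (X : rspace k).
Variables (F E : nat -> omodule X).
Variables (d : forall n, omhom (F n) (F n.+1)) (e : forall n, omhom (E n) (E n.+1)).
Variable f : forall n, omhom (F n) (E n).
Hypothesis dd : forall n x (m : F n x), d n.+1 x (d n x m) = 0.
Hypothesis ee : forall n x (m : E n x), e n.+1 x (e n x m) = 0.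
Hypothesis fd : forall n x (m : F n x), f n.+1 x (d n x m) = e n x (f n x m).

Definition cone (n : nat) : omodule X :=
  match n with 0 => F 0 | n'.+1 => prodmod (F n'.+1) (E n') end.
Definition cone_d (n : nat) : omhom (cone n) (cone n.+1) :=
  match n return omhom (cone n) (cone n.+1) with
  | 0 => om_pair (d 0) (f 0)
  | n'.+1 => om_pair (om_comp (d n'.+1) (om_fst _ _))
               (om_sub (om_comp (f n'.+1) (om_fst _ _)) (om_comp (e n') (om_snd _ _)))
  end.

Lemma cone_dd n x (m : cone n x) : cone_d n.+1 x (cone_d n x m) = 0.
Proof.
case: n m => [|n] m /=; rewrite /om_pair_fun /=.
  by rewrite dd fd subrr.
by rewrite dd fd linearB /= ee subr0 subrr.
Qed.

Lemma cone_exact x :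
  quasi_iso (C := fun n => F n x) (D := fun n => E n x)
    (fun n => d n x) (fun n => e n x) (fun n => f n x) ->
  exact_cpx (C := fun n => cone n x) (fun n => cone_d n x).
Proof.
move=> q [|[|n]] z.
- by case=> z1 z2; have [qi _] := q 0%N; exact: qi.
- case: z => z w [/= z1 /eqP]; rewrite subr_eq0 => /eqP z2.
  have [qi _] := q 1%N; have [|y yE] := qi z z1; first by exists w.
  have [_ qs] := q 0%N; have [|y' y'0 /eqP] := qs (w - f 0%N x y).
    by rewrite linearB /= -z2 -fd yE subrr.
  rewrite subr_eq0 subr_eq => /eqP wE.
  by exists (y' + y); rewrite /= /om_pair_fun !linearD /= y'0 add0r yE wE.
- case: z => z w [/= z1 /eqP]; rewrite subr_eq0 => /eqP z2.
  have [qi _] := q n.+2; have [|y yE] := qi z z1; first by exists w.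
  have [_ qs] := q n.+1; have [|y' y'0 [v vE]] := qs (f n.+1 x y - w).
    by rewrite linearB /= -z2 -fd yE subrr.
  exists (y - y', v); rewrite /= /om_pair_fun /= !linearB /= y'0 subr0 yE vE.
  by rewrite opprB addrA subrK opprB addrC subrK.
Qed.

Variable V : {set X}.
Hypothesis Vop : is_open V.
Hypothesis Fac : forall n, acyc V (F n).
Hypothesis Eac : forall n, acyc V (E n).

Lemma cone_acyc n : acyc V (cone n).
Proof.
case: n => [|n]; first exact (@Fac 0).
exact (prodmod_acyc Vop (@Fac n.+1) (@Eac n)).
Qed.

Lemma quasi_iso_sections :
  (forall x, x \in V -> quasi_iso (C := fun n => F n x) (D := fun n => E n x)
    (fun n => d n x) (fun n => e n x) (fun n => f n x)) ->
  quasi_iso (C := fun n => sections (F n) V) (D := fun n => sections (E n) V)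
    (fun n s => sec_map (d n) s) (fun n s => sec_map (e n) s) (fun n s => sec_map (f n) s).
Proof.
move=> q.
have ex : exact_cpx (C := fun n => sections (cone n) V) (fun n s => sec_map (cone_d n) s).
  apply: acyc_exact => //; first exact: cone_dd.
    exact: cone_acyc.
  by move=> x hx; exact: cone_exact (q x hx).
have prs (A B : omodule X) (s : sections A V) (t : sections B V) :
    exists2 p : sections (prodmod A B) V, sec_map (om_fst _ _) p = s & sec_map (om_snd _ _) p = t.
  have pres p r (h : le p r) (hp : p \in V) (hr : r \in V) :
      mres (prodmod A B) h (s p hp, t p hp) = (s r hr, t r hr).
    by rewrite /= /pair_res /= !(sec_res _ h hp hr).
  by exists (Sections pres); exact: sections_ext.
move=> i; split.
- case: i => [|i] z dz.
    move=> fz; apply: (ex 0%N z); apply: sections_ext => x hx.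
    congr (_, _); [exact: (sec_eq dz hx)|exact: (sec_eq fz hx)].
  case=> w wE; have [p p1 p2] := prs _ _ z w.
  have [|y yE] := ex i.+1 p.
    apply: sections_ext => x hx /=; rewrite /om_pair_fun /=.
    have -> : (p x hx).1 = z x hx by exact: (sec_eq p1 hx).
    have -> : (p x hx).2 = w x hx by exact: (sec_eq p2 hx).
    congr (_, _); first exact: (sec_eq dz hx).
    by apply/eqP; rewrite subr_eq0; apply/eqP/esym; exact: (sec_eq wE hx).
  case: i z dz w wE p p1 p2 y yE => [|i] z dz w wE p p1 p2 y yE.
    by exists y; rewrite -p1 -yE; exact: sections_ext.
  exists (sec_map (om_fst _ _) y); rewrite -p1 -yE; exact: sections_ext.
- move=> w ew; have [p p1 p2] := prs (F i.+1) (E i) 0 w.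
  have [|y yE] := ex i.+1 p.
    apply: sections_ext => x hx /=; rewrite /om_pair_fun /=.
    have -> : (p x hx).1 = 0 by exact: (sec_eq p1 hx).
    have -> : (p x hx).2 = w x hx by exact: (sec_eq p2 hx).
    congr (_, _); first exact: linear0.
    have -> : e i x (w x hx) = 0 by exact: (sec_eq ew hx).
    by rewrite linear0 subrr.
  case: i w ew p p1 p2 y yE => [|i] w ew p p1 p2 y yE.
    exists y; first by rewrite -p1 -yE; exact: sections_ext.
    apply/eqP; rewrite subr_eq0; apply/eqP.
    by rewrite -p2 -yE; exact: sections_ext.
  exists (sec_map (om_fst _ _) y); first by rewrite -p1 -yE; exact: sections_ext.
  exists (- sec_map (om_snd _ _) y).
  apply/eqP; rewrite eq_sym subr_eq; apply/eqP.
  rewrite -p2 -yE; apply: sections_ext => x hx; rewrite secDE /=.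
  by rewrite linearN addrC.
Qed.
End Cone.

Section Extension.
Variables (k : comPzRingType) (X : rspace k) (A B E : omodule X).
Variables (a : omhom A B) (g : omhom A E).
Hypothesis kag : forall x m, a x m = 0 -> g x m = 0.

Definition im_ext_fun (x : X) (n : imag a x) : E x := g x (projT1 (cid (submP n))).
Lemma im_extE x (n : imag a x) m : a x m = val n -> im_ext_fun n = g x m.
Proof.
move=> e; apply/eqP; rewrite -subr_eq0 -linearB; apply/eqP/kag.
by rewrite linearB (projT2 (cid (submP n))) e subrr.
Qed.
Lemma im_ext_lin x : linear (@im_ext_fun x).
Proof.
move=> c m n; rewrite (im_extE (m := c *: projT1 (cid (submP m)) + projT1 (cid (submP n)))).
  by rewrite linearP.
by rewrite linearP (projT2 (cid (submP m))) (projT2 (cid (submP n))).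
Qed.
HB.instance Definition _ x := GRing.isLinear.Build (stalk x) (imag a x) (E x) _
  (@im_ext_fun x) (@im_ext_lin x).
Lemma im_ext_res (x y : X) (h : le x y) n :
  mres E h (im_ext_fun n) = im_ext_fun (mres (imag a) h n).
Proof.
rewrite hfun_res; symmetry; apply: im_extE.
by rewrite -hfun_res (projT2 (cid (submP n))).
Qed.
Definition im_ext : omhom (imag a) E :=
  OMHom (hfun := fun x => @im_ext_fun x : {linear imag a x -> E x}) im_ext_res.

Lemma om_injective_ext : om_injective E -> exists h : omhom B E, forall x m, h x (a x m) = g x m.
Proof.
move=> hE; have [|h hh] := hE _ _ (imag_inc a) _ im_ext; first by move=> x; exact: sub_inc_inj.
exists h => x m.
have -> : a x m = imag_inc a x (imag_cor a x m) by [].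
rewrite -[LHS]/(om_comp h (imag_inc a) x _) hh.
exact: im_extE.
Qed.
End Extension.

Section Resolutions.
Variables (k : comPzRingType) (X : rspace k).

Record resolution (M : omodule X) := Resolution {
  rs_obj : nat -> omodule X;
  rs_d : forall n, omhom (rs_obj n) (rs_obj n.+1);
  rs_aug : omhom M (rs_obj 0);
  rs_mono : om_mono rs_aug;
  rs_exact0 : forall (p : X) x, rs_d 0 p x = 0 <-> exists m, rs_aug p m = x;
  rs_exact : forall n (p : X) x, rs_d n.+1 p x = 0 <-> exists y, rs_d n p y = x
}.

Lemma rs_dd M (F : resolution M) n x m : rs_d F n.+1 x (rs_d F n x m) = 0.
Proof. by apply/rs_exact; exists m. Qed.

Section GodementResolution.
Variable M : omodule X.
Definition gres_obj n := god (gquon n M).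
Definition gres_d n : omhom (gres_obj n) (gres_obj n.+1) :=
  om_comp (unit (gquon n.+1 M)) (gproj (gquon n M)).
Lemma gres_exact0 (p : X) x : gres_d 0 p x = 0 <-> exists m, unit M p m = x.
Proof.
split=> [e|[m <-]]; last by rewrite /= gproj_unit linear0.
by apply: gproj_ker; apply: (@unit_inj _ _ (gquon 1 M)); rewrite linear0.
Qed.
Lemma gres_exact n (p : X) x : gres_d n.+1 p x = 0 <-> exists y, gres_d n p y = x.
Proof.
split=> [e|[y <-]]; last first.
  rewrite -[LHS]/(unit (gquon n.+2 M) p (gproj (gquon n.+1 M) p (unit (gquon n.+1 M) p _))).
  by rewrite gproj_unit linear0.
have [|m <-] := @gproj_ker _ _ (gquon n.+1 M) p x.
  by apply: (@unit_inj _ _ (gquon n.+2 M)); rewrite linear0.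
by have [y <-] := gproj_surj m; exists y.
Qed.
Definition gres : resolution M := {|
  rs_obj := gres_obj; rs_d := gres_d; rs_aug := unit M;
  rs_mono := @unit_inj k X M; rs_exact0 := gres_exact0; rs_exact := gres_exact
|}.
Lemma gres_rel_inj n : rel_inj (rs_obj gres n). Proof. exact: rel_inj_god. Qed.
End GodementResolution.

Section ChainMap.
Variables (M : omodule X) (F : resolution M) (E : injective_resolution M).

Let good n (f : omhom (rs_obj F n) (ir_obj E n)) : Prop :=
  forall x z, rs_d F n x z = 0 -> ir_d E n x (f x z) = 0.

Let chain0 : exists f : omhom (rs_obj F 0) (ir_obj E 0),
  good f /\ forall x m, f x (rs_aug F x m) = ir_aug E x m.
Proof.
have [|f fE] := @om_injective_ext _ _ _ _ _ (rs_aug F) (ir_aug E) _ (@ir_inj k X M E 0).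
  by move=> x m e; rewrite (rs_mono (r := F) (etrans e (esym (linear0 _)))) linear0.
exists f; split=> // x z /rs_exact0 [m <-].
by rewrite fE; apply/(ir_exact0 (i := E)); exists m.
Qed.

Let chainS n (f : omhom (rs_obj F n) (ir_obj E n)) : good f ->
  exists f' : omhom (rs_obj F n.+1) (ir_obj E n.+1),
    good f' /\ forall x m, f' x (rs_d F n x m) = ir_d E n x (f x m).
Proof.
move=> gf.
have [|f' fE] := @om_injective_ext _ _ _ _ _ (rs_d F n) (om_comp (ir_d E n) f) _ (@ir_inj k X M E n.+1).
  exact: gf.
exists f'; split=> // x z /rs_exact [m <-].
by rewrite fE /=; apply/(ir_exact (i := E)); exists (f x m).
Qed.

Fixpoint chain n : {f : omhom (rs_obj F n) (ir_obj E n) | good f} :=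
  match n with
  | 0 => exist _ (projT1 (cid chain0)) (proj1 (projT2 (cid chain0)))
  | n'.+1 => exist _ (projT1 (cid (chainS (proj2_sig (chain n')))))
               (proj1 (projT2 (cid (chainS (proj2_sig (chain n'))))))
  end.

Lemma chain_map : exists f : forall n, omhom (rs_obj F n) (ir_obj E n),
  (forall n x m, f n.+1 x (rs_d F n x m) = ir_d E n x (f n x m)) /\
  (forall x m, f 0%N x (rs_aug F x m) = ir_aug E x m).
Proof.
exists (fun n => proj1_sig (chain n)); split; last exact: (proj2 (projT2 (cid chain0))).
by move=> n x m; rewrite (proj2 (projT2 (cid (chainS (proj2_sig (chain n)))))).
Qed.

Hypothesis Frel : forall n, rel_inj (rs_obj F n).

Lemma resolution_compare : exists f : forall n, omhom (rs_obj F n) (ir_obj E n),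
  (forall n x m, f n.+1 x (rs_d F n x m) = ir_d E n x (f n x m)) /\
  forall V : {set X}, is_open V ->
    quasi_iso (C := fun n => sections (rs_obj F n) V) (D := fun n => sections (ir_obj E n) V)
      (fun n s => sec_map (rs_d F n) s) (fun n s => sec_map (ir_d E n) s)
      (fun n s => sec_map (f n) s).
Proof.
have [f [fd fa]] := chain_map; exists f; split=> // V Vop.
apply: quasi_iso_sections => //.
- exact: rs_dd.
- by move=> n x m; apply/(ir_exact (i := E)); exists m.
- by move=> n; exact: rel_inj_acyc.
- by move=> n; apply: rel_inj_acyc => //; exact/om_injective_rel_inj/ir_inj.
move=> x _ [|i]; split=> /=.
- move=> z /rs_exact0 [m <-]; rewrite fa => e.
  by rewrite (ir_mono (i := E) (etrans e (esym (linear0 _)))) linear0.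
- move=> w /(ir_exact0 (i := E)) [m <-]; exists (rs_aug F x m); last by rewrite fa subrr.
  by apply/rs_exact0; exists m.
- by move=> z /rs_exact.
- move=> w /(ir_exact (i := E)) [y <-]; exists 0; first exact: linear0.
  by exists y; rewrite linear0 subr0.
Qed.
End ChainMap.
End Resolutions.

(** * Injective modules and resolutions *)

Section QmodZ.
Definition int_pred : {pred rat} := fun x => x \is a Num.int.
Lemma int_closed : zmod_closed int_pred.
Proof.
split; first exact: Num.Theory.int_num0.
by move=> x y hx hy; rewrite /int_pred /in_mem /=; exact: rpredB.
Qed.
HB.instance Definition _ := GRing.isZmodClosed.Build rat int_pred int_closed.

Definition QZ : zmodType := Quotient.quot int_pred.
Definition qz (x : rat) : QZ := \pi_(Quotient.quot int_pred)%qT x.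

Lemma qzD x y : qz (x + y) = qz x + qz y. Proof. exact: Quotient.pi_add. Qed.
Lemma qz_eq0 x : qz x = 0 <-> x \is a Num.int.
Proof.
have -> : 0 = qz 0 by apply: (addrI (qz 0)); rewrite -qzD !addr0.
have -> : (qz x = qz 0) = (x - 0 \in int_pred) :> Prop.
  rewrite Quotient.idealrBE; apply/propext; split=> [h|/eqP //].
  by apply/eqP.
by rewrite subr0.
Qed.
Lemma qz_surj (d : QZ) : exists x, qz x = d.
Proof. by exists (repr (d : Quotient.quot int_pred)); exact: reprK. Qed.
Lemma qzMn x n : qz (x *+ n) = qz x *+ n.
Proof.
elim: n => [|n IH]; last by rewrite !mulrS qzD IH.
by apply/qz_eq0; exact: rpred0.
Qed.

Lemma QZ_div n (d : QZ) : (0 < n)%N -> exists e, e *+ n = d.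
Proof.
move=> n0; have [x <-] := qz_surj d; exists (qz (x / n%:R)).
have n0' : n%:R != 0 :> rat by rewrite Num.Theory.pnatr_eq0 -lt0n.
by rewrite -qzMn -[_ *+ n]mulr_natr divfK.
Qed.

Lemma QZ_tors n : (1 < n)%N -> exists2 d : QZ, d *+ n = 0 & d <> 0.
Proof.
move=> n1; have n0 : n%:R != 0 :> rat by rewrite Num.Theory.pnatr_eq0 -lt0n; exact: ltnW.
exists (qz n%:R^-1).
  by rewrite -qzMn -[_ *+ n]mulr_natr mulVf //; apply/qz_eq0; exact: rpred1.
move/qz_eq0 => /Num.Theory.intrP [z zE].
have : (n%:R * z%:~R = 1 :> rat) by rewrite -zE mulfV.
move=> nz; have /eqP : n%:Z * z == 1.
  by rewrite -(@eqr_int rat) intrM; apply/eqP.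
move/(congr1 absz); rewrite abszM absz_nat => /eqP; rewrite muln_eq1.
by move=> /andP[/eqP n1']; rewrite n1' in n1.
Qed.

End QmodZ.

Section DivisibleExtension.
Variables (G : zmodType).

(* Graphs of homomorphisms from a subgroup of [G] to [QZ] *)
Definition fun_graph (A : set (G * QZ)) : Prop :=
  [/\ A (0, 0), forall a b, A a -> A b -> A (a - b) & forall d, A (0, d) -> d = 0].

Section Graph.
Variable A : set (G * QZ).
Hypothesis gA : fun_graph A.
Lemma fun_graphN a : A a -> A (- a).
Proof. by case: gA => A0 AB _ Aa; rewrite -[- a]add0r; exact: AB. Qed.
Lemma fun_graphD a b : A a -> A b -> A (a + b).
Proof.
by move=> Aa Ab; case: gA => _ AB _; rewrite -[b]opprK; apply: AB => //; exact: fun_graphN.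
Qed.
Lemma fun_graphMn a n : A a -> A (a *+ n).
Proof.
move=> Aa; elim: n => [|n IH]; first by case: gA.
by rewrite mulrS; exact: fun_graphD.
Qed.
Lemma fun_graphMz a n : A a -> A (a *~ n).
Proof. by case: n => n Aa; [exact: fun_graphMn|exact/fun_graphN/fun_graphMn]. Qed.
Lemma fun_graph_inj g d d' : A (g, d) -> A (g, d') -> d = d'.
Proof.
case: gA => _ AB A0 h h'; apply/eqP; rewrite -subr_eq0; apply/eqP/A0.
by have := AB _ _ h h'; rewrite (_ : (g, d) - (g, d') = (0, d - d')) // -(subrr g).
Qed.

Definition graph_adj (g : G) (d : QZ) : set (G * QZ) :=
  fun p => exists2 a, A a & exists n : int, p = a + (g, d) *~ n.

Lemma pairMz (g : G) (d : QZ) (n : int) : (g, d) *~ n = (g *~ n, d *~ n).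
Proof.
have H m : (g, d) *+ m = (g *+ m, d *+ m).
  by elim: m => [|m IH]; rewrite ?mulr0n // !mulrS IH.
by case: n => n; rewrite ?NegzE -?pmulrn ?H // !mulrNz -!pmulrn H.
Qed.

Lemma graph_adjP g : exists d, fun_graph (graph_adj g d).
Proof.
case: (gA) => A0 AB Af.
have mk d : (forall (n : int) e, A (g *~ n, e) -> e = d *~ n) -> fun_graph (graph_adj g d).
  move=> hd; split.
  - by exists 0 => //; exists 0; rewrite mulr0z addr0.
  - move=> _ _ [a Aa [n ->]] [b Ab [m ->]]; exists (a - b); first exact: AB.
    by exists (n - m); rewrite mulrzBr opprD addrACA.
  - move=> e [[a c] Aa [n]]; rewrite pairMz => -[/eqP].
    rewrite eq_sym addr_eq0 => /eqP aE ->.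
    have := hd (- n) c; rewrite !mulrNz -aE => /(_ Aa) ->.
    by rewrite addNr.
case: (pselect (exists2 n : nat, (0 < n)%N & exists e, A (g *+ n, e))) => [ex|nex].
  have ex' : exists n, `[< (0 < n)%N /\ exists e, A (g *+ n, e) >].
    by case: ex => n n0 h; exists n; apply/asboolP.
  case: (ex_minnP ex') => n /asboolP [n0 [e Ae]] nmin.
  have [d dE] := QZ_div e n0; exists d; apply: mk => m c Ac.
  have rA : A (g *~ (m %% n%:Z)%Z, c - e *~ (m %/ n%:Z)%Z).
    have -> : (g *~ (m %% n%:Z)%Z, c - e *~ (m %/ n%:Z)%Z) =
              (g *~ m, c) - (g *+ n, e) *~ (m %/ n%:Z)%Z.
      rewrite pairMz; congr (_, _) => /=; rewrite /modz mulrzBr; congr (_ - _).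
      by rewrite pmulrn mulrzA mulrzAC.
    by apply: AB => //; exact: fun_graphMz.
  have r0 : (m %% n%:Z)%Z = 0.
    apply/eqP/negPn/negP => rn0.
    have rge : 0 <= (m %% n%:Z)%Z by rewrite modz_ge0 // -lt0n.
    have [r rE] : exists r : nat, (m %% n%:Z)%Z = r by exists `|(m %% n%:Z)%Z|%N; rewrite gez0_abs.
    have rn : (r < n)%N.
      by rewrite -ltz_nat -rE ltz_pmod.
    have r1 : (0 < r)%N by rewrite lt0n; apply: contra rn0 => /eqP r0; rewrite rE r0.
    suff : (n <= r)%N by rewrite leqNgt rn.
    apply: nmin; apply/asboolP; split=> //.
    by exists (c - e *~ (m %/ n%:Z)%Z); rewrite rE in rA.
  rewrite r0 mulr0z in rA; move/Af/eqP: rA; rewrite subr_eq0 => /eqP ->.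
  rewrite -dE [in RHS](divz_eq m n) r0 addr0 mulrC.
  by rewrite mulrzA pmulrn.
exists 0; apply: mk => n e Ae; rewrite mul0rz.
case: (eqVneq n 0) => [n0|n0]; first by apply: Af; rewrite n0 mulr0z in Ae.
case: nex; exists `|n|%N; first by rewrite absz_gt0.
case: n Ae {n0} => n Ae; first by exists e.
by exists (- e); have := fun_graphN Ae; rewrite NegzE mulrNz -[X in X -> _]/(A (- - _, - e)) opprK.
Qed.
End Graph.

Lemma fun_graph_ext (A : set (G * QZ)) : fun_graph A ->
  exists chi : G -> QZ, (forall x y, chi (x + y) = chi x + chi y) /\
    forall g d, A (g, d) -> chi g = d.
Proof.
move=> gA.
pose P (B : set (G * QZ)) := fun_graph (B `|` A)%classic.
have [B [PB Bmax]] : exists B, P B /\ forall C, (B `<` C)%classic -> ~ P C.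
  apply: Zorn_bigcup => F FP Ftot.
  have pick a b : (\bigcup_(C in F) C `|` A)%classic a -> (\bigcup_(C in F) C `|` A)%classic b ->
      (A a /\ A b) \/ exists2 C, F C & (C `|` A)%classic a /\ (C `|` A)%classic b.
    case=> [[C FC Ca]|Aa] [[D FD Db]|Ab]; last by left.
    - right; case: (Ftot C D FC FD) => CD.
        by exists D => //; split; left => //; exact: CD.
      by exists C => //; split; left => //; exact: CD.
    - by right; exists C => //; split; [left|right].
    - by right; exists D => //; split; [right|left].
  split.
  - by right; case: gA.
  - move=> a b ha hb; case: (pick a b ha hb) => [[Aa Ab]|[C FC [Ca Cb]]].
      by right; case: gA => _ AB _; exact: AB.
    case: (FP C FC) => _ AB _; case: (AB a b Ca Cb); last by right.
    by left; exists C.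
  - move=> d hd; case: (pick _ _ hd hd) => [[Aa _]|[C FC [Ca _]]].
      by case: gA => _ _; exact.
    by case: (FP C FC) => _ _; exact.
have tot g : exists d, (B `|` A)%classic (g, d).
  have [d gd] := graph_adjP PB g; exists d.
  pose C := graph_adj (B `|` A)%classic g d.
  have BC : (B `|` A `<=` C)%classic.
    by move=> a Ba; exists a => //; exists 0; rewrite mulr0z addr0.
  have Cg : C (g, d) by exists 0; [case: PB|exists 1; rewrite add0r mulr1z].
  have PC : P C.
    rewrite /P (_ : (C `|` A)%classic = C) //.
    by apply/seteqP; split=> [a [//|Aa]|a]; [apply: BC; right|left].
  apply: contrapT => nBg; apply: (Bmax C) PC; split.
    by move=> a Ba; apply: BC; left.
  by move=> CB; apply: nBg; left; exact: CB.
pose chi g := projT1 (cid (tot g)).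
have chiE g : (B `|` A)%classic (g, chi g) by exact: projT2 (cid (tot g)).
exists chi; split=> [x y|g d Agd].
  apply: (fun_graph_inj PB (chiE _)).
  exact: (fun_graphD PB (chiE x) (chiE y)).
by apply: (fun_graph_inj PB (chiE _)); right.
Qed.

Lemma character_sep (x : G) : x <> 0 ->
  exists chi : G -> QZ, (forall x y, chi (x + y) = chi x + chi y) /\ chi x <> 0.
Proof.
move=> x0.
have [d d0 dP] : exists2 d : QZ, d <> 0 & forall n : int, x *~ n = 0 -> d *~ n = 0.
  case: (pselect (exists2 n : nat, (0 < n)%N & x *+ n = 0)) => [ex|nex]; last first.
    have [d _ d0] := @QZ_tors 2 isT; exists d => // n xn.
    case: (eqVneq n 0) => [->|n0]; first by rewrite mulr0z.
    case: nex; exists `|n|%N; first by rewrite absz_gt0.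
    case: n xn {n0} => n // /eqP.
    by rewrite NegzE mulrNz oppr_eq0 => /eqP.
  have ex' : exists n, (0 < n)%N && (x *+ n == 0).
    by case: ex => n n0 /eqP h; exists n; rewrite n0.
  case: (ex_minnP ex') => n /andP[n0 /eqP xn] nmin.
  have n1 : (1 < n)%N.
    by case: n n0 xn {nmin} => [|[|n]] //; rewrite mulr1n.
  have [d dn d0] := QZ_tors n1; exists d => // m xm.
  have r0 : (m %% n%:Z)%Z = 0.
    apply/eqP/negPn/negP => rn0.
    have rge : 0 <= (m %% n%:Z)%Z by rewrite modz_ge0 // -lt0n.
    have [r rE] : exists r : nat, (m %% n%:Z)%Z = r.
      by exists `|(m %% n%:Z)%Z|%N; rewrite gez0_abs.
    have rn : (r < n)%N by rewrite -ltz_nat -rE ltz_pmod.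
    have r1 : (0 < r)%N by rewrite lt0n; apply: contra rn0 => /eqP r0; rewrite rE r0.
    suff : (n <= r)%N by rewrite leqNgt rn.
    apply: nmin; rewrite r1; apply/eqP.
    have := xm; rewrite [in x *~ _](divz_eq m n) rE mulrzDr.
    by rewrite mulrC mulrzA -pmulrn xn mul0rz add0r.
  by rewrite (divz_eq m n) r0 addr0 mulrC mulrzA -pmulrn dn mul0rz.
have [|chi [chiD chiE]] := @fun_graph_ext [set p | exists n : int, p = (x *~ n, d *~ n)]%classic.
  split.
  - by exists 0; rewrite !mulr0z.
  - by move=> _ _ [n ->] [m ->]; exists (n - m); rewrite !mulrzBr.
  - by move=> e [n [/esym/dP dn ->]].
exists chi; split=> //; rewrite (chiE _ d) //.
by exists 1; rewrite !mulr1z.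
Qed.
End DivisibleExtension.

Definition linpack (R : pzRingType) (M N : lmodType R) (f : M -> N) (hf : linear f) :
  {linear M -> N} := HB.pack f (GRing.isLinear.Build R M N _ f hf).

Section InjectiveHull.
Variables (A : comPzRingType) (M : lmodType A).

Definition character : Type := {chi : M -> QZ | forall x y, chi (x + y) = chi x + chi y}.

Definition charfam_pred : {pred character -> A -> QZ} := fun f =>
  `[< forall s a b, f s (a + b) = f s a + f s b >].
Lemma charfam_closed : zmod_closed charfam_pred.
Proof.
split; first by apply/asboolP => s a b; rewrite -[RHS]/(0 + 0) addr0.
move=> f g /asboolP hf /asboolP hg; apply/asboolP => s a b.
by rewrite -[LHS]/(f s (a + b) - g s (a + b)) hf hg opprD addrACA.
Qed.
HB.instance Definition _ :=
  GRing.isZmodClosed.Build (character -> A -> QZ) charfam_pred charfam_closed.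

Record hull := Hull { hull_val : character -> A -> QZ; _ : hull_val \in charfam_pred }.
HB.instance Definition _ := [isSub for hull_val].
HB.instance Definition _ := [Choice of hull by <:].
HB.instance Definition _ := [SubChoice_isSubZmodule of hull by <:].

Lemma hull_add (f : hull) s a b : val f s (a + b) = val f s a + val f s b.
Proof. by case: f => f /= /asboolP. Qed.
Lemma hull_ext (f g : hull) : (forall s a, val f s a = val g s a) -> f = g.
Proof. by move=> e; apply/val_inj/funext => s; apply/funext => a. Qed.

Lemma mkhull_subproof (f : character -> A -> QZ) :
  (forall s a b, f s (a + b) = f s a + f s b) -> f \in charfam_pred.
Proof. by move=> h; apply/asboolP. Qed.
Definition mkhull f h : hull := Hull (@mkhull_subproof f h).

Lemma hull_scale_subproof (a : A) (f : hull) s b c :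
  val f s ((b + c) * a) = val f s (b * a) + val f s (c * a).
Proof. by rewrite mulrDl hull_add. Qed.
Definition hull_scale (a : A) (f : hull) : hull :=
  mkhull (f := fun s b => val f s (b * a)) (hull_scale_subproof a f).
Lemma hull_scaleA a b f : hull_scale a (hull_scale b f) = hull_scale (a * b) f.
Proof. by apply: hull_ext => s c; rewrite /= mulrA. Qed.
Lemma hull_scale1 : left_id 1 hull_scale.
Proof. by move=> f; apply: hull_ext => s c; rewrite /= mulr1. Qed.
Lemma hull_scaleDr : right_distributive hull_scale +%R.
Proof. by move=> a f g; apply: hull_ext. Qed.
Lemma hull_scaleDl f : {morph hull_scale^~ f : a b / a + b}.
Proof. by move=> a b; apply: hull_ext => s c; rewrite /= mulrDr hull_add. Qed.
HB.instance Definition _ := GRing.Zmodule_isLmodule.Build A hull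
  hull_scaleA hull_scale1 hull_scaleDr hull_scaleDl.

Lemma to_hull_subproof (m : M) (s : character) (a b : A) :
  proj1_sig s ((a + b) *: m) = proj1_sig s (a *: m) + proj1_sig s (b *: m).
Proof. by rewrite scalerDl (proj2_sig s). Qed.
Definition to_hull (m : M) : hull :=
  mkhull (f := fun s a => proj1_sig s (a *: m)) (to_hull_subproof m).
Lemma to_hull_linear : linear to_hull.
Proof.
move=> a m n; apply: hull_ext => s b.
by rewrite /= scalerDr (proj2_sig s) scalerA.
Qed.
HB.instance Definition _ := GRing.isLinear.Build A M hull _ to_hull to_hull_linear.

Lemma to_hull_inj : injective to_hull.
Proof.
move=> m n e; apply/eqP; rewrite -subr_eq0; apply/eqP; apply: contrapT => mn.
have [chi [chiD chi0]] := character_sep mn.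
pose s : character := exist _ chi chiD.
apply: chi0; have := congr1 (fun f => val f s 1) e.
rewrite /= !scale1r => chiE.
by apply: (addIr (chi n)); rewrite -chiD subrK add0r.
Qed.

Lemma hull_injective (N P : lmodType A) (u : {linear N -> P}) (g : {linear N -> hull}) :
  injective u -> exists h : {linear P -> hull}, forall n, h (u n) = g n.
Proof.
move=> ui.
have ex (s : character) : exists chi : P -> QZ, (forall x y, chi (x + y) = chi x + chi y) /\
    forall n, chi (u n) = val (g n) s 1.
  have [|chi [chiD chiE]] := @fun_graph_ext P
      [set p | exists n, p = (u n, val (g n) s 1)]%classic.
    split.
    - by exists 0; rewrite !linear0.
    - by move=> _ _ [m ->] [n ->]; exists (m - n); rewrite !linearB.
    - move=> d [n [/esym un ->]].
      have -> : n = 0 by apply: ui; rewrite linear0.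
      by rewrite linear0.
  by exists chi; split=> // n; apply: chiE; exists n.
pose chi s := projT1 (cid (ex s)).
have chiD s x y : chi s (x + y) = chi s x + chi s y by exact: (proj1 (projT2 (cid (ex s)))).
have chiE s n : chi s (u n) = val (g n) s 1 by exact: (proj2 (projT2 (cid (ex s)))).
have hP (p : P) s (a b : A) : chi s ((a + b) *: p) = chi s (a *: p) + chi s (b *: p).
  by rewrite scalerDl chiD.
pose h p : hull := mkhull (f := fun s a => chi s (a *: p)) (hP p).
have hl : linear h.
  by move=> a x y; apply: hull_ext => s b; rewrite /= scalerDr chiD scalerA.
exists (linpack hl) => n; apply: hull_ext => s a.
by rewrite /= -linearZ /= chiE linearZ /= mul1r.
Qed.
End InjectiveHull.

Section InjectiveSheaf.
Variables (k : comPzRingType) (X : rspace k) (M : omodule X).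

Definition injhull : omodule X := coind (fun y => hull (M y)) predT.

Lemma injhull_injective : om_injective injhull.
Proof.
move=> N P u ui g.
have tt (y : X) : le y y && predT y by rewrite le_refl.
have gl y : linear (fun n : N y => (g y n : cofam (fun y => hull (M y)) predT y) y (tt y)).
  by move=> a m n; rewrite linearP cofam_linE res_id.
pose gy y : {linear N y -> hull (M y)}:= linpack (gl y).
have ex y := hull_injective (gy y) (ui y).
pose hy y := projT1 (cid (ex y)).
have hyE y n : hy y (u y n) = gy y n by exact: (projT2 (cid (ex y))).
pose h x (p : P x) : injhull x := fun y hxy => hy y (mres P (cof_le hxy) p).
have hl x : linear (@h x).
  move=> a m n; apply: cofam_ext => y hxy; rewrite /h mres_lin linearP.
  by rewrite cofam_linE.
pose hL x : {linear P x -> injhull x} := linpack (hl x).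
have hres x y (hxy : le x y) p : mres injhull hxy (hL x p) = hL y (mres P hxy p).
  apply: cofam_ext => z hz; rewrite /= /cofam_res /h; congr (hy z _).
  by rewrite (mres_comp _ _ (cof_le (cof_up hxy hz))).
exists (OMHom hres); apply: omhom_ext => x n; apply: cofam_ext => y hxy.
rewrite /= /h hfun_res hyE /= -hfun_res /= /cofam_res.
by congr (_ y _); exact: bool_irrelevance.
Qed.

Definition injhull_fun (x : X) (m : M x) : injhull x := fun y h => to_hull (mres M (cof_le h) m).
Lemma injhull_lin x : linear (@injhull_fun x).
Proof.
move=> a m n; apply: cofam_ext => y h.
by rewrite /injhull_fun mres_lin linearP cofam_linE.
Qed.
HB.instance Definition _ x := GRing.isLinear.Build (stalk x) (M x) (injhull x) _
  (@injhull_fun x) (@injhull_lin x).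
Lemma injhull_res (x y : X) (h : le x y) m :
  mres injhull h (injhull_fun m) = injhull_fun (mres M h m).
Proof.
apply: cofam_ext => z hz; rewrite /= /cofam_res /injhull_fun.
by rewrite (mres_comp _ _ (cof_le (cof_up h hz))).
Qed.
Definition to_injhull : omhom M injhull :=
  OMHom (hfun := fun x => @injhull_fun x : {linear M x -> injhull x}) injhull_res.
Lemma to_injhull_mono : om_mono to_injhull.
Proof.
have tt (y : X) : le y y && predT y by rewrite le_refl.
move=> x m n /(congr1 (fun f : injhull x => f x (tt x))) /=.
by rewrite /injhull_fun !mres_id => /to_hull_inj.
Qed.
End InjectiveSheaf.

Section Cokernel.
Variables (k : comPzRingType) (X : rspace k) (M N : omodule X) (u : omhom M N).

Definition cok_obj (n : nat) : omodule X := if n is 0 then M else N.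
Definition cok_d (n : nat) : omhom (cok_obj n) (cok_obj n.+1) :=
  match n with 0 => u | _ => om0 N N end.

(* The cokernel of [u], as the cohomology of [M -> N -> N] with second map zero. *)
Definition cok : omodule X := cohomology_sheaf cok_d 1.

Lemma cok_cocycle (x : X) (n : N x) :
  n \in @cocycle_pred _ (fun n => cok_obj n x) (fun n => cok_d n x) 1.
Proof. exact/eqP. Qed.
Definition cok_proj_fun (x : X) (n : N x) : cok x := hcls (Cocycle (cok_cocycle n)).
Lemma cok_proj_lin x : linear (@cok_proj_fun x).
Proof.
move=> a m n; rewrite /cok_proj_fun -hclsZ -hclsD; congr (hcls _).
exact: val_inj.
Qed.
HB.instance Definition _ x := GRing.isLinear.Build (stalk x) (N x) (cok x) _
  (@cok_proj_fun x) (@cok_proj_lin x).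
Lemma cok_proj_res (x y : X) (h : le x y) n :
  mres cok h (cok_proj_fun n) = cok_proj_fun (mres N h n).
Proof. by rewrite /= /cohom_sheaf_res cohomology_mapE; congr (hcls _); exact: val_inj. Qed.
Definition cok_proj : omhom N cok :=
  OMHom (hfun := fun x => @cok_proj_fun x : {linear N x -> cok x}) cok_proj_res.
Lemma cok_proj_surj x c : exists n, cok_proj x n = c.
Proof.
exists (val (hrep c)); rewrite -[RHS]hrepK /= /cok_proj_fun; congr (hcls _).
exact: val_inj.
Qed.
Lemma cok_proj0 x n : cok_proj x n = 0 <-> exists m, u x m = n.
Proof.
rewrite -(linear0 (cok_proj x)) [cok_proj x n = _](_ : _ = (boundary (i := 1) (fun n => cok_d n x) (n - 0))).
  by rewrite subr0.
by apply/propext; exact: hclsP.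
Qed.
End Cokernel.

Section InjectiveResolution.
Variables (k : comPzRingType) (X : rspace k) (M : omodule X).

Fixpoint cosyz (n : nat) : omodule X :=
  if n is n'.+1 then cok (to_injhull (cosyz n')) else M.
Definition ires_obj n := injhull (cosyz n).
Definition ires_d n : omhom (ires_obj n) (ires_obj n.+1) :=
  om_comp (to_injhull (cosyz n.+1)) (cok_proj (to_injhull (cosyz n))).
Lemma ires_d0 n (p : X) x : ires_d n p x = 0 <-> exists m, to_injhull (cosyz n) p m = x.
Proof.
rewrite -cok_proj0; split=> [e|e].
  by apply: (@to_injhull_mono _ _ (cosyz n.+1)); rewrite linear0.
by rewrite -[LHS]/(to_injhull (cosyz n.+1) p (cok_proj _ p x)) e linear0.
Qed.
Lemma ires_exact n (p : X) x : ires_d n.+1 p x = 0 <-> exists y, ires_d n p y = x.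
Proof.
rewrite ires_d0; split=> [[m <-]|[y <-]]; last by exists (cok_proj _ p y).
by have [y <-] := cok_proj_surj m; exists y.
Qed.
Definition ires : injective_resolution M := {|
  ir_obj := ires_obj; ir_d := ires_d; ir_aug := to_injhull M;
  ir_inj := fun n => @injhull_injective k X (cosyz n);
  ir_mono := @to_injhull_mono k X M;
  ir_exact0 := ires_d0 (n := 0); ir_exact := ires_exact
|}.
End InjectiveResolution.

(** * Tensor products and base change *)

Section TensorTheory.
Variables (R : comPzRingType) (M N : lmodType R).
Lemma tens0l (n : N) : tens (0 : M) n = 0.
Proof. by apply: (addrI (tens 0 n)); rewrite -tensDl !addr0. Qed.
Lemma tens0r (m : M) : tens m (0 : N) = 0.
Proof. by apply: (addrI (tens m 0)); rewrite -tensDr !addr0. Qed.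
Lemma tensNl (m : M) (n : N) : tens (- m) n = - tens m n.
Proof. by apply: (addrI (tens m n)); rewrite -tensDl !subrr tens0l. Qed.

Section LiftTheory.
Variables (G : zmodType) (b : M -> N -> G) (hb : balanced b).
Lemma tensor_liftN t : tensor_lift b (- t) = - tensor_lift b t.
Proof. by apply: (addrI (tensor_lift b t)); rewrite -tensor_liftD // !subrr tensor_lift0. Qed.
Lemma tensor_liftB t u : tensor_lift b (t - u) = tensor_lift b t - tensor_lift b u.
Proof. by rewrite tensor_liftD // tensor_liftN. Qed.
End LiftTheory.
End TensorTheory.

Section TensorMap.
Variables (R : comPzRingType) (N : lmodType R).

Section One.
Variables (M M' : lmodType R) (u : {linear M -> M'}).
Lemma mapl_bal : balanced (fun (m : M) (n : N) => tens (u m) n).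
Proof.
split=> [m m' n|m n n'|a m n]; first by rewrite linearD tensDl.
  by rewrite tensDr.
by rewrite linearZ tensZ.
Qed.
Lemma maplE m (n : N) : tensor_mapl u (tens m n) = tens (u m) n.
Proof. exact: (tensor_lift_tens mapl_bal). Qed.
Lemma maplD (s t : tensor M N) : tensor_mapl u (s + t) = tensor_mapl u s + tensor_mapl u t.
Proof. exact: (tensor_liftD mapl_bal). Qed.
Lemma mapl0 : tensor_mapl u (0 : tensor M N) = 0.
Proof. exact: (tensor_lift0 mapl_bal). Qed.
Lemma maplB (s t : tensor M N) : tensor_mapl u (s - t) = tensor_mapl u s - tensor_mapl u t.
Proof. exact: (tensor_liftB mapl_bal). Qed.
Lemma mapl_surj : (forall m', exists m, u m = m') ->
  forall t' : tensor M' N, exists t, tensor_mapl u t = t'.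
Proof.
move=> us; elim/tensor_ind => [|m' n|s t [s' <-] [t' <-]].
- by exists 0; rewrite mapl0.
- by have [m <-] := us m'; exists (tens m n); rewrite maplE.
- by exists (s' + t'); rewrite maplD.
Qed.

End One.

Lemma mapl_comp (M M' M'' : lmodType R) (u : {linear M -> M'}) (v : {linear M' -> M''})
    (w : {linear M -> M''}) : (forall m, v (u m) = w m) ->
  forall t : tensor M N, tensor_mapl v (tensor_mapl u t) = tensor_mapl w t.
Proof.
move=> e; elim/tensor_ind => [|m n|s t IHs IHt]; first by rewrite !mapl0.
  by rewrite !maplE e.
by rewrite !maplD IHs IHt.
Qed.

Lemma mapl_eq0 (M M' : lmodType R) (u : {linear M -> M'}) : (forall m, u m = 0) ->
  forall t : tensor M N, tensor_mapl u t = 0.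
Proof.
move=> e; elim/tensor_ind => [|m n|s t IHs IHt]; first by rewrite !mapl0.
  by rewrite maplE e tens0l.
by rewrite maplD IHs IHt addr0.
Qed.

Section RightExact.
Variables (M M' M'' : lmodType R) (u : {linear M -> M'}) (v : {linear M' -> M''}).
Hypothesis vs : forall p, exists m, v m = p.
Hypothesis vk : forall m, v m = 0 -> exists n, u n = m.

Definition tim_pred : {pred tensor M' N} := fun t => `[< exists s, tensor_mapl u s = t >].
Lemma tim_closed : zmod_closed tim_pred.
Proof.
split; first by apply/asboolP; exists 0; rewrite mapl0.
move=> x y /asboolP [s <-] /asboolP [t <-]; apply/asboolP.
by exists (s - t); rewrite maplB.
Qed.
HB.instance Definition _ := GRing.isZmodClosed.Build (tensor M' N) tim_pred tim_closed.

Let Qt : zmodType := Quotient.quot tim_pred.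
Let pr (t : tensor M' N) : Qt := \pi_(Quotient.quot tim_pred)%qT t.
Let prD s t : pr (s + t) = pr s + pr t. Proof. exact: Quotient.pi_add. Qed.
Let pr_eq s t : pr s = pr t <-> exists r, tensor_mapl u r = s - t.
Proof.
have -> : (pr s = pr t) = (s - t \in tim_pred) :> Prop.
  rewrite Quotient.idealrBE; apply/propext; split=> [h|/eqP //].
  by apply/eqP.
by split=> /asboolP.
Qed.

Lemma mapl_right_exact (t : tensor M' N) :
  tensor_mapl v t = 0 -> exists s, tensor_mapl u s = t.
Proof.
move=> vt; pose l p := projT1 (cid (vs p)).
have lE p : v (l p) = p by exact: projT2 (cid (vs p)).
have key m m' n : v m = v m' -> pr (tens m n) = pr (tens m' n).
  move=> e; apply/pr_eq; rewrite -tensNl -tensDl.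
  have [|r <-] := vk (m := m - m'); first by rewrite linearB e subrr.
  by exists (tens r n); rewrite maplE.
have bal : balanced (fun p n => pr (tens (l p) n)).
  split=> [m m' n|m n n'|a m n].
  - by rewrite -prD -tensDl; apply: key; rewrite linearD !lE.
  - by rewrite -prD -tensDr.
  - by rewrite -tensZ; apply: key; rewrite linearZ !lE.
have pE s : tensor_lift (fun p n => pr (tens (l p) n)) (tensor_mapl v s) = pr s.
  elim/tensor_ind: s => [|m n|s s' IH IH'].
  - rewrite mapl0 tensor_lift0 //; apply: (addrI (pr 0)).
    by rewrite -prD !addr0.
  - by rewrite maplE tensor_lift_tens //; apply: key; rewrite lE.
  - by rewrite maplD tensor_liftD // IH IH' prD.
have /pr_eq [s sE] : pr t = pr 0 by rewrite -!pE vt mapl0.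
by exists s; rewrite sE subr0.
Qed.
End RightExact.
End TensorMap.

Section Flat.
Variables (A B : comPzRingType) (phi : {rmorphism A -> B}) (phi_flat : flat phi).
Local Notation T N := (tensor N (restr phi B^o)).

Lemma flat_mono (M N : lmodType A) (u : {linear M -> N}) (t : T M) :
  injective u -> tensor_mapl u t = 0 -> t = 0.
Proof. by move=> ui e; apply: (phi_flat ui); rewrite e mapl0. Qed.

Lemma flat_exact (M N P : lmodType A) (u : {linear M -> N}) (v : {linear N -> P}) :
  (forall n, v n = 0 -> exists m, u m = n) ->
  forall t : T N, tensor_mapl v t = 0 -> exists s, tensor_mapl u s = t.
Proof.
move=> uv t vt.
have cl : lin_closed (fun p : P => exists n, v n = p).
  split=> [|a _ _ [m <-] [n <-]]; first by exists 0; rewrite linear0.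
  by exists (a *: m + n); rewrite linearP.
pose w n : subm cl := mksubm cl (ex_intro (fun m => v m = v n) n erefl).
have wl : linear w by move=> a m n; apply/val_inj; rewrite /= linearP.
apply: (mapl_right_exact (v := linpack wl)).
- by move=> p; have [n e] := submP p; exists n; apply/val_inj.
- by move=> m /(congr1 val); exact: uv.
apply: (flat_mono (u := @subm_inc _ _ _ cl)); first exact: val_inj.
by rewrite (mapl_comp (w := v)).
Qed.
End Flat.

Section BaseChange.
Variables (A B : comPzRingType) (phi : {rmorphism A -> B}).
Local Notation T N := (tensor N (restr phi B^o)).

Section Lift.
Variables (N : lmodType A) (G : zmodType) (b : N -> B -> G).

Definition bc_balanced : Prop := @balanced A N (restr phi B^o) G b.
Definition bc_tens (n : N) (r : B) : T N := @tens A N (restr phi B^o) n r.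
Definition bc_lift : T N -> G := @tensor_lift A N (restr phi B^o) G b.

(* [b] exhibits [G] as the base change of [N] along [phi]. *)
Definition base_change : Prop :=
  [/\ bc_balanced, forall g, exists t, bc_lift t = g & forall t, bc_lift t = 0 -> t = 0].

Lemma bc_tens_ind (P : T N -> Prop) :
  P 0 -> (forall n r, P (bc_tens n r)) -> (forall t u, P t -> P u -> P (t + u)) ->
  forall t, P t.
Proof. exact: (@tensor_ind A N (restr phi B^o)). Qed.

Hypothesis hb : bc_balanced.
Lemma bc_lift0 : bc_lift 0 = 0. Proof. exact: (tensor_lift0 hb). Qed.
Lemma bc_liftD s t : bc_lift (s + t) = bc_lift s + bc_lift t.
Proof. exact: (tensor_liftD hb). Qed.
Lemma bc_liftB s t : bc_lift (s - t) = bc_lift s - bc_lift t.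
Proof. exact: (tensor_liftB hb). Qed.
Lemma bc_liftE n r : bc_lift (bc_tens n r) = b n r.
Proof. exact: (tensor_lift_tens hb). Qed.
Lemma bc_balD n n' r : b (n + n') r = b n r + b n' r. Proof. by case: hb. Qed.
Lemma bc_bal0 r : b 0 r = 0.
Proof. by apply: (addrI (b 0 r)); rewrite -bc_balD !addr0. Qed.
End Lift.

Definition bc_map (M N : lmodType A) (u : {linear M -> N}) : T M -> T N := tensor_mapl u.
Lemma bc_mapE (M N : lmodType A) (u : {linear M -> N}) m r :
  bc_map u (bc_tens m r) = bc_tens (u m) r.
Proof. exact: maplE. Qed.

Lemma bc_mapD (M N : lmodType A) (u : {linear M -> N}) s t :
  bc_map u (s + t) = bc_map u s + bc_map u t.
Proof. exact: maplD. Qed.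
Lemma bc_map0 (M N : lmodType A) (u : {linear M -> N}) : bc_map u 0 = 0.
Proof. exact: mapl0. Qed.

Lemma bc_lift_map (M N : lmodType A) (P Q : zmodType) (b : M -> B -> P) (b' : N -> B -> Q)
    (d : {linear M -> N}) (e : P -> Q) (t : T M) :
  bc_balanced b -> bc_balanced b' -> (forall x y, e (x + y) = e x + e y) ->
  (forall m r, e (b m r) = b' (d m) r) ->
  bc_lift b' (bc_map d t) = e (bc_lift b t).
Proof.
move=> hb hb' eD be.
elim/bc_tens_ind: t => [|m r|s t IHs IHt].
- rewrite /bc_map mapl0 !bc_lift0 //; apply: (addrI (e 0)).
  by rewrite -eD !addr0.
- by rewrite bc_mapE !bc_liftE.
- by rewrite /bc_map maplD !bc_liftD // eD IHs IHt.
Qed.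
End BaseChange.
Arguments bc_lift {A B} phi {N G} b t.
Arguments bc_map {A B} phi {M N} u t.
Arguments bc_tens {A B} phi {N} n r.

Section CohomologyClasses.
(* [cls] is only meaningful on cocycles. *)
Definition is_coh (C : nat -> zmodType) (d : forall n, C n -> C n.+1) (i : nat)
    (H : zmodType) (cls : C i -> H) : Prop :=
  [/\ forall z z', d i z = 0 -> d i z' = 0 -> cls (z + z') = cls z + cls z',
      forall h, exists2 z, d i z = 0 & cls z = h
    & forall z, d i z = 0 -> (cls z = 0 <-> bnd d z)].

Lemma is_coh_quasi_iso (C D : nat -> zmodType) (d : forall n, C n -> C n.+1)
    (e : forall n, D n -> D n.+1) (f : forall n, C n -> D n) i (H : zmodType)
    (cls : D i -> H) :
  (forall n x y, f n (x + y) = f n x + f n y) ->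
  (forall n x, f n.+1 (d n x) = e n (f n x)) ->
  (forall n, e n 0 = 0) ->
  (forall n x y, e n (x + y) = e n x + e n y) ->
  quasi_iso d e f -> is_coh e cls -> is_coh d (fun z => cls (f i z)).
Proof.
move=> fD fd e0 eD q [cD cS cK].
have f0 n : f n 0 = 0 by apply: (addrI (f n 0)); rewrite -fD !addr0.
have fz z : d i z = 0 -> e i (f i z) = 0 by rewrite -fd => ->; rewrite f0.
have fN n x : f n (- x) = - f n x by apply: (addrI (f n x)); rewrite -fD !subrr f0.
have eN n x : e n (- x) = - e n x by apply: (addrI (e n x)); rewrite -eD !subrr e0.
split.
- by move=> z z' hz hz'; rewrite fD; apply: cD; exact: fz.
- move=> h; have [w w0 <-] := cS h; have [_ /(_ w w0) [z z0 wz]] := q i.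
  exists z => //.
  have e1 : e i (w - f i z) = 0 by rewrite eD eN w0 fz // subr0.
  have {}wz : cls (w - f i z) = 0 by apply/(cK _ e1).
  by rewrite -[w in RHS](subrK (f i z)) cD ?wz ?add0r //; exact: fz.
- move=> z z0; rewrite cK; last exact: fz.
  split; first by case: (q i) => h _; exact: h.
  case: i z z0 cls cD cS cK fz => [|i] z z0 cls cD cS cK fz /=; first by move=> ->; rewrite f0.
  by case=> y <-; exists (f i y); rewrite fd.
Qed.
End CohomologyClasses.

Section FlatCohomology.
Variables (A B : comPzRingType) (phi : {rmorphism A -> B}) (phi_flat : flat phi).
Local Notation T N := (tensor N (restr phi B^o)).
Variables (K0 K1 K2 : lmodType A) (d0 : {linear K0 -> K1}) (d1 : {linear K1 -> K2}).
Hypothesis dd : forall x, d1 (d0 x) = 0.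
Variables (L0 L1 L2 : zmodType) (e0 : L0 -> L1) (e1 : L1 -> L2).
Hypothesis e0D : forall x y, e0 (x + y) = e0 x + e0 y.
Hypothesis e1D : forall x y, e1 (x + y) = e1 x + e1 y.
Variables (b0 : K0 -> B -> L0) (b1 : K1 -> B -> L1) (b2 : K2 -> B -> L2).
Hypothesis bb0 : base_change phi b0.
Hypothesis bb1 : base_change phi b1.
Hypothesis bb2 : base_change phi b2.
Hypothesis be0 : forall m r, e0 (b0 m r) = b1 (d0 m) r.
Hypothesis be1 : forall m r, e1 (b1 m r) = b2 (d1 m) r.
Variables (H : lmodType A) (cls : K1 -> H).
Hypothesis clsD : forall z z', d1 z = 0 -> d1 z' = 0 -> cls (z + z') = cls z + cls z'.
Hypothesis clsZ : forall a z, d1 z = 0 -> cls (a *: z) = a *: cls z.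
Hypothesis clsS : forall h, exists2 z, d1 z = 0 & cls z = h.
Hypothesis clsK : forall y, cls (d0 y) = 0.
Variables (H' : zmodType) (cls' : L1 -> H').
Hypothesis clsD' : forall z z', e1 z = 0 -> e1 z' = 0 -> cls' (z + z') = cls' z + cls' z'.
Hypothesis clsS' : forall h, exists2 z, e1 z = 0 & cls' z = h.
Hypothesis clsK' : forall z, e1 z = 0 -> cls' z = 0 -> exists y, e0 y = z.
Variable c : H -> B -> H'.
Hypothesis c_bal : bc_balanced phi c.
Hypothesis cE : forall z r, d1 z = 0 -> c (cls z) r = cls' (b1 z r).

Lemma additive0 (U W : zmodType) (f : U -> W) : (forall x y, f (x + y) = f x + f y) -> f 0 = 0.
Proof. by move=> fD; apply: (addrI (f 0)); rewrite -fD !addr0. Qed.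

Let Zcl : lin_closed (fun z : K1 => d1 z = 0).
Proof. by split=> [|a m n hm hn]; rewrite ?linear0 // linearP hm hn scaler0 addr0. Qed.
Let Z : lmodType A := subm Zcl.
Let zinc : {linear Z -> K1} := @subm_inc _ _ _ Zcl.
Let zcls_lin : linear (fun z : Z => cls (zinc z)).
Proof.
move=> a m n; have zm : d1 (zinc m) = 0 := submP m; have zn : d1 (zinc n) = 0 := submP n.
have zam : d1 (a *: zinc m) = 0 by rewrite linearZ /= zm scaler0.
by rewrite linearP clsD // clsZ.
Qed.
Let zcls : {linear Z -> H} := linpack zcls_lin.

Let zcls_surj h : exists z, zcls z = h.
Proof. by have [z z0 <-] := clsS h; exists (mksubm Zcl z0). Qed.

Let zlift (s : T Z) : e1 (bc_lift phi b1 (bc_map phi zinc s)) = 0 /\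
  cls' (bc_lift phi b1 (bc_map phi zinc s)) = bc_lift phi c (bc_map phi zcls s).
Proof.
have [hb _ _] := bb1; have [hb2 _ _] := bb2.
elim/bc_tens_ind: s => [|z r|s t [IHs1 IHs2] [IHt1 IHt2]].
- rewrite /bc_map !mapl0 !bc_lift0 // (additive0 e1D); split=> //.
  by apply: (addrI (cls' 0)); rewrite -clsD' ?addr0 // additive0.
- rewrite !bc_mapE !bc_liftE // be1.
  have z0 : d1 (zinc z) = 0 := submP z.
  split; last by rewrite -cE.
  by rewrite z0 (bc_bal0 hb2).
- by rewrite /bc_map !maplD !bc_liftD // e1D IHs1 IHt1 addr0 clsD' // IHs2 IHt2.
Qed.

Lemma flat_cohomology : base_change phi c.
Proof.
have [hb bS bI] := bb1; have [hb0 b0S _] := bb0; have [hb2 _ b2I] := bb2.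
split=> //.
- move=> h'; have [w w0 <-] := clsS' h'.
  have [t tE] := bS w.
  have zex n : d1 n = 0 -> exists m, zinc m = n by move=> n0; exists (mksubm Zcl n0).
  have d1t : bc_map phi d1 t = 0.
    by apply: b2I; rewrite (bc_lift_map _ hb hb2 e1D be1) tE.
  have [s sE] := flat_exact phi_flat zex d1t.
  exists (bc_map phi zcls s).
  by rewrite -(proj2 (zlift s)) /bc_map sE tE.
- move=> t t0; have [s sE] := mapl_surj zcls_surj t.
  have [z1 z2] := zlift s; rewrite /bc_map sE t0 in z2.
  have [l lE] := clsK' z1 z2; have [y yE] := b0S l.
  pose w x : Z := mksubm Zcl (dd x).
  have wl : linear w by move=> a m n; apply/val_inj; rewrite /= linearP.
  have sy : s = bc_map phi (linpack wl) y.
    apply/eqP; rewrite -subr_eq0; apply/eqP.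
    apply: (flat_mono phi_flat (u := zinc)); first exact: val_inj.
    rewrite /bc_map maplB (mapl_comp (w := d0)) //; apply: bI.
    by rewrite -/(bc_map phi zinc s) bc_liftB // (bc_lift_map _ hb0 hb e0D be0) yE lE subrr.
  rewrite -sE sy.
  have ul : linear (fun x => zcls (linpack wl x)) by move=> a m n; rewrite !linearP.
  rewrite (mapl_comp (w := linpack ul)) //; apply: mapl_eq0 => x.
  exact: clsK.
Qed.
End FlatCohomology.

Section BaseChangeProduct.
Variables (A B : comPzRingType) (phi : {rmorphism A -> B}).
Variables (N : lmodType A) (G : zmodType) (b : N -> B -> G).
Variables (Y : finType) (Ny : Y -> lmodType A) (Gy : Y -> zmodType).
Variable by_ : forall y, Ny y -> B -> Gy y.
Variables (pi : forall y, {linear N -> Ny y}) (io : forall y, {linear Ny y -> N}).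
Variables (pi' : forall y, G -> Gy y) (io' : forall y, Gy y -> G).
Hypothesis b_bal : bc_balanced phi b.
Hypothesis bc_y : forall y, base_change phi (@by_ y).
Hypothesis piD : forall y x x', pi' y (x + x') = pi' y x + pi' y x'.
Hypothesis ioD : forall y x x', @io' y (x + x') = io' x + io' x'.
Hypothesis pib : forall y n r, pi' y (b n r) = by_ (pi y n) r.
Hypothesis iob : forall y m r, io' (by_ m r) = b (io y m) r.
Hypothesis sumN : forall n, \sum_(y : Y) io y (pi y n) = n.
Hypothesis sumG : forall g, \sum_(y : Y) io' (pi' y g) = g.

Lemma base_change_prod : base_change phi b.
Proof.
split=> //.
- move=> g.
  have ex y : exists t, bc_lift phi (@by_ y) t = pi' y g by case: (bc_y y).
  pose t y := projT1 (cid (ex y)).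
  have tE y : bc_lift phi (@by_ y) (t y) = pi' y g := projT2 (cid (ex y)).
  exists (\sum_(y : Y) bc_map phi (io y) (t y)).
  rewrite -[RHS]sumG (big_morph _ (bc_liftD b_bal) (bc_lift0 b_bal)).
  apply: eq_bigr => y _; have [hy _ _] := bc_y y.
  by rewrite (bc_lift_map _ hy b_bal (@ioD y) (@iob y)) tE.
- move=> t t0.
  have tE : t = \sum_(y : Y) bc_map phi (io y) (bc_map phi (pi y) t).
    elim/bc_tens_ind: {t0} t => [|n r|s t {1}-> {1}->].
    - by rewrite big1 // => y _; rewrite !bc_map0.
    - under eq_bigr do rewrite !bc_mapE.
      rewrite -[in LHS](sumN n).
      apply: (big_morph (fun n => bc_tens phi n r)) => [x y|]; first exact: tensDl.
      exact: tens0l.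
    - by rewrite -big_split; apply: eq_bigr => y _; rewrite /bc_map !maplD.
  rewrite tE big1 // => y _; have [hy _ iy] := bc_y y.
  rewrite (_ : bc_map phi (pi y) t = 0) /bc_map ?mapl0 //; apply: iy.
  rewrite -/(bc_map phi (pi y) t) (bc_lift_map _ b_bal hy (piD y) (@pib y)) t0.
  by apply: (addrI (pi' y 0)); rewrite -piD !addr0.
Qed.
End BaseChangeProduct.

Section ModuleBaseChange.
Variables (A B : comPzRingType) (phi : {rmorphism A -> B}).
Variables (N : lmodType A) (N' : lmodType B) (f : N -> N').

Definition mod_base_change : Prop :=
  semilinear phi f /\ base_change phi (fun n r => r *: f n).

Lemma semilinear_balanced : semilinear phi f -> bc_balanced phi (fun n r => r *: f n).
Proof.
move=> hf; split=> [m m' r|m r r'|a m r]; first by rewrite (semilinD hf) scalerDr.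
  by rewrite scalerDl.
by rewrite (semilinZ hf) scalerA mulrC.
Qed.

End ModuleBaseChange.

Section BaseChangeComp.
Variables (A B C : comPzRingType) (phi : {rmorphism A -> B}) (psi : {rmorphism B -> C}).
Variable chi : {rmorphism A -> C}.
Hypothesis chiE : forall a, chi a = psi (phi a).
Variables (N : lmodType A) (N' : lmodType B) (N'' : lmodType C).
Variables (f : N -> N') (g : N' -> N'') (h : N -> N'').
Hypothesis hE : forall n, h n = g (f n).
Hypothesis fb : mod_base_change phi f.
Hypothesis gb : mod_base_change psi g.

Lemma base_change_comp : mod_base_change chi h.
Proof.
case: fb gb => fl [fB fS fI] [gl [gB gS gI]].
have hl : semilinear chi h by move=> a x y; rewrite !hE fl gl chiE.
split=> //; have hB := semilinear_balanced hl; split=> //.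
- move=> x; have [t <-] := gS x; elim/bc_tens_ind: t => [|n' c|s t [s' sE] [t' tE]].
  + by exists 0; rewrite !bc_lift0.
  + have [t <-] := fS n'; rewrite bc_liftE //.
    elim/bc_tens_ind: t => [|n b|s t [s' sE] [t' tE]].
    * by exists 0; rewrite !bc_lift0 // (semilin0 gl) scaler0.
    * exists (bc_tens chi n (c * psi b)).
      by rewrite !bc_liftE // (semilinZ gl) scalerA hE.
    * by exists (s' + t'); rewrite !bc_liftD // (semilinD gl) scalerDr sE tE.
  + by exists (s' + t'); rewrite !bc_liftD // sE tE.
- move=> t t0.
  pose inv n' := projT1 (cid (fS n')).
  have invE n' : bc_lift phi (fun n r => r *: f n) (inv n') = n' := projT2 (cid (fS n')).
  have inv_eq n' s : bc_lift phi (fun n r => r *: f n) s = n' -> inv n' = s.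
    move=> e; apply/eqP; rewrite -subr_eq0; apply/eqP/fI.
    by rewrite bc_liftB // invE e subrr.
  have invD m n : inv (m + n) = inv m + inv n.
    by apply: inv_eq; rewrite bc_liftD // !invE.
  pose tr (c : C) (n : N) (b : B) := bc_tens chi n (c * psi b).
  have trB c : bc_balanced phi (tr c).
    split=> [m m' r|m r r'|a m r].
    - exact: tensDl.
    - by rewrite /tr rmorphD mulrDr; exact: tensDr.
    - rewrite /tr.
      rewrite [LHS](@tensZ A N (restr chi C^o)).
      congr (tens m _); rewrite -[LHS]/(chi a * (c * psi r)) -[a *: r]/(phi a * (r : B)).
      by rewrite rmorphM chiE mulrCA.
  pose back n' (c : C) := bc_lift phi (tr c) (inv n').
  have backB : bc_balanced psi back.
    split=> [m m' c|n' c c'|b n' c]; first by rewrite /back invD bc_liftD.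
    - rewrite /back; elim/bc_tens_ind: (inv n') => [|n b|s s' IH IH'].
      + by rewrite !bc_lift0 // addr0.
      + by rewrite !bc_liftE // /tr mulrDl; exact: tensDr.
      + by rewrite !bc_liftD // IH IH' addrACA.
    - rewrite /back.
      pose mulb (n : N) (r : B) : tensor N (restr phi B^o) := bc_tens phi n (b * r).
      have mulB : bc_balanced phi mulb.
        split=> [m m' r|m r r'|a m r]; first exact: tensDl.
          by rewrite /mulb mulrDr; exact: tensDr.
        rewrite /mulb [LHS](@tensZ A N (restr phi B^o)); congr (tens m _).
        by rewrite -[LHS]/(phi a * (b * r)) mulrCA.
      rewrite (inv_eq (b *: n') (bc_lift phi mulb (inv n'))).
        elim/bc_tens_ind: (inv n') => [|n r|s s' IH IH'].
        - by rewrite !bc_lift0.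
        - rewrite !bc_liftE // /tr rmorphM mulrA; congr (bc_tens chi n (_ * _)).
          by rewrite mulrC.
        - by rewrite !bc_liftD // IH IH'.
      rewrite -[in RHS](invE n').
      elim/bc_tens_ind: (inv n') => [|n r|s s' IH IH'].
      - by rewrite !bc_lift0 // scaler0.
      - by rewrite !bc_liftE // scalerA.
      - by rewrite !bc_liftD // IH IH' scalerDr.
  pose ep n (c : C) := bc_tens psi (f n) c.
  have epB : bc_balanced chi ep.
    split=> [m m' r|m r r'|a m r]; rewrite /ep.
    - by rewrite (semilinD fl); exact: tensDl.
    - exact: tensDr.
    - rewrite (semilinZ fl) [LHS](@tensZ B N' (restr psi C^o)); congr (tens (f m) _).
      by rewrite -[LHS]/(psi (phi a) * r) -chiE.
  have e1 : bc_lift psi (fun n r => r *: g n) (bc_lift chi ep t) = 0.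
    rewrite -t0; elim/bc_tens_ind: {t0} t => [|n c|s s' IH IH'].
    - by rewrite !bc_lift0.
    - by rewrite !bc_liftE // hE.
    - by rewrite !bc_liftD // IH IH'.
  have e2 : bc_lift psi back (bc_lift chi ep t) = t.
    elim/bc_tens_ind: {t0 e1} t => [|n c|s s' IH IH'].
    - by rewrite !bc_lift0.
    - rewrite bc_liftE // bc_liftE // /back (inv_eq _ (bc_tens phi n 1)).
        by rewrite bc_liftE // /tr rmorph1 mulr1.
      by rewrite bc_liftE // scale1r.
    - by rewrite !bc_liftD // IH IH'.
  by rewrite -e2 (gI _ e1) bc_lift0.
Qed.
End BaseChangeComp.

Section RingChange.
Variables (A A' R R' : comPzRingType) (phi : {rmorphism A -> A'}) (rho : {rmorphism R -> R'}).
Variables (al : {rmorphism A -> R}) (al' : {rmorphism A' -> R'}).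
Hypothesis pushout : base_change phi (N := restr al R^o) (fun (r : R) (a : A') => rho r * al' a).
Variables (N : lmodType R) (N' : lmodType R') (f : N -> N') (fl : semilinear rho f).

Let NA : lmodType A := restr al N.
Let NA' : lmodType A' := restr al' N'.

Let al_comm a : rho (al a) = al' (phi a).
Proof.
have e : rho (al a * 1) * al' 1 = rho 1 * al' (phi a * 1).
  by case: pushout => [[_ _ h] _ _]; exact: (h a 1 1).
by rewrite !mulr1 !rmorph1 mulr1 mul1r in e.
Qed.

Let flA : @semilinear A A' phi NA NA' f.
Proof.
move=> a x y; rewrite -[a *: x + y]/(al a *: (x : N) + y) fl al_comm.
by [].
Qed.

Let B_A : bc_balanced phi (N := NA) (fun n (r : A') => al' r *: f n).
Proof. exact: (semilinear_balanced (N := NA) (N' := NA') flA). Qed.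
Let B_R : bc_balanced rho (fun n r => r *: f n).
Proof. exact: semilinear_balanced. Qed.

Let ga (n : NA) (a : A') : tensor N (restr rho R'^o) := bc_tens rho (n : N) (al' a).
Let gaB : bc_balanced phi (N := NA) ga.
Proof.
split=> [m m' a|m a a'|c m a]; rewrite /ga; first exact: tensDl.
  by rewrite rmorphD; exact: tensDr.
rewrite -[c *: m]/(al c *: (m : N)) [LHS](@tensZ R N (restr rho R'^o)); congr (tens (m : N) _).
by rewrite -[LHS]/(rho (al c) * al' a) al_comm -rmorphM.
Qed.

Let gaS t : exists s, bc_lift phi (N := NA) ga s = t.
Proof.
elim/bc_tens_ind: t => [|n r|s t [s' sE] [t' tE]].
- by exists 0; rewrite bc_lift0.
- case: (pushout) => pB pS _; have [x <-] := pS r.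
  elim/bc_tens_ind: x => [|q a|x y [s sE] [t tE]].
  + exists 0; rewrite !bc_lift0 //; symmetry; exact: (@tens0r R N (restr rho R'^o)).
  + exists (bc_tens phi (N := NA) (q *: n) a); rewrite !bc_liftE // /ga.
    exact: (@tensZ R N (restr rho R'^o)).
  + exists (s + t); rewrite !bc_liftD // sE tE; symmetry.
    exact: (@tensDr R N (restr rho R'^o)).
- by exists (s' + t'); rewrite bc_liftD // sE tE.
Qed.

Let gaE s : bc_lift rho (fun n r => r *: f n) (bc_lift phi (N := NA) ga s) =
  bc_lift phi (N := NA) (fun n (r : A') => al' r *: f n) s.
Proof.
elim/bc_tens_ind: s => [|n r|s t IH IH']; first by rewrite !bc_lift0.
  by rewrite !bc_liftE.
by rewrite !bc_liftD // IH IH'.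
Qed.

Lemma ring_change_up : base_change phi (N := NA) (fun n (r : A') => al' r *: f n) ->
  base_change rho (fun n r => r *: f n).
Proof.
move=> [_ S I]; split=> // [g|t t0].
  by have [s <-] := S g; exists (bc_lift phi (N := NA) ga s); rewrite gaE.
have [s sE] := gaS t; rewrite -sE gaE in t0.
by rewrite -sE (I _ t0) bc_lift0.
Qed.

Lemma ring_change_down : base_change rho (fun n r => r *: f n) ->
  base_change phi (N := NA) (fun n (r : A') => al' r *: f n).
Proof.
move=> [_ S I]; split=> // [g|s s0].
  by have [t <-] := S g; have [s <-] := gaS t; exists s; rewrite gaE.
case: (pushout) => pB pS pI.
pose inv r := projT1 (cid (pS r)).
have invE r : bc_lift phi (N := restr al R^o) (fun (r : R) (a : A') => rho r * al' a) (inv r) = r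
  := projT2 (cid (pS r)).
have inv_eq r x : bc_lift phi (N := restr al R^o) (fun (r : R) (a : A') => rho r * al' a) x = r ->
    inv r = x.
  move=> e; apply/eqP; rewrite -subr_eq0; apply/eqP/pI.
  by rewrite bc_liftB // invE e subrr.
have invD x y : inv (x + y) = inv x + inv y.
  by apply: inv_eq; rewrite bc_liftD // !invE.
have mul : forall n : N, linear (fun r : restr al R^o => ((r : R) *: n : NA)).
  move=> n a x y; rewrite -[a *: x + y]/(al a * (x : R) + y) scalerDl -scalerA.
  by [].
pose mu n := linpack (mul n).
have muD m n x : bc_map phi (mu (m + n)) x = bc_map phi (mu m) x + bc_map phi (mu n) x.
  elim/bc_tens_ind: x => [|r a|x y IH IH'].
  - by rewrite !bc_map0 addr0.
  - rewrite !bc_mapE /= scalerDr; exact: (@tensDl A NA).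
  - by rewrite !bc_mapD IH IH' addrACA.
have rmulL (r : R) : linear (fun x : restr al R^o => (r * (x : R) : restr al R^o)).
  move=> a x y; rewrite -[a *: x + y]/(al a * (x : R) + y) mulrDr mulrCA.
  by [].
pose de (n : N) (r : R') := bc_map phi (mu n) (inv r).
have deB : bc_balanced rho de.
  split=> [m m' r|m r r'|c m r]; rewrite /de; first exact: muD.
    by rewrite invD /bc_map maplD.
  rewrite (inv_eq (c *: (r : restr rho R'^o)) (bc_map phi (linpack (rmulL c)) (inv r))).
    rewrite /bc_map (mapl_comp (w := mu (c *: m))) //.
    by move=> x; rewrite /= scalerA mulrC.
  rewrite -[c *: _]/(rho c * r) -[in RHS](invE r).
  elim/bc_tens_ind: (inv r) => [|x a|x y IH IH'].
  - by rewrite bc_map0 !bc_lift0 // mulr0.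
  - by rewrite bc_mapE !bc_liftE // /= rmorphM mulrA.
  - by rewrite bc_mapD !bc_liftD // IH IH' mulrDr.
have dega x : bc_lift rho de (bc_lift phi (N := NA) ga x) = x.
  elim/bc_tens_ind: x => [|n a|x y IH IH'].
  - by rewrite !bc_lift0.
  - rewrite !bc_liftE // /de (inv_eq _ (bc_tens phi (N := restr al R^o) (1 : R) a)).
      by rewrite bc_mapE /= scale1r.
    by rewrite bc_liftE // rmorph1 mul1r.
  - by rewrite !bc_liftD // IH IH'.
by rewrite -(dega s) (I (bc_lift phi (N := NA) ga s)) ?gaE // bc_lift0.
Qed.
End RingChange.

Section RTensorPushout.
Variables (k A A' C : comPzRingType).
Variables (kA : {rmorphism k -> A}) (kA' : {rmorphism k -> A'}) (kC : {rmorphism k -> C}).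
Variables (phi : {rmorphism A -> A'}).
Hypothesis phik : forall c, phi (kA c) = kA' c.

Lemma rtensor_pushoutr (rho : {rmorphism rtensor kC kA -> rtensor kC kA'}) :
  (forall c a, rho (rtens kC kA c a) = rtens kC kA' c (phi a)) ->
  base_change phi (N := restr (rinr kC kA) (rtensor kC kA)^o)
    (fun (r : rtensor kC kA) (a : A') => rho r * rinr kC kA' a).
Proof.
move=> rhoE.
have bal : bc_balanced phi (N := restr (rinr kC kA) (rtensor kC kA)^o)
    (fun (r : rtensor kC kA) (a : A') => rho r * rinr kC kA' a).
  split=> [m m' r|m r r'|a m r]; first by rewrite rmorphD mulrDl.
    by rewrite rmorphD mulrDr.
  rewrite -[a *: m]/(rinr kC kA a * (m : rtensor kC kA)) -[a *: r]/(phi a * (r : A')).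
  by rewrite !rmorphM [rho (rinr _ _ _)]rhoE mulrCA mulrA.
split=> // [g|t t0].
  elim/rtensor_ind: g => [|c a|s t [s' sE] [t' tE]].
  - by exists 0; rewrite bc_lift0.
  - exists (bc_tens phi (N := restr (rinr kC kA) (rtensor kC kA)^o) (rtens kC kA c 1) a).
    by rewrite bc_liftE // rhoE /rinr rtensM mulr1 rmorph1 mul1r.
  - by exists (s' + t'); rewrite bc_liftD // sE tE.
pose inv (c : C) (a : A') : tensor (restr (rinr kC kA) (rtensor kC kA)^o) (restr phi A'^o) :=
  bc_tens phi (N := restr (rinr kC kA) (rtensor kC kA)^o) (rtens kC kA c 1) a.
have invB : rbalanced kC kA' inv.
  split=> [c c' a|c a a'|x c a]; rewrite /inv.
  - by rewrite rtensDl; exact: tensDl.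
  - exact: tensDr.
  - rewrite rtensZ mulr1.
    have -> : rtens kC kA c (kA x) = (kA x) *: (rtens kC kA c 1 : restr (rinr kC kA) (rtensor kC kA)^o).
      by rewrite -[RHS]/(rinr kC kA (kA x) * rtens kC kA c 1) /rinr rtensM mul1r mulr1.
    by rewrite [LHS]tensZ; congr (tens _ _); rewrite -[LHS]/(phi (kA x) * a) phik.
suff -> : t = rlift inv (bc_lift phi (N := restr (rinr kC kA) (rtensor kC kA)^o)
    (fun (r : rtensor kC kA) (a : A') => rho r * rinr kC kA' a) t) by rewrite t0 rlift0.
elim/bc_tens_ind: {t0} t => [|r a|s t {1}-> {1}->].
- by rewrite bc_lift0 // rlift0.
- rewrite bc_liftE //; elim/rtensor_ind: r => [|c x|r r' IH IH'].
  + by rewrite rmorph0 mul0r rlift0 //; exact: tens0l.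
  + rewrite rhoE /rinr rtensM mulr1 rliftE // /inv.
    have -> : rtens kC kA c x = x *: (rtens kC kA c 1 : restr (rinr kC kA) (rtensor kC kA)^o).
      by rewrite -[RHS]/(rinr kC kA x * rtens kC kA c 1) /rinr rtensM mul1r mulr1.
    by rewrite [LHS]tensZ; congr (tens _ _).
  + rewrite rmorphD mulrDl rliftD // -IH -IH'; exact: tensDl.
- by rewrite bc_liftD // rliftD.
Qed.

Lemma rtensor_pushoutl (rho : {rmorphism rtensor kA kC -> rtensor kA' kC}) :
  (forall a c, rho (rtens kA kC a c) = rtens kA' kC (phi a) c) ->
  base_change phi (N := restr (rinl kA kC) (rtensor kA kC)^o)
    (fun (r : rtensor kA kC) (a : A') => rho r * rinl kA' kC a).
Proof.
move=> rhoE; pose RA := restr (rinl kA kC) (rtensor kA kC)^o.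
have bal : bc_balanced phi (N := RA)
    (fun (r : rtensor kA kC) (a : A') => rho r * rinl kA' kC a).
  split=> [m m' r|m r r'|a m r]; first by rewrite rmorphD mulrDl.
    by rewrite rmorphD mulrDr.
  rewrite -[a *: m]/(rinl kA kC a * (m : rtensor kA kC)) -[a *: r]/(phi a * (r : A')).
  by rewrite !rmorphM [rho (rinl _ _ _)]rhoE mulrCA mulrA.
split=> // [g|t t0].
  elim/rtensor_ind: g => [|a c|s t [s' sE] [t' tE]].
  - by exists 0; rewrite bc_lift0.
  - exists (bc_tens phi (N := RA) (rtens kA kC 1 c) a).
    by rewrite bc_liftE // rhoE /rinl rtensM mulr1 rmorph1 mul1r.
  - by exists (s' + t'); rewrite bc_liftD // sE tE.
pose inv (a : A') (c : C) : tensor RA (restr phi A'^o) :=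
  bc_tens phi (N := RA) (rtens kA kC 1 c) a.
have sE x c : rtens kA kC x c = x *: (rtens kA kC 1 c : RA).
  by rewrite -[RHS]/(rinl kA kC x * rtens kA kC 1 c) /rinl rtensM mul1r mulr1.
have invB : rbalanced kA' kC inv.
  split=> [a a' c|a c c'|x a c]; rewrite /inv.
  - exact: tensDr.
  - by rewrite rtensDr; exact: tensDl.
  - rewrite -[kC x * c]mul1r -[1 * (_ * _)]mulrCA -rtensZ mulr1 [1 * c]mul1r (sE (kA x)).
    rewrite [RHS](@tensZ A RA (restr phi A'^o)); congr (tens _ _).
    by rewrite -[RHS]/(phi (kA x) * a) phik.
suff -> : t = rlift inv (bc_lift phi (N := RA)
    (fun (r : rtensor kA kC) (a : A') => rho r * rinl kA' kC a) t) by rewrite t0 rlift0.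
elim/bc_tens_ind: {t0} t => [|r a|s t {1}-> {1}->].
- by rewrite bc_lift0 // rlift0.
- rewrite bc_liftE //; elim/rtensor_ind: r => [|x c|r r' IH IH'].
  + by rewrite rmorph0 mul0r rlift0 //; exact: tens0l.
  + rewrite rhoE /rinl rtensM mulr1 rliftE // /inv sE.
    by rewrite [LHS]tensZ; congr (tens _ _).
  + rewrite rmorphD mulrDl rliftD // -IH -IH'; exact: tensDl.
- by rewrite bc_liftD // rliftD.
Qed.
End RTensorPushout.

(** * Quasi-coherence as base change *)

Section FreeSum.
Variables (R : pzRingType) (I : Type).
Implicit Types f g : free_mod R I.

Lemma supp_ex f : exists s : seq {classic I}, uniq s /\ forall i, (i \in s) = (f i != 0).
Proof.
have /asboolP : free_val f \in @fin_supp R I by case: f.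
move/(finite_seqP (T := {classic I})) => [s sE]; exists (undup s).
split=> [|i]; first exact: undup_uniq.
rewrite mem_undup; apply/idP/idP => [h|h].
  by have : [set` s]%classic i by []; rewrite -sE.
by have : [set i : I | f i != 0]%classic i by []; rewrite sE.
Qed.
Definition supp f : seq {classic I} := projT1 (cid (supp_ex f)).
Lemma supp_uniq f : uniq (supp f). Proof. by case: (projT2 (cid (supp_ex f))). Qed.
Lemma suppE f i : (i \in supp f) = (f i != 0).
Proof. by case: (projT2 (cid (supp_ex f))). Qed.

Section Sum.
Variables (V : zmodType) (F : I -> R -> V).
Hypothesis FD : forall i a b, F i (a + b) = F i a + F i b.

Definition fsum f : V := \sum_(i <- supp f) F i (f i).

Let F0 i : F i 0 = 0. Proof. by apply: (addrI (F i 0)); rewrite -FD !addr0. Qed.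

Lemma fsum_sub f (s : seq {classic I}) : uniq s -> {subset supp f <= s} ->
  fsum f = \sum_(i <- s) F i (f i).
Proof.
move=> us sub; rewrite (bigID (fun i : {classic I} => f i != 0)) /= [X in _ + X]big1 ?addr0; last first.
  by move=> i /negPn /eqP ->; exact: F0.
rewrite -big_filter; apply: perm_big; apply: uniq_perm.
- exact: supp_uniq.
- exact: filter_uniq.
- move=> i; rewrite mem_filter suppE; case: eqVneq => //= fi.
  by symmetry; apply: sub; rewrite suppE.
Qed.

Lemma fsumD f g : fsum (f + g) = fsum f + fsum g.
Proof.
pose s : seq {classic I} := undup (supp f ++ supp g).
have us : uniq s := undup_uniq _.
rewrite !(fsum_sub (s := s)) //.
- by rewrite -big_split; apply: eq_bigr => i _; exact: FD.
- by move=> i; rewrite mem_undup mem_cat => ->; rewrite orbT.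
- by move=> i; rewrite mem_undup mem_cat => ->.
- move=> i; rewrite mem_undup mem_cat !suppE.
  rewrite -[free_val _ i]/(f i + g i).
  case: (eqVneq (f i) 0) => [->|//]; case: (eqVneq (g i) 0) => [->|//].
  by rewrite addr0 eqxx.
Qed.
Lemma fsum0 : fsum 0 = 0.
Proof. by apply: (addrI (fsum 0)); rewrite -fsumD !addr0. Qed.

End Sum.

Lemma single_subproof (i : I) (r : R) :
  (fun j => if `[< j = i >] then r else 0 : R^o) \in @fin_supp R I.
Proof.
apply/asboolP; apply: (sub_finite_set _ (finite_set1 i)) => j /=.
by case: asboolP => // _; rewrite eqxx.
Qed.
Definition single i r : free_mod R I := FreeMod (single_subproof i r).

Lemma free_ext f g : (forall i, f i = g i) -> f = g.
Proof. by move=> e; apply/val_inj/funext. Qed.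

Lemma fsum_single (V : zmodType) (F : I -> R -> V) i r :
  (forall i a b, F i (a + b) = F i a + F i b) -> fsum F (single i r) = F i r.
Proof.
move=> FD; rewrite (fsum_sub FD (s := [:: (i : {classic I})])) //.
  by rewrite big_seq1 /=; case: asboolP.
move=> j; rewrite suppE /= inE; case: asboolP => [->|]; by rewrite eqxx.
Qed.

Lemma single_sum f : f = \sum_(i <- supp f) single i (f i).
Proof.
apply: free_ext => j.
have -> : free_val (\sum_(i <- supp f) single i (f i)) j = \sum_(i <- supp f) single i (f i) j.
  by apply: (big_morph (fun f : free_mod R I => f j)).
case: (boolP ((j : {classic I}) \in supp f)) => jf.
  rewrite (bigD1_seq (j : {classic I})) ?supp_uniq //= big1 ?addr0.
    by case: asboolP.
  by move=> i ij; case: asboolP => // e; rewrite e eqxx in ij.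
rewrite big_seq big1 => [|i hi].
  by move: jf; rewrite suppE negbK => /eqP.
by rewrite /=; case: asboolP => // e; rewrite -e (negbTE jf) in hi.
Qed.

Lemma free_ind (P : free_mod R I -> Prop) :
  P 0 -> (forall i r, P (single i r)) -> (forall f g, P f -> P g -> P (f + g)) -> forall f, P f.
Proof.
by move=> P0 Ps PD f; rewrite [f]single_sum; elim/big_ind: _.
Qed.

Lemma singleD i r s : single i (r + s) = single i r + single i s.
Proof.
apply: free_ext => j; rewrite -[RHS]/(single i r j + single i s j) /=.
by case: ifP => // _; rewrite addr0.
Qed.
Lemma singleZ i r s : r *: single i s = single i (r * s).
Proof.
apply: free_ext => j; rewrite -[LHS]/(r * single i s j) /=.
by case: ifP => // _; rewrite mulr0.
Qed.

Section Lin.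
Variables (V : lmodType R) (c : I -> V).
Definition fcomb : free_mod R I -> V := fsum (fun i r => r *: c i).
Let FD i a b : (a + b) *: c i = a *: c i + b *: c i. Proof. exact: scalerDl. Qed.
Lemma fcombD f g : fcomb (f + g) = fcomb f + fcomb g. Proof. exact: fsumD. Qed.
Lemma fcomb_single i r : fcomb (single i r) = r *: c i. Proof. exact: fsum_single. Qed.
Lemma fcomb_lin : linear fcomb.
Proof.
move=> a f g; rewrite fcombD; congr (_ + _).
elim/free_ind: f => [|i r|x y IH IH'].
- by rewrite scaler0 [fcomb 0]fsum0 ?scaler0.
- by rewrite singleZ !fcomb_single scalerA.
- by rewrite scalerDr !fcombD IH IH' scalerDr.
Qed.
HB.instance Definition _ := GRing.isLinear.Build R (free_mod R I) V _ fcomb fcomb_lin.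
End Lin.
End FreeSum.

Section FreeHom.
Variables (k : comPzRingType) (X : rspace k) (I : Type) (N : omodule X).
Variable n : I -> forall x : X, N x.
Hypothesis nres : forall i (x y : X) (h : le x y), mres N h (n i x) = n i y.

Lemma free_res_single (x y : X) (h : le x y) (i : I) r :
  free_res h (single i r) = single i (res h r).
Proof. by apply: free_ext => j /=; case: ifP => // _; rewrite rmorph0. Qed.

Lemma free_hom_res (x y : X) (h : le x y) (f : free_module X I x) :
  mres N h (fcomb (n^~ x) f) = fcomb (n^~ y) (mres (free_module X I) h f).
Proof.
elim/free_ind: f => [|i r|f g IH IH'].
- by rewrite !mres0 !linear0 mres0.
- by rewrite /= free_res_single !fcomb_single mresZ nres.
- by rewrite !mresD !linearD /= mresD IH IH'.
Qed.
Definition free_hom : omhom (free_module X I) N :=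
  OMHom (hfun := fun x => fcomb (n^~ x) : {linear free_module X I x -> N x}) free_hom_res.
End FreeHom.

Section FreeBaseChange.
Variables (k : comPzRingType) (X : rspace k) (I : Type).

Lemma free_base_change (x y : X) (h : le x y) :
  mod_base_change (res h) (mres (free_module X I) h).
Proof.
have sl := mres_lin (o := free_module X I) h.
have B := semilinear_balanced sl.
split=> //; split=> //.
- elim/free_ind => [|i r|f g [s sE] [t tE]].
  + by exists 0; rewrite bc_lift0.
  + exists (bc_tens (res h) (single i 1) r).
    by rewrite bc_liftE // [mres _ _ _]free_res_single rmorph1 singleZ mulr1.
  + by exists (s + t); rewrite bc_liftD // sE tE.
- move=> t t0.
  pose F (i : I) (r : stalk y) := bc_tens (res h) (single i 1 : free_mod (stalk x) I) r.
  have FD i a b : F i (a + b) = F i a + F i b by exact: tensDr.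
  suff -> : t = fsum F (bc_lift (res h) (fun n r => r *: mres (free_module X I) h n) t).
    by rewrite t0 fsum0.
  elim/bc_tens_ind: {t0} t => [|f r|s t {1}-> {1}->].
  + by rewrite bc_lift0 // fsum0.
  + rewrite bc_liftE //; elim/free_ind: f => [|i a|f g IH IH'].
    * by rewrite mres0 scaler0 fsum0 //; exact: tens0l.
    * rewrite [mres _ _ _]free_res_single singleZ fsum_single // /F.
      have -> : single i a = a *: single i 1 :> free_mod (stalk x) I by rewrite singleZ mulr1.
      rewrite [LHS](@tensZ _ _ (restr (res h) (stalk y)^o)); congr (tens _ _).
      by rewrite mulrC.
    * rewrite mresD scalerDr fsumD // -IH -IH'; exact: tensDl.
  + by rewrite bc_liftD // fsumD.
Qed.
End FreeBaseChange.

Section CokernelBaseChange.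
Variables (A B : comPzRingType) (phi : {rmorphism A -> B}).
Variables (F1 F0 N : lmodType A) (F1' F0' N' : lmodType B).
Variables (u : {linear F1 -> F0}) (v : {linear F0 -> N}).
Variables (u' : {linear F1' -> F0'}) (v' : {linear F0' -> N'}).
Variables (f1 : F1 -> F1') (f0 : F0 -> F0') (f : N -> N').
Hypothesis b1 : mod_base_change phi f1.
Hypothesis b0 : mod_base_change phi f0.
Hypothesis fl : semilinear phi f.
Hypothesis fu : forall x, f0 (u x) = u' (f1 x).
Hypothesis fv : forall x, f (v x) = v' (f0 x).
Hypothesis vS : forall n, exists x, v x = n.
Hypothesis vS' : forall n, exists x, v' x = n.
Hypothesis vu : forall x, v (u x) = 0.
Hypothesis vK' : forall x, v' x = 0 -> exists y, u' y = x.

Lemma cokernel_base_change : mod_base_change phi f.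
Proof.
case: b1 b0 => l1 [B1 S1 I1] [l0 [B0 S0 I0]].
have Bf := semilinear_balanced fl; split=> //.
have cv x : bc_lift phi (fun n r => r *: f n) (bc_map phi v x) =
    v' (bc_lift phi (fun n r => r *: f0 n) x).
  apply: bc_lift_map => // [y z|m r]; first exact: linearD.
  by rewrite linearZ fv.
have cu x : bc_lift phi (fun n r => r *: f0 n) (bc_map phi u x) =
    u' (bc_lift phi (fun n r => r *: f1 n) x).
  apply: bc_lift_map => // [y z|m r]; first exact: linearD.
  by rewrite linearZ fu.
split=> // [n'|t t0].
  have [x <-] := vS' n'; have [s <-] := S0 x.
  by exists (bc_map phi v s).
have [s sE] := mapl_surj vS t.
move: t0; rewrite -sE -/(bc_map phi v s) cv => /vK' [y yE].
have [r rE] := S1 y.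
have e : s = bc_map phi u r.
  apply/eqP; rewrite -subr_eq0; apply/eqP/I0.
  by rewrite bc_liftB // cu rE yE subrr.
have wl : linear (fun x => v (u x)) by move=> a x z; rewrite !linearP.
by rewrite e /bc_map (mapl_comp (w := linpack wl)) //; exact: mapl_eq0.
Qed.
End CokernelBaseChange.

Lemma min_open_open (k : comPzRingType) (X : rspace k) (p : X) : is_open (min_open p).
Proof. by move=> x y xy; rewrite !inE => px; exact: le_trans xy. Qed.

Section QuasiCoherent.
Variables (k : comPzRingType) (X : rspace k) (M : omodule X).

Lemma quasi_coherent_base_change : quasi_coherent M ->
  forall (p q : X) (h : le p q), mod_base_change (res h) (mres M h).
Proof.
move=> qc p q h; have [U [Uop pU [I [J [u [v uv]]]]]] := qc p.
have qU := Uop _ _ h pU.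
pose sp : subspace U := Sub p pU; pose sq : subspace U := Sub q qU.
have sh : @le _ (subspace U) sp sq by exact: h.
apply: (@cokernel_base_change _ _ (@res _ (subspace U) sp sq h) _ _ _ _ _ _
  (u sp) (v sp) (u sq) (v sq)
  (mres (free_module (subspace U) J) (h : @le _ (subspace U) sp sq))
  (mres (free_module (subspace U) I) (h : @le _ (subspace U) sp sq))
  (mres (mod_restr M U) (h : @le _ (subspace U) sp sq))).
- exact: (@free_base_change _ (subspace U)).
- exact: (@free_base_change _ (subspace U)).
- exact: mres_lin.
- by move=> x; rewrite hfun_res.
- by move=> x; rewrite hfun_res.
- by case: (uv sp).
- by case: (uv sq).
- by move=> x; case: (uv sp) => _ /(_ (u sp x)) [_]; apply; exists x.
- by move=> x; case: (uv sq) => _ /(_ x) [].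
Qed.

Lemma base_change_quasi_coherent :
  (forall (p q : X) (h : le p q), mod_base_change (res h) (mres M h)) -> quasi_coherent M.
Proof.
move=> bc p; exists (min_open p).
have op := @min_open_open _ _ p.
split=> //; first by rewrite inE le_refl.
have ple (x : subspace (min_open p)) : le p (val x) by have := valP x; rewrite inE.
pose Y := subspace (min_open p).
pose I : Type := M p.
pose ev : {linear free_mod (stalk p) I -> M p} := fcomb (fun m : M p => m).
have kc : lin_closed (fun f => ev f = 0).
  by split=> [|a f g hf hg]; rewrite ?linear0 // linearP hf hg scaler0 addr0.
pose J := subm kc.
pose nv (m : I) (x : Y) : mod_restr M (min_open p) x := mres M (ple x) m.
have nv_res m (x y : Y) (h : le x y) : mres (mod_restr M (min_open p)) h (nv m x) = nv m y.
  exact: (mres_comp _ _ (ple y)).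
pose nu (j : J) (x : Y) : free_module Y I x := free_res (ple x) (val j).
have nu_res j (x y : Y) (h : le x y) : mres (free_module Y I) h (nu j x) = nu j y.
  by apply: free_ext => i; exact: (res_comp _ _ (ple y)).
exists I, J, (free_hom nu_res), (free_hom nv_res) => x.
have vE f : free_hom nv_res x (free_res (ple x) f) = mres M (ple x) (ev f).
  elim/free_ind: f => [|i r|f g IH IH'].
  - rewrite linear0 mres0 -[RHS](linear0 (free_hom nv_res x)); congr (free_hom nv_res x _).
    exact: (mres0 (free_module X I)).
  - by rewrite free_res_single [LHS]fcomb_single [ev _]fcomb_single mresZ.
  - rewrite linearD mresD -IH -IH' -linearD; congr (free_hom nv_res x _).
    exact: (mresD (M := free_module X I)).
have [ml [mB mS mI]] := bc _ _ (ple x).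
have [fl [fB fS fI]] := free_base_change I (ple x).
have cv s : bc_lift (res (ple x)) (fun n r => r *: mres M (ple x) n) (bc_map (res (ple x)) ev s) =
    free_hom nv_res x (bc_lift (res (ple x)) (fun n r => r *: mres (free_module X I) (ple x) n) s).
  apply: bc_lift_map => // [y z|m r]; first exact: linearD.
  by rewrite linearZ; congr (_ *: _); exact: vE.
split.
- move=> m; have [t <-] := mS m; elim/bc_tens_ind: t => [|n r|s t [s' sE] [t' tE]].
  + by exists 0; rewrite linear0 bc_lift0.
  + exists (single n r); rewrite bc_liftE //.
    exact: fcomb_single.
  + by exists (s' + t'); rewrite linearD sE tE bc_liftD.
- move=> f; split; last first.
    case=> z <-; elim/free_ind: z => [|j r|z z' IH IH'].
    + by rewrite !linear0.
    + have -> : free_hom nu_res x (single j r) = r *: nu j x by exact: fcomb_single.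
      by rewrite linearZ /= vE (submP j) mres0 scaler0.
    + by rewrite !linearD IH IH' addr0.
  move=> f0; have [t tE] := fS f.
  have t0 : bc_map (res (ple x)) ev t = 0 by apply: mI; rewrite cv tE.
  have [|n|s sE] := @mapl_right_exact _ _ _ _ _ (@subm_inc _ _ _ kc) ev _ _ t t0.
  + by move=> m; exists (single m 1); rewrite [LHS]fcomb_single scale1r.
  + by move=> n0; exists (mksubm kc n0).
  rewrite -tE -sE; elim/bc_tens_ind: s {sE} => [|j r|s s' [a aE] [b bE]].
  + exists 0; rewrite linear0 -/(bc_map _ _ _) bc_map0 bc_lift0 //.
  + exists (single j r); rewrite -/(bc_map _ _ _) bc_mapE bc_liftE //.
    exact: fcomb_single.
  + exists (a + b); rewrite linearD aE bE -bc_liftD //.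
    by rewrite -/(bc_map (res (ple x)) (@subm_inc _ _ _ kc) (s + s')) bc_mapD.
Qed.
End QuasiCoherent.

(** * Direct images from open subsets *)

Section ScalarSection.
Variables (k : comPzRingType) (X : rspace k) (V : {set X}) (p : X).
Hypothesis Vp : forall x, x \in V -> le p x.
Lemma asec_res (a : stalk p) (x y : X) (h : le x y) (hx : x \in V) (hy : y \in V) :
  mres (struct_module X) h (res (Vp hx) a) = res (Vp hy) a.
Proof. exact: res_comp. Qed.
Definition asec (a : stalk p) : osec V :=
  Sections (M := struct_module X) (U := V) (sec := fun x hx => res (Vp hx) a) (asec_res a).
Lemma asec_zmod : zmod_morphism asec.
Proof. by move=> a b; apply: sections_ext => x hx; rewrite /= rmorphB. Qed.
HB.instance Definition _ := GRing.isZmodMorphism.Build _ _ asec asec_zmod.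
Lemma asec_monoid : monoid_morphism asec.
Proof.
split=> [|a b]; apply: sections_ext => x hx; first exact: rmorph1.
exact: rmorphM.
Qed.
HB.instance Definition _ := GRing.isMonoidMorphism.Build _ _ asec asec_monoid.
End ScalarSection.

Section Extension.
Variables (k : comPzRingType) (X : rspace k) (W : {set X}).
Hypothesis Wop : is_open W.

Definition jW (x : X) : {set X} := W :&: min_open x.
Lemma jW_le x y : y \in jW x -> le x y. Proof. by rewrite !inE => /andP[]. Qed.
Lemma jW_W x y : y \in jW x -> y \in W. Proof. by rewrite inE => /andP[]. Qed.
Lemma jW_in x y : y \in W -> le x y -> y \in jW x. Proof. by rewrite !inE => -> ->. Qed.
Lemma jW_open x : is_open (jW x).
Proof.
move=> y z yz hy; apply: jW_in; first exact: Wop yz (jW_W hy).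
exact: le_trans (jW_le hy) yz.
Qed.
Lemma jW_sub x y z : le x y -> z \in jW y -> z \in jW x.
Proof. by move=> xy hz; apply: jW_in (jW_W hz) (le_trans xy (jW_le hz)). Qed.

Section Obj.
Variable M : omodule X.
Definition jst x : lmodType (stalk x) := restr (asec (@jW_le x)) (sections M (jW x)).
Lemma jres_subproof (x y : X) (h : le x y) (s : jst x) (p q : X) (pq : le p q)
    (hp : p \in jW y) (hq : q \in jW y) :
  mres M pq (sec s (jW_sub h hp)) = sec s (jW_sub h hq).
Proof. exact: sec_res. Qed.
Definition jres (x y : X) (h : le x y) (s : jst x) : jst y :=
  Sections (sec := fun p hp => sec s (jW_sub h hp)) (jres_subproof h s).
Lemma jres_lin (x y : X) (h : le x y) : semilinear (res h) (jres h).
Proof.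
move=> a s t; apply: sections_ext => p hp /=.
by congr (_ *: _ + _); rewrite /osec_val /= (res_comp h _ (jW_le (jW_sub h hp))).
Qed.
Lemma jres_id (x : X) (h : le x x) s : jres h s = s.
Proof. by apply: sections_ext => p hp; exact: (sec_irr (s : sections M (jW x))). Qed.
Lemma jres_comp (x y z : X) (h : le x y) (h' : le y z) (h'' : le x z) s :
  jres h' (jres h s) = jres h'' s.
Proof. by apply: sections_ext => p hp; exact: (sec_irr (s : sections M (jW x))). Qed.

(* The direct image in [X] of the restriction of [M] to [W]. *)
Definition jext : omodule X := {|
  mst := jst; mres := jres; mres_lin := jres_lin; mres_id := jres_id; mres_comp := jres_comp
|}.

Lemma jsecZ x (a : stalk x) (s : jext x) y (hy : y \in jW x) :
  sec (a *: s) hy = res (jW_le hy) a *: sec s hy.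
Proof. by []. Qed.
Lemma jsecD x (s t : jext x) y (hy : y \in jW x) : sec (s + t) hy = sec s hy + sec t hy.
Proof. by []. Qed.

Lemma junit_res_subproof x (m : M x) (p q : X) (h : le p q) (hp : p \in jW x) (hq : q \in jW x) :
  mres M h (mres M (jW_le hp) m) = mres M (jW_le hq) m.
Proof. exact: mres_comp. Qed.
Definition junit_fun x (m : M x) : jext x :=
  Sections (sec := fun p (hp : p \in jW x) => mres M (jW_le hp) m) (junit_res_subproof m).
Lemma junit_lin x : linear (@junit_fun x).
Proof. by move=> a m n; apply: sections_ext => p hp; exact: mres_lin. Qed.
HB.instance Definition _ x := GRing.isLinear.Build (stalk x) (M x) (jext x) _
  (@junit_fun x) (@junit_lin x).
Lemma junit_res (x y : X) (h : le x y) m :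
  mres jext h (junit_fun m) = junit_fun (mres M h m).
Proof.
apply: sections_ext => p hp /=.
by rewrite (mres_comp h _ (jW_le (jW_sub h hp))).
Qed.
Definition junit : omhom M jext :=
  OMHom (hfun := fun x => @junit_fun x : {linear M x -> jext x}) junit_res.

Lemma junit_inj x : x \in W -> injective (junit x).
Proof.
move=> xW m n /(congr1 (fun s : sections M (jW x) => sec s (jW_in xW (le_refl x)))) /=.
by rewrite !mres_id.
Qed.
Lemma junit_surj x : x \in W -> forall s, exists m, junit x m = s.
Proof.
move=> xW s; exists (sec s (jW_in xW (le_refl x))); apply: sections_ext => p hp.
exact: sec_res.
Qed.

Lemma rel_inj_jext : rel_inj M -> rel_inj jext.
Proof.
case=> r rK.
pose diag_ x (m : god jext x) z (hz : z \in jW x) : god M z := fun y h =>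
  sec (m y (cof_up (jW_le hz) h)) (jW_in (Wop (cof_le h) (jW_W hz)) (le_refl y)).
have dres x (m : god jext x) (p q : X) (h : le p q) (hp : p \in jW x) (hq : q \in jW x) :
    mres M h (r p (diag_ x m p hp)) = r q (diag_ x m q hq).
  rewrite hfun_res; congr (r q _); apply: cofam_ext => y hy; rewrite /= /cofam_res /diag_.
  rewrite (god_irr m _ (cof_up (jW_le hq) hy)); exact: sec_irr.
pose r' x (m : god jext x) : jext x := Sections (dres x m).
have r'l x : linear (r' x).
  move=> a m n; apply: sections_ext => z hz.
  rewrite -[RHS]/(res (jW_le hz) a *: r z (diag_ x m z hz) + r z (diag_ x n z hz)).
  rewrite -linearP; congr (r z _); apply: cofam_ext => y hy.
  rewrite cofam_linE /diag_ cofam_linE jsecD jsecZ; congr (_ *: _ + _).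
  by rewrite res_id !(res_comp _ _ (cof_le (cof_up (jW_le hz) hy))).
have r'r (x y : X) (h : le x y) (m : god jext x) :
    mres jext h (linpack (r'l x) m) = linpack (r'l y) (mres (god jext) h m).
  apply: sections_ext => z hz; congr (r z _); apply: cofam_ext => w hw.
  rewrite /diag_ /= /cofam_res.
  by rewrite (god_irr m _ (cof_up h (cof_up (jW_le hz) hw))); exact: sec_irr.
exists (OMHom r'r) => x s; apply: sections_ext => z hz.
rewrite -[RHS]rK; congr (r z _); apply: cofam_ext => y hy.
rewrite /diag_ /= /unit_fun /= /jres /=.
rewrite (sec_res s (cof_le hy) hz (jW_sub (cof_le (cof_up (jW_le hz) hy)) (jW_in (Wop (cof_le hy) (jW_W hz)) (le_refl y)))).
by [].
Qed.
End Obj.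
End Extension.

Section IsoOn.
Variables (k : comPzRingType) (X : rspace k) (V : {set X}).
Hypothesis Vop : is_open V.
Implicit Types A B : omodule X.

Definition iso_on A B (u : omhom A B) : Prop :=
  forall x, x \in V -> injective (u x) /\ forall b, exists a, u x a = b.

Let zmod_ B : omodule X := kern (om_id B).
Let zmod0 B (x : X) (m : zmod_ B x) : m = 0.
Proof. by apply/val_inj; exact: (submP m). Qed.

Let iso_ses A B (u : omhom A B) : iso_on u <-> ses V u (om0 B (zmod_ B)).
Proof.
split=> [h|h x hx].
  split=> x hx; have [i s] := h x hx => //.
  by move=> c; exists 0; rewrite [c]zmod0.
split; first exact: (ses_mono h).
by move=> b; exact: (ses_ker h hx).
Qed.

Lemma iso_on_gquon n A B (u : omhom A B) : iso_on u -> iso_on (gquon_map n u).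
Proof.
move/iso_ses => /(gquon_ses Vop n) h x hx; split; first exact: (ses_mono h).
move=> b; apply: (ses_ker h hx); apply: (gquon_zero Vop) => // y hy m; exact: zmod0.
Qed.

Lemma iso_on_god A B (u : omhom A B) : iso_on u -> iso_on (god_map u).
Proof.
move/iso_ses => /(god_ses Vop) h x hx; split; first exact: (ses_mono h).
by move=> b; apply: (ses_ker h hx); apply: cofam_ext => y hy.
Qed.

Lemma iso_on_sections A B (u : omhom A B) : iso_on u ->
  injective (sec_map u (U := V)) /\ forall t : sections B V, exists s, sec_map u s = t.
Proof.
move=> h; split.
  by move=> s t e; apply: (sec_inj _ e) => x /h [].
by move=> t; apply: sec_lift => x hx; have [i s] := h x hx.
Qed.
End IsoOn.

Section CohBijection.
Variables (C D : nat -> zmodType) (d : forall n, C n -> C n.+1) (e : forall n, D n -> D n.+1).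
Variable f : forall n, C n -> D n.
Arguments f n _ : clear implicits.
Arguments d n _ : clear implicits.
Arguments e n _ : clear implicits.
Hypothesis fD : forall n x y, f n (x + y) = f n x + f n y.
Hypothesis fd : forall n x, f n.+1 (d n x) = e n (f n x).
Hypothesis finj : forall n, injective (f n).
Hypothesis fsurj : forall n y, exists x, f n x = y.
Variables (i : nat) (H : zmodType) (cls : C i -> H).

Lemma is_coh_bij : is_coh d cls -> exists cls' : D i -> H,
  is_coh e cls' /\ forall z, cls' (f i z) = cls z.
Proof.
move=> [cD cS cK]; pose g n y := projT1 (cid (@fsurj n y)).
have gK n y : f n (g n y) = y := projT2 (cid (@fsurj n y)).
have fK n x : g n (f n x) = x by apply: finj; rewrite gK.
have f0 n : f n 0 = 0 by apply: (addrI (f n 0)); rewrite -fD !addr0.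
have gz y : e i y = 0 -> d i (g i y) = 0.
  by move=> ey; apply: finj; rewrite fd gK ey f0.
exists (fun y => cls (g i y)); split; last by move=> z; rewrite fK.
split.
- move=> y y' hy hy'; have -> : g i (y + y') = g i y + g i y'.
    by apply: finj; rewrite fD !gK.
  by apply: cD; exact: gz.
- by move=> h; have [z z0 <-] := cS h; exists (f i z); rewrite ?fK // -fd z0 f0.
- move=> y hy; rewrite cK; last exact: gz.
  case: (i) y hy g gK fK {gz} => [|j] y hy g gK fK /=.
    split=> [e0|->]; first by rewrite -[y]gK e0 f0.
    by apply: finj; rewrite gK f0.
  split=> [[x xE]|[x xE]]; first by exists (f j x); rewrite -fd xE gK.
  by exists (g j x); apply: finj; rewrite fd !gK.
Qed.
End CohBijection.

Section QuasiIsoExact.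
Variables (C D : nat -> zmodType) (d : forall n, C n -> C n.+1) (e : forall n, D n -> D n.+1).
Variable f : forall n, C n -> D n.
Arguments f n _ : clear implicits.
Arguments d n _ : clear implicits.
Arguments e n _ : clear implicits.
Hypothesis fD : forall n x y, f n (x + y) = f n x + f n y.
Hypothesis eD : forall n x y, e n (x + y) = e n x + e n y.
Hypothesis fd : forall n x, f n.+1 (d n x) = e n (f n x).

Let f0 n : f n 0 = 0. Proof. by apply: (addrI (f n 0)); rewrite -fD !addr0. Qed.

Lemma exact_pos_quasi_iso : quasi_iso d e f -> (exact_pos d <-> exact_pos e).
Proof.
move=> q; split=> ex i z z0; have [qi qs] := q i.+1.
- have [w w0 [y yE]] := qs z z0; have [v vE] := ex i w w0.
  exists (y + f i v); rewrite eD yE -fd vE; exact: subrK.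
- apply: qi => //; apply: ex; by rewrite -fd z0 f0.
Qed.

Lemma bij_quasi_iso : (forall n, injective (f n)) -> (forall n y, exists x, f n x = y) ->
  quasi_iso d e f.
Proof.
move=> fi fs i; split.
- move=> z z0; case: i z z0 => [|i] z z0 /=; first by move=> e0; apply: fi; rewrite e0 f0.
  by case=> y; have [x <-] := fs i y; rewrite -fd => /fi <-; exists x.
- move=> w w0; have [z zE] := fs i w; exists z; first by apply: fi; rewrite fd zE w0 f0.
  rewrite zE subrr; case: (i) => //= j; exists 0.
  by apply: (addrI (e j 0)); rewrite -eD !addr0.
Qed.
End QuasiIsoExact.

Section SectionComplexes.
Variables (k : comPzRingType) (X : rspace k) (V : {set X}) (A B : nat -> omodule X).
Variables (dA : forall n, omhom (A n) (A n.+1)) (dB : forall n, omhom (B n) (B n.+1)).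
Variable f : forall n, omhom (A n) (B n).
Hypothesis fd : forall n x m, f n.+1 x (dA n x m) = dB n x (f n x m).

Definition scpx (C : nat -> omodule X) (U : {set X}) : nat -> zmodType :=
  fun n => sections (C n) U.
Definition sdif (C : nat -> omodule X) (d : forall n, omhom (C n) (C n.+1)) (U : {set X}) :
  forall n, scpx C U n -> scpx C U n.+1 := fun n s => sec_map (d n) s.
Definition smap (C D : nat -> omodule X) (g : forall n, omhom (C n) (D n)) (U : {set X}) :
  forall n, scpx C U n -> scpx D U n := fun n s => sec_map (g n) s.

Lemma smapD n (x y : scpx A V n) : smap f (x + y) = smap f x + smap f y.
Proof. by apply: sections_ext => p hp; exact: (linearD (f n p)). Qed.
Lemma sdifD n (x y : scpx B V n) : sdif dB (x + y) = sdif dB x + sdif dB y.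
Proof. by apply: sections_ext => p hp; exact: (linearD (dB n p)). Qed.
Lemma sdif0 n : sdif dB (0 : scpx B V n) = 0.
Proof. by apply: sections_ext => p hp; exact: (linear0 (dB n p)). Qed.
Lemma smap_d n (x : scpx A V n) : smap f (sdif dA x) = sdif dB (smap f x).
Proof. by apply: sections_ext => p hp; exact: fd. Qed.

Lemma sections_exact_pos : quasi_iso (sdif dA (U := V)) (sdif dB (U := V)) (smap f (U := V)) ->
  (exact_pos (sdif dA (U := V)) <-> exact_pos (sdif dB (U := V))).
Proof. by apply: exact_pos_quasi_iso; [exact: smapD|exact: sdifD|exact: smap_d]. Qed.

Lemma iso_on_quasi_iso : (forall n, iso_on V (f n)) ->
  quasi_iso (sdif dA (U := V)) (sdif dB (U := V)) (smap f (U := V)).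
Proof.
move=> h; apply: bij_quasi_iso; [exact: smapD|exact: sdifD|exact: smap_d| |] => n.
  by have [] := iso_on_sections (h n).
by have [] := iso_on_sections (h n).
Qed.

Lemma sections_is_coh i (H : zmodType) (cls : scpx B V i -> H) :
  quasi_iso (sdif dA (U := V)) (sdif dB (U := V)) (smap f (U := V)) ->
  is_coh (sdif dB (U := V)) cls -> is_coh (sdif dA (U := V)) (fun z => cls (smap f z)).
Proof.
by apply: is_coh_quasi_iso; [exact: smapD|exact: smap_d|exact: sdif0|exact: sdifD].
Qed.

Lemma sections_is_coh_iso i (H : zmodType) (cls : scpx A V i -> H) :
  (forall n, iso_on V (f n)) -> is_coh (sdif dA (U := V)) cls ->
  exists cls' : scpx B V i -> H,
    is_coh (sdif dB (U := V)) cls' /\ forall z, cls' (smap f z) = cls z.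
Proof.
move=> h; apply: is_coh_bij; [exact: smapD|exact: smap_d| |] => n.
  by have [] := iso_on_sections (h n).
by have [] := iso_on_sections (h n).
Qed.
End SectionComplexes.

Section ExtensionSections.
Variables (k : comPzRingType) (X : rspace k) (W : {set X}).
Hypothesis Wop : is_open W.

Section Map.
Variables (M N : omodule X) (u : omhom M N).
Definition jmap_fun x (s : jext W M x) : jext W N x := sec_map u (s : sections M (jW W x)).
Lemma jmap_lin x : linear (@jmap_fun x).
Proof.
by move=> a s t; apply: sections_ext => p hp; exact: linearP.
Qed.
HB.instance Definition _ x := GRing.isLinear.Build (stalk x) (jext W M x) (jext W N x) _
  (@jmap_fun x) (@jmap_lin x).
Lemma jmap_res (x y : X) (h : le x y) s :
  mres (jext W N) h (jmap_fun s) = jmap_fun (mres (jext W M) h s).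
Proof. exact: sections_ext. Qed.
Definition jmap : omhom (jext W M) (jext W N) :=
  OMHom (hfun := fun x => @jmap_fun x : {linear jext W M x -> jext W N x}) jmap_res.

Lemma junit_nat x m : jmap x (junit W M x m) = junit W N x (u x m).
Proof. by apply: sections_ext => p hp; rewrite /= hfun_res. Qed.
End Map.

Variables (V : {set X}) (Vop : is_open V) (M : omodule X).

Lemma jsec_in x y : x \in V -> y \in jW W x -> y \in V :&: W.
Proof. by move=> hx hy; rewrite inE (Vop (jW_le hy) hx) (jW_W hy). Qed.

Lemma jsec_res1 (s : sections M (V :&: W)) x (hx : x \in V) (p q : X) (h : le p q)
    (hp : p \in jW W x) (hq : q \in jW W x) :
  mres M h (s p (jsec_in hx hp)) = s q (jsec_in hx hq).
Proof. exact: sec_res. Qed.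
Definition jsec_fun (s : sections M (V :&: W)) x (hx : x \in V) : jext W M x :=
  Sections (jsec_res1 s hx).
Lemma jsec_res2 s (x y : X) (h : le x y) (hx : x \in V) (hy : y \in V) :
  mres (jext W M) h (jsec_fun s hx) = jsec_fun s hy.
Proof. by apply: sections_ext => p hp; exact: (sec_irr s). Qed.
Definition jsec (s : sections M (V :&: W)) : sections (jext W M) V := Sections (jsec_res2 s).

Lemma jsecE s x (hx : x \in V) y (hy : y \in jW W x) (hy' : y \in V :&: W) :
  sec (jsec s x hx) hy = s y hy'.
Proof. exact: (sec_irr s). Qed.

Lemma jsec_D s t : jsec (s + t) = jsec s + jsec t.
Proof. by apply: sections_ext => x hx; apply: sections_ext. Qed.

Lemma jsec_inj : injective jsec.
Proof.
move=> s t e; apply: sections_ext => x hx.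
have [xV xW] : x \in V /\ x \in W by move: hx; rewrite inE => /andP.
have := congr1 (fun s : sections (jext W M) V => sec (s x xV) (jW_in xW (le_refl x))) e.
by rewrite !(jsecE _ _ _ hx).
Qed.

Lemma inV x : x \in V :&: W -> x \in V. Proof. by rewrite inE => /andP[]. Qed.
Lemma inW x : x \in V :&: W -> x \in W. Proof. by rewrite inE => /andP[]. Qed.

Lemma jsec_surj t : exists s, jsec s = t.
Proof.
pose s y (hy : y \in V :&: W) : M y := sec (t y (inV hy)) (jW_in (inW hy) (le_refl y)).
have sE x (hx : x \in V) y (hy : y \in jW W x) (hy' : y \in V :&: W) :
    s y hy' = sec (t x hx) hy.
  by rewrite /s -(sec_res t (jW_le hy) hx (inV hy')) /=; exact: (sec_irr (t x hx : sections M _)).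
have sres (p q : X) (h : le p q) (hp : p \in V :&: W) (hq : q \in V :&: W) :
    mres M h (s p hp) = s q hq.
  rewrite (sE p (inV hp) q (jW_in (inW hq) h)) /s.
  exact: (sec_res (t p (inV hp) : sections M _)).
exists (Sections sres); apply: sections_ext => x hx; apply: sections_ext => y hy.
rewrite (jsecE _ _ _ (jsec_in hx hy)); exact: sE.
Qed.
End ExtensionSections.

Section ExtensionQuasiIso.
Variables (k : comPzRingType) (X : rspace k) (W : {set X}) (Wop : is_open W).
Variables (M : omodule X).
Let jM := jext W M.
Let F := gres jM.
Variables (V : {set X}) (Vop : is_open V).
Hypothesis Vex : forall x, x \in V ->
  exact_pos (sdif (rs_d F) (U := jW W x)).

Lemma jext_quasi_iso :
  quasi_iso (sdif (rs_d F) (U := V)) (sdif (fun n => jmap W (rs_d F n)) (U := V))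
    (smap (fun n => junit W (rs_obj F n)) (U := V)).
Proof.
apply: quasi_iso_sections => //.
- exact: rs_dd.
- by move=> n x s; apply: sections_ext => y hy; exact: rs_dd.
- by move=> n x m; rewrite junit_nat.
- by move=> n; apply: rel_inj_acyc => //; exact: gres_rel_inj.
- by move=> n; apply: rel_inj_acyc => //; apply: rel_inj_jext => //; exact: gres_rel_inj.
move=> x hx [|i]; split=> /=.
- move=> z /(rs_exact0 (r := F)) [m <-] e.
  suff -> : m = 0 by rewrite linear0.
  apply: sections_ext => y hy.
  have e1 : mres (god jM) (jW_le hy) (unit jM x m) = 0.
    exact: (congr1 (fun s : sections (god jM) (jW W x) => sec s hy) e).
  have e2 : mres jM (jW_le hy) m = 0.
    by apply: (@unit_inj _ _ jM); rewrite linear0 -e1 -(hfun_res (unit jM)).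
  have yy : y \in jW W y := jW_in (jW_W hy) (le_refl y).
  have := congr1 (fun s : sections M (jW W y) => sec s yy) e2.
  rewrite /= => <-; exact: (sec_irr (m : sections M _)).
- move=> w w0.
  have [n nE] : exists n : sections jM (jW W x), sec_map (unit jM) n = w.
    apply: sec_lift => y hy; first exact: unit_inj.
    apply/(rs_exact0 (r := F)).
    exact: (congr1 (fun s : sections _ (jW W x) => sec s hy) w0).
  pose yy y (hy : y \in jW W x) : y \in jW W y := jW_in (jW_W hy) (le_refl y).
  pose m y (hy : y \in jW W x) : M y := sec (n y hy) (yy y hy).
  have mE y (hy : y \in jW W x) z (hz : z \in jW W y) (hxz : z \in jW W x) :
      m z hxz = sec (n y hy) hz.
    rewrite /m -(sec_res n (jW_le hz) hy hxz) /=.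
    exact: (sec_irr (n y hy : sections M _)).
  have mres_ (p q : X) (h : le p q) (hp : p \in jW W x) (hq : q \in jW W x) :
      mres M h (m p hp) = m q hq.
    rewrite (mE p hp q (jW_in (jW_W hq) h)) /m.
    exact: (sec_res (n p hp : sections M _)).
  pose m' : jM x := Sections mres_.
  exists (rs_aug F x m'); first by apply/(rs_exact0 (r := F)); exists m'.
  apply/eqP; rewrite subr_eq0; apply/eqP; apply: sections_ext => y hy.
  rewrite -nE -[RHS]/(mres (god jM) (jW_le hy) (unit jM x m')) (hfun_res (unit jM)).
  congr (unit jM y _); apply: sections_ext => z hz.
  by rewrite -(mE y hy z hz (jW_sub (jW_le hy) hz)).
- by move=> z /(rs_exact (r := F)).
- move=> w w0; exists 0; first exact: (linear0 (rs_d F i.+1 x)).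
  have [y yE] := Vex hx w0; exists y.
  rewrite [X in w - X](linear0 (junit W (rs_obj F i.+1) x)) subr0; exact: yE.
Qed.
End ExtensionQuasiIso.

Section CastIf.
Variables (k : comPzRingType) (X : rspace k).
Implicit Types M N : omodule X.

Definition castif M (y z : X) (m : M y) : M z :=
  match y =P z with ReflectT e => eq_rect y (fun y => M y) m z e | ReflectF _ => 0 end.

Lemma castif_id M (y : X) (m : M y) : castif y m = m.
Proof. by rewrite /castif; case: eqP => // e; rewrite (eq_axiomK e). Qed.
Lemma castif_ne M (y z : X) (m : M y) : y <> z -> castif z m = 0.
Proof. by rewrite /castif; case: eqP. Qed.
Lemma castif_map M N (u : omhom M N) (y z : X) (m : M y) : u z (castif z m) = castif z (u y m).
Proof. by rewrite /castif; case: eqP => [e|_]; [case: z / e|rewrite linear0]. Qed.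
Lemma castif_lin M (p : X) (a : stalk p) (y z : X) (hy : le p y) (hz : le p z) (m n : M y) :
  castif z (res hy a *: m + n) = res hz a *: castif z m + castif z n.
Proof.
rewrite /castif; case: eqP => [e|_]; last by rewrite scaler0 addr0.
by case: z / e hz => hz; rewrite (bool_irrelevance hy hz).
Qed.
Lemma castifD M (y z : X) (m n : M y) : castif z (m + n) = castif z m + castif z n.
Proof. by rewrite /castif; case: eqP => [e|_]; [case: z / e|rewrite addr0]. Qed.
End CastIf.

Section ScalarMaps.
Variables (k : comPzRingType) (X : rspace k) (V : {set X}) (Vop : is_open V).
Variables (M N : omodule X).

Lemma gquon_map_scal (al : forall x : X, x \in V -> stalk x) (w u : omhom M N) :
  (forall x y (h : le x y) hx hy, res h (al x hx) = al y hy) ->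
  (forall x hx m, w x m = al x hx *: u x m) ->
  forall n x hx m, gquon_map n w x m = al x hx *: gquon_map n u x m.
Proof.
move=> alr wu; elim=> [|n IH] //= x hx m; apply: gquo_ext => y h.
rewrite /= /god_map_fun (IH y (Vop (cof_le h) hx)).
by rewrite -(alr x y (cof_le h) hx).
Qed.

Lemma gquon_map_add (w u v : omhom M N) :
  (forall x, x \in V -> forall m, w x m = u x m + v x m) ->
  forall n x, x \in V -> forall m, gquon_map n w x m = gquon_map n u x m + gquon_map n v x m.
Proof.
move=> e; elim=> [|n IH] //= x hx m; apply: gquo_ext => y h.
by rewrite /= /god_map_fun IH //; exact: Vop (cof_le h) hx.
Qed.
End ScalarMaps.

Section Restriction.
Variables (k : comPzRingType) (X : rspace k) (M : omodule X) (V V' : {set X}).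
Hypothesis sub : {subset V' <= V}.
Lemma srestr_res (s : sections M V) (p q : X) (h : le p q) (hp : p \in V') (hq : q \in V') :
  mres M h (s p (sub hp)) = s q (sub hq).
Proof. exact: sec_res. Qed.
Definition srestr (s : sections M V) : sections M V' := Sections (srestr_res s).
End Restriction.

Section GodementMap.
Variables (k : comPzRingType) (X : rspace k) (M N : omodule X) (u : omhom M N).
Definition gres_map n : omhom (rs_obj (gres M) n) (rs_obj (gres N) n) := god_map (gquon_map n u).
Lemma gres_map_d n x m : gres_map n.+1 x (rs_d (gres M) n x m) = rs_d (gres N) n x (gres_map n x m).
Proof.
rewrite -[LHS]/(god_map (gquon_map n.+1 u) x (unit (gquon n.+1 M) x (gproj (gquon n M) x m))).
rewrite -unit_nat; congr (unit (gquon n.+1 N) x _); exact: gquo_map_gproj.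
Qed.
End GodementMap.

Section OpenBaseChange.
Variables (k : comPzRingType) (X : rspace k).
Hypothesis Xfin : finite_space X.
Variables (p p' : X) (pp : le p p').
Let W := min_open p'.
Let Wop : is_open W := @min_open_open k X p'.
Variables (V : {set X}) (Vop : is_open V).
Hypothesis Vp : forall x, x \in V -> le p x.
Let O := struct_module X.
Let jO := jext W O.

Lemma jW_p' x y : y \in jW W x -> le p' y. Proof. by move/jW_W; rewrite inE. Qed.

Lemma jtimes_res x (r : stalk p') (m : O x) (y z : X) (h : le y z)
    (hy : y \in jW W x) (hz : z \in jW W x) :
  mres O h (res (jW_p' hy) r * res (jW_le hy) m) = res (jW_p' hz) r * res (jW_le hz) m.
Proof.
by rewrite /= rmorphM (res_comp _ _ (jW_p' hz)) (res_comp _ _ (jW_le hz)).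
Qed.
Definition jtimes_fun (r : stalk p') x (m : O x) : jO x :=
  Sections (M := O) (U := jW W x) (@jtimes_res x r m).
Lemma jtimes_lin r x : linear (@jtimes_fun r x).
Proof.
move=> a m n; apply: sections_ext => y hy.
rewrite -[RHS]/(res (jW_le hy) a * (res (jW_p' hy) r * res (jW_le hy) m) +
  res (jW_p' hy) r * res (jW_le hy) n) /=.
by rewrite [res _ (_ + _)]rmorphD [res _ (a * m)]rmorphM mulrDr mulrCA.
Qed.
HB.instance Definition _ r x := GRing.isLinear.Build (stalk x) (O x) (jO x) _
  (@jtimes_fun r x) (@jtimes_lin r x).
Lemma jtimes_nat r (x y : X) (h : le x y) m : mres jO h (jtimes_fun r m) = jtimes_fun r (mres O h m).
Proof.
apply: sections_ext => z hz /=; rewrite (res_comp _ _ (jW_le (jW_sub h hz))).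
by congr (res _ _ * _); exact: bool_irrelevance.
Qed.
Definition jtimes (r : stalk p') : omhom O jO :=
  OMHom (hfun := fun x => @jtimes_fun r x : {linear O x -> jO x}) (jtimes_nat r).

Hypothesis h0 : forall x (hx : x \in V),
  base_change (res pp) (N := restr (res (Vp hx)) (stalk x)^o) (fun (m : O x) r => jtimes r x m).

Let bq n x (m : gquon n O x) (r : stalk p') : gquon n jO x := gquon_map n (jtimes r) x m.

Let bqD n x (hx : x \in V) (m : gquon n O x) r s : bq m (r + s) = bq m r + bq m s.
Proof.
apply: (gquon_map_add Vop) hx m => y hy m; apply: sections_ext => z hz.
by rewrite jsecD /= rmorphD mulrDl.
Qed.

Let bqZ n x (hx : x \in V) (m : gquon n O x) a r :
  bq (res (Vp hx) a *: m) r = bq m (res pp a * r).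
Proof.
rewrite /bq linearZ /=.
rewrite (@gquon_map_scal _ _ _ Vop _ _ (fun x hx => res (Vp hx) a) (jtimes (res pp a * r)) (jtimes r))
  //.
- by move=> y z h hy hz; exact: res_comp.
- move=> y hy w; apply: sections_ext => z hz.
  rewrite jsecZ /= rmorphM -mulrA; congr (_ * _).
  by rewrite !(res_comp _ _ (le_trans (Vp hy) (jW_le hz))).
Qed.

Lemma gquon_base_change n x (hx : x \in V) :
  base_change (res pp) (N := restr (res (Vp hx)) (gquon n O x)) (@bq n x).
Proof.
elim: n x hx => [|n IH] x hx; first exact: h0.
pose Y := {y : X | (le x y && isrep y) && (y != rep x)}.
have Yle (y : Y) : le x (val y) && isrep (val y) by case/andP: (valP y).
have Yne (y : Y) : val y <> rep x by case/andP: (valP y) => _ /eqP.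
have YV (y : Y) : val y \in V := Vop (cof_le (Yle y)) hx.
pose Ny (y : Y) : lmodType (stalk p) := restr (res (Vp (YV y))) (gquon n O (val y)).
pose N : lmodType (stalk p) := restr (res (Vp hx)) (gquon n.+1 O x).
have pil (y : Y) : linear (fun q : N => gquo_val (q : gquo (gquon n O) x) (val y) (Yle y) : Ny y).
  move=> a q q'; rewrite -[LHS]/(res (cof_le (Yle y)) (res (Vp hx) a) *: gquo_val q (val y) (Yle y) +
    gquo_val q' (val y) (Yle y)).
  by rewrite (res_comp _ _ (Vp (YV y))).
have oneP (M : omodule X) (y : Y) (m : M (val y)) :
    (fun z _ => castif z m : M z) \in @gquo_pred k X M x.
  by apply/eqP/castif_ne/Yne.
pose one (M : omodule X) (y : Y) (m : M (val y)) : gquo M x := GQuo (oneP M y m).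
have iol (y : Y) : linear (fun m : Ny y => one (gquon n O) y m : N).
  move=> a m m'; apply: gquo_ext => z hz.
  rewrite -[RHS]/(res (cof_le hz) (res (Vp hx) a) *: castif z (m : gquon n O (val y)) +
    castif z (m' : gquon n O (val y))).
  rewrite (res_comp _ _ (Vp (Vop (cof_le hz) hx))).
  exact: castif_lin.
have sum_one (M : omodule X) (q : gquo M x) :
    \sum_(y : Y) one M y (gquo_val q (val y) (Yle y)) = q.
  apply: gquo_ext => z hz.
  rewrite (big_morph (fun q : gquo_st M x => gquo_val q z hz) (id1 := 0) (op1 := +%R)) //.
  case: (eqVneq z (rep x)) => [ze|ze].
    rewrite big1; first by move: hz; rewrite ze => hz; rewrite gquo_rep.
    by move=> y _; apply: castif_ne; rewrite ze; exact: Yne.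
  have zP : (le x z && isrep z) && (z != rep x) by rewrite hz ze.
  rewrite (bigD1 (exist _ z zP : Y)) //= big1 ?addr0.
    by rewrite castif_id; exact: god_irr.
  move=> y yz; apply: castif_ne => e; case/eqP: yz; exact: val_inj.
apply: (@base_change_prod _ _ (res pp) N (gquon n.+1 jO x) _ Y Ny
  (fun y => gquon n jO (val y)) (fun y => @bq n (val y))
  (fun y => linpack (pil y)) (fun y => linpack (iol y))
  (fun y (q : gquo (gquon n jO) x) => gquo_val q (val y) (Yle y))
  (fun y m => one (gquon n jO) y m)).
- split=> [m m' r|m r r'|a m r].
  + exact: (linearD (gquon_map n.+1 (jtimes r) x)).
  + exact: (bqD (n := n.+1)).
  + exact: (bqZ (n := n.+1)).
- by move=> y; exact: IH.
- by [].
- by move=> y m m'; apply: gquo_ext => z hz; exact: castifD.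
- by [].
- by move=> y m r; apply: gquo_ext => z hz; rewrite /= /god_map_fun castif_map.
- exact: sum_one.
- exact: sum_one.
Qed.

Let K n : lmodType (stalk p) := restr (asec Vp) (sections (god (gquon n O)) V).
Let L n : zmodType := sections (god (gquon n jO)) V.
Let bK n (s : K n) (r : stalk p') : L n :=
  sec_map (god_map (gquon_map n (jtimes r))) (s : sections (god (gquon n O)) V).

Lemma god_base_change n : base_change (res pp) (@bK n).
Proof.
pose Y := {y : X | (y \in V) && isrep y}.
have YV (y : Y) : val y \in V by case/andP: (valP y).
have Yr (y : Y) : isrep (val y) by case/andP: (valP y).
pose Ny (y : Y) : lmodType (stalk p) := restr (res (Vp (YV y))) (gquon n O (val y)).
have pil (y : Y) : linear (fun s : K n =>
    (s : sections (god (gquon n O)) V) (val y) (YV y) (val y) (le_repn (Yr y)) : Ny y).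
  move=> a s s'; rewrite -[LHS]/(res (cof_le (le_repn (Yr y))) (res (Vp (YV y)) a) *:
    (s : sections (god (gquon n O)) V) (val y) (YV y) (val y) (le_repn (Yr y)) +
    (s' : sections (god (gquon n O)) V) (val y) (YV y) (val y) (le_repn (Yr y))).
  by rewrite res_id.
pose one (M : omodule X) (y : Y) (m : M (val y)) : sections (god M) V :=
  gsec Vop (M := M) (fun z _ _ => castif z m).
have iol (y : Y) : linear (fun m : Ny y => one (gquon n O) y m : K n).
  move=> a m m'; apply: sections_ext => x hx; apply: cofam_ext => z hz.
  rewrite -[RHS]/(res (cof_le hz) (res (Vp hx) a) *: castif z (m : gquon n O (val y)) +
    castif z (m' : gquon n O (val y))).
  rewrite (res_comp _ _ (Vp (Vop (cof_le hz) hx))).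
  exact: castif_lin.
have sum_one (M : omodule X) (s : sections (god M) V) :
    \sum_(y : Y) one M y (s (val y) (YV y) (val y) (le_repn (Yr y))) = s.
  apply: sections_ext => x hx; apply: cofam_ext => z hz.
  rewrite (big_morph (fun s : sections (god M) V => s x hx z hz) (id1 := 0) (op1 := +%R)) //.
  have zV := Vop (cof_le hz) hx; have rz := proj2 (andP hz).
  have zP : (z \in V) && isrep z by rewrite zV rz.
  rewrite (bigD1 (exist _ z zP : Y)) //= big1 ?addr0.
    rewrite castif_id (god_sec s hx hz zV rz).
    rewrite (sec_irr s (YV (exist _ z zP)) zV); exact: god_irr.
  move=> y yz; apply: castif_ne => e; case/eqP: yz; exact: val_inj.
apply: (@base_change_prod _ _ (res pp) (K n) (L n) _ Y Ny
  (fun y => gquon n jO (val y)) (fun y => @bq n (val y))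
  (fun y => linpack (pil y)) (fun y => linpack (iol y))
  (fun y (s : sections (god (gquon n jO)) V) => s (val y) (YV y) (val y) (le_repn (Yr y)))
  (fun y m => one (gquon n jO) y m)).
- split=> [m m' r|m r r'|a m r].
  + apply: sections_ext => x hx; apply: cofam_ext => z hz.
    exact: (linearD (gquon_map n (jtimes r) z)).
  + apply: sections_ext => x hx; apply: cofam_ext => z hz.
    exact: (bqD (n := n) (Vop (cof_le hz) hx)).
  + apply: sections_ext => x hx; apply: cofam_ext => z hz.
    rewrite -[LHS]/(bq (res (cof_le hz) (res (Vp hx) a) *: _) r).
    rewrite (res_comp _ _ (Vp (Vop (cof_le hz) hx))); exact: bqZ.
- by move=> y; exact: gquon_base_change.
- by [].
- move=> y m m'; apply: sections_ext => x hx; apply: cofam_ext => z hz; exact: castifD.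
- by [].
- move=> y m r; apply: sections_ext => x hx; apply: cofam_ext => z hz.
  by rewrite /= /god_map_fun castif_map.
- exact: sum_one.
- exact: sum_one.
Qed.

Variable E : injective_resolution O.
Hypothesis h1 : forall x, x \in V -> exact_pos (sdif (ir_d E) (U := jW W x)).

Let VWop : is_open (V :&: W).
Proof.
move=> x y xy; rewrite !finset.in_setI => /andP[h h'].
by rewrite (Vop xy h) (Wop xy h').
Qed.
Lemma inVW x : x \in V :&: W -> le p' x.
Proof. by rewrite finset.in_setI => /andP[_]; rewrite inE. Qed.
Lemma subVW : {subset V :&: W <= V}. Proof. by move=> x; rewrite finset.in_setI => /andP[]. Qed.

Let gres_iso (V' : {set X}) n : is_open V' -> {subset V' <= W} ->
  iso_on V' (gres_map (junit W O) n).
Proof.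
move=> op VW; apply: (iso_on_god op); apply: (iso_on_gquon op) => x hx.
split; first by apply: junit_inj; exact: VW.
by apply: junit_surj; exact: VW.
Qed.

Let jO_exact x : x \in V -> exact_pos (sdif (rs_d (gres jO)) (U := jW W x)).
Proof.
move=> hx; have op := @jW_open _ _ _ Wop x.
have [f [fd fq]] := resolution_compare E (@gres_rel_inj _ _ O).
have e1 := proj2 (sections_exact_pos fd (fq _ op)) (h1 hx).
apply: (proj1 (sections_exact_pos (gres_map_d (junit W O)) _)) e1.
apply: iso_on_quasi_iso; first exact: gres_map_d.
by move=> n; apply: gres_iso => // y; exact: jW_W.
Qed.

Variables (i : nat) (H : lmodType (stalk p)) (cls : sections (ir_obj E i) V -> H).
Hypothesis cls_coh : is_coh (sdif (ir_d E) (U := V)) cls.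
Hypothesis clsZ : forall a z, sec_map (ir_d E i) z = 0 -> cls (asec Vp a *: z) = a *: cls z.
Variables (H' : zmodType) (cls' : sections (ir_obj E i) (V :&: W) -> H').
Hypothesis cls'_coh : is_coh (sdif (ir_d E) (U := V :&: W)) cls'.
Variable c : H -> stalk p' -> H'.
Hypothesis c_bal : bc_balanced (res pp) c.
Hypothesis cE : forall z r, sec_map (ir_d E i) z = 0 ->
  c (cls z) r = cls' (asec inVW r *: srestr subVW z).

Let kd n : linear (fun s : K n => (sec_map (rs_d (gres O) n) (s : sections _ V) : K n.+1)).
Proof.
move=> a s t; apply: sections_ext => x hx.
exact: (linearP (rs_d (gres O) n x)).
Qed.

Lemma open_base_change : base_change (res pp) c.
Proof.
have [f [fd fq]] := resolution_compare E (@gres_rel_inj _ _ O).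
have cohK := sections_is_coh fd (fq _ Vop) cls_coh.
have cohW := sections_is_coh fd (fq _ VWop) cls'_coh.
have [clsJ [cohJ clsJE]] := sections_is_coh_iso (gres_map_d (junit W O))
  (fun n => gres_iso n VWop (@inW _ _ W V)) cohW.
have [||||clsJJ [cohJJ clsJJE]] := @is_coh_bij _ _ (sdif (rs_d (gres jO)) (U := V :&: W))
  (sdif (fun n => jmap W (rs_d (gres jO) n)) (U := V)) (fun n s => jsec Vop s) _ _ _ _ _ _ _ cohJ.
- by move=> n x y; exact: jsec_D.
- by move=> n x; apply: sections_ext => y hy; apply: sections_ext => z hz.
- by move=> n; exact: jsec_inj.
- by move=> n y; exact: jsec_surj.
have cohL := sections_is_coh (fun n x m => esym (junit_nat W (rs_d (gres jO) n) m))
  (jext_quasi_iso Wop Vop jO_exact) cohJJ.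
pose dK n : {linear K n -> K n.+1} := linpack (@kd n).
pose dL n : L n -> L n.+1 := sdif (rs_d (gres jO)) (U := V) (n := n).
have dLD n x y : dL n (x + y) = dL n x + dL n y.
  by apply: sections_ext => q hq; exact: (linearD (rs_d (gres jO) n q)).
have bd n m r : dL n (bK m r) = bK (dK n m) r.
  apply: sections_ext => q hq; symmetry; exact: (gres_map_d (jtimes r)).
have ddK n x : dK n.+1 (dK n x) = 0.
  by apply: sections_ext => q hq; exact: (rs_dd (F := gres O)).
have [K0 [L0 [d0 [e0 [b0 [bb0 be0 e0D d0K [d0b e0b]]]]]]] : exists (K0 : lmodType (stalk p))
    (L0 : zmodType) (d0 : {linear K0 -> K i}) (e0 : L0 -> L i) (b0 : K0 -> stalk p' -> L0),
    [/\ base_change (res pp) b0, forall m r, e0 (b0 m r) = bK (d0 m) r,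
      forall x y, e0 (x + y) = e0 x + e0 y, forall x, dK i (d0 x) = 0 &
      (forall y, bnd (sdif (rs_d (gres O)) (U := V)) (d0 y)) /\
      forall z, bnd dL z -> exists y, e0 y = z].
  case: (i) => [|j].
    exists (K 0), (L 0), (\0), (fun=> 0), (@bK 0); split.
    - exact: god_base_change.
    - by move=> m r; have [hb _ _] := god_base_change 0; rewrite (bc_bal0 hb).
    - by move=> x y; rewrite addr0.
    - by move=> x; rewrite linear0.
    - by split=> // z ->; exists 0.
  exists (K j), (L j), (dK j), (dL j), (@bK j); split=> //.
  - exact: god_base_change.
  - by split=> // y; exists y.
case: cohK cohL => kD kS kK [lD lS lK].
apply: (@flat_cohomology _ _ (res pp) (@Xfin p p' pp) _ _ _ d0 (dK i) d0K _ _ _ e0 (dL i) e0D (dLD i)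
  b0 (@bK i) (@bK i.+1) bb0 (god_base_change i) (god_base_change i.+1) be0 (bd i) H _ kD _ kS _
  H' _ lD lS _ c c_bal _).
- move=> a z z0; rewrite -clsZ; last first.
    transitivity (smap f (sdif (rs_d (gres O)) (z : sections _ V))).
      by apply: sections_ext => q hq; rewrite /= fd.
    by rewrite [sdif _ _]z0; apply: sections_ext => q hq; exact: linear0.
  congr cls; apply: sections_ext => q hq.
  exact: (linearZ_LR (f i q) (res (Vp hq) a) ((z : sections (rs_obj (gres O) i) V) q hq)).
- by move=> y; apply/kK; [exact: d0K|exact: d0b].
- by move=> z z0 /(lK _ z0); exact: e0b.
- move=> z r z0; rewrite cE; last first.
    transitivity (smap f (sdif (rs_d (gres O)) (z : sections _ V))).
      by apply: sections_ext => q hq; rewrite /= fd.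
    by rewrite [sdif _ _]z0; apply: sections_ext => q hq; exact: linear0.
  pose w : sections (rs_obj (gres O) i) (V :&: W) := asec inVW r *: srestr subVW z.
  have -> : asec inVW r *: srestr subVW (smap f z) = smap f w.
    apply: sections_ext => q hq; symmetry.
    exact: (linearZ_LR (f i q) (res (inVW hq) r)).
  rewrite -clsJE -clsJJE; congr clsJJ.
  apply: sections_ext => x hx; apply: sections_ext => y hy.
  have yVW := jsec_in Vop hx hy.
  rewrite (jsecE Vop _ hx hy yVW).
  have -> : sec (smap (fun n => junit W (rs_obj (gres jO) n)) (bK z r) x hx) hy = bK z r y (subVW yVW).
    exact: (sec_res (bK z r) (jW_le hy) hx (subVW yVW)).
  apply: cofam_ext => t ht; have tVW := VWop (cof_le ht) yVW.
  rewrite -[LHS]/(gquon_map i (junit W O) t (res (cof_le ht) (res (inVW yVW) r) *: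
    (srestr subVW z y yVW : god (gquon i O) y) t ht)).
  rewrite linearZ_LR (res_comp _ _ (inVW tVW)).
  rewrite -(@gquon_map_scal _ _ (V :&: W) VWop _ _ (fun x hx => res (inVW hx) r) (jtimes r)
    (junit W O)) //.
  - by move=> q q' h hq hq'; exact: res_comp.
  - move=> q hq m; apply: sections_ext => v hv.
    rewrite jsecZ /= (res_comp _ _ (jW_p' hv)) //.
Qed.
End OpenBaseChange.

(** * Higher direct images along the diagonal *)

Section CohomologyClass.
Variables (R : pzRingType) (C : nat -> lmodType R) (d : forall n, {linear C n -> C n.+1}) (i : nat).

Lemma boundary_bnd j (z : C j) : boundary d z <-> bnd (C := C) (fun n => d n) z.
Proof. by case: j z. Qed.

Definition hclass (z : C i) : cohomology d i :=
  match pselect (d i z = 0) with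
  | left h => hcls (@Cocycle R C d i z (introT eqP h))
  | right _ => 0
  end.

Lemma hclassE (z : cocycle d i) : hclass (val z) = hcls z.
Proof.
rewrite /hclass; case: pselect => [h|]; first by congr (hcls _); exact: val_inj.
by case; case: z => z /= /eqP.
Qed.

Lemma hclass_ex z : d i z = 0 -> exists2 c : cocycle d i, val c = z & hclass z = hcls c.
Proof.
move=> z0; exists (@Cocycle R C d i z (introT eqP z0)) => //.
exact: (hclassE (Cocycle _)).
Qed.

Lemma hclass_lin a z z' : d i z = 0 -> d i z' = 0 ->
  hclass (a *: z + z') = a *: hclass z + hclass z'.
Proof.
move=> z0 z0'; have [c <- ->] := hclass_ex z0; have [c' <- ->] := hclass_ex z0'.
by rewrite -hclsZ -hclsD -hclassE.
Qed.

Lemma hclass_is_coh : is_coh (C := C) (fun n => d n) hclass.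
Proof.
split.
- by move=> z z' hz hz'; have := hclass_lin 1 hz hz'; rewrite !scale1r.
- move=> h; exists (val (hrep h)); last by rewrite hclassE hrepK.
  by case: (hrep h) => z /= /eqP.
- move=> z z0; have [c <- ->] := hclass_ex z0.
  have -> : (hcls c = 0) = (hcls c = hcls 0) :> Prop.
    congr (_ = _); symmetry; apply: (addrI (hcls 0)); by rewrite -hclsD !addr0.
  by rewrite hclsP subr0; exact: boundary_bnd.
Qed.
End CohomologyClass.

Section DirectImages.
Variables (k : comPzRingType) (X Y : rspace k) (f : rmap X Y) (M : omodule X).
Variables (E : injective_resolution M) (i : nat).

Definition rclass (y : Y) (z : sections (ir_obj E i) (pre_open f y)) : Rpush f E i y :=
  hclass (fun n => push_map f (ir_d E n) y) (z : push_st f (ir_obj E i) y).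

Lemma rclass_is_coh y : is_coh (sdif (ir_d E) (U := pre_open f y)) (@rclass y).
Proof. exact: (hclass_is_coh (fun n => push_map f (ir_d E n) y)). Qed.

Lemma rclassZ y a z : sec_map (ir_d E i) z = 0 -> rclass (sharp f a *: z) = a *: @rclass y z.
Proof.
move=> z0.
have z00 : push_map f (ir_d E i) y 0 = 0 by rewrite linear0.
have := hclass_lin (d := fun n => push_map f (ir_d E n) y) a z0 z00.
rewrite /rclass => e.
have h0 : hclass (fun n => push_map f (ir_d E n) y) (0 : push_st f (ir_obj E i) y) = 0.
  have := hclass_lin (d := fun n => push_map f (ir_d E n) y) 1 z00 z00.
  by rewrite !scale1r addr0 => /esym/eqP; rewrite -subr_eq0 addrK => /eqP.
by rewrite h0 !addr0 in e.
Qed.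

Lemma rclass_res (y y' : Y) (h : le y y') z : sec_map (ir_d E i) z = 0 ->
  mres (Rpush f E i) h (@rclass y z) = rclass (push_res h z).
Proof.
move=> z0; rewrite /rclass.
have [c cz ->] := hclass_ex (d := fun n => push_map f (ir_d E n) y) z0.
rewrite [mres _ _ _]cohomology_mapE -hclassE; congr (hclass _ _).
by rewrite -cz.
Qed.
End DirectImages.

Section RpushZero.
Variables (k : comPzRingType) (X Y : rspace k) (f : rmap X Y) (M : omodule X).
Variables (E : injective_resolution M).

Lemma Rpush_zeroP y : exact_pos (sdif (ir_d E) (U := pre_open f y)) <->
  forall i, (0 < i)%N -> forall m : Rpush f E i y, m = 0.
Proof.
split=> [ex [//|i] _ m|h i z z0].
  have [_ S K] := rclass_is_coh f E i.+1 y.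
  by have [z z0 <-] := S m; apply/(K _ z0); exact: ex.
have [_ S K] := rclass_is_coh f E i.+1 y.
by apply/(K _ z0); exact: h.
Qed.

Lemma Rpush0_fun_subproof (y : Y) (s : pushforward f M y) :
  sec_map (ir_d E 0) (sec_map (ir_aug E) (s : sections M _)) = 0.
Proof.
by apply: sections_ext => x hx; apply/(ir_exact0 (i := E)); exists ((s : sections M _) x hx).
Qed.
Definition Rpush0_fun (y : Y) (s : pushforward f M y) : Rpush f E 0 y :=
  rclass (sec_map (ir_aug E) (s : sections M _)).
Lemma Rpush0_lin y : linear (@Rpush0_fun y).
Proof.
move=> a s t; rewrite /Rpush0_fun.
have [D _ _] := rclass_is_coh f E 0 y.
rewrite -rclassZ ?Rpush0_fun_subproof // -D; last 2 first.
- have -> : sdif (ir_d E) (sharp f a *: sec_map (ir_aug E) (s : sections M _)) =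
    sharp f a *: sec_map (ir_d E 0) (sec_map (ir_aug E) (s : sections M _)).
    exact: linearZ_LR.
  by rewrite Rpush0_fun_subproof scaler0.
- exact: Rpush0_fun_subproof.
congr (rclass _); apply: sections_ext => x hx.
exact: (linearP (ir_aug E x)).
Qed.
HB.instance Definition _ y := GRing.isLinear.Build (stalk y) (pushforward f M y) (Rpush f E 0 y) _
  (@Rpush0_fun y) (@Rpush0_lin y).
Lemma Rpush0_res (y y' : Y) (h : le y y') s :
  mres (Rpush f E 0) h (Rpush0_fun s) = Rpush0_fun (mres (pushforward f M) h s).
Proof.
rewrite /Rpush0_fun rclass_res ?Rpush0_fun_subproof //; congr (rclass _).
exact: sections_ext.
Qed.
Definition Rpush0 : omhom (pushforward f M) (Rpush f E 0) :=
  OMHom (hfun := fun y => @Rpush0_fun y : {linear pushforward f M y -> Rpush f E 0 y}) Rpush0_res.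

Lemma Rpush0_bij y : injective (Rpush0 y) /\ forall m, exists s, Rpush0 y s = m.
Proof.
have [_ S K] := rclass_is_coh f E 0 y.
split.
  move=> s t /eqP; rewrite -subr_eq0 -linearB => /eqP /(K _ (Rpush0_fun_subproof _)) /= e.
  apply/eqP; rewrite -subr_eq0; apply/eqP; apply: sections_ext => x hx.
  apply: (ir_mono (i := E) (p := x)); rewrite linear0.
  exact: (sec_eq e hx).
move=> m; have [z z0 <-] := S m.
have [|x hx|s sE] := @sec_lift k X (pre_open f y) M (ir_obj E 0) (ir_aug E) z.
- by move=> x _; exact: ir_mono.
- by apply/(ir_exact0 (i := E)); exact: (sec_eq z0 hx).
- by exists s; rewrite -sE.
Qed.
End RpushZero.

Section QuasiCoherentIso.

Lemma mod_base_change_iso (A B : comPzRingType) (phi : {rmorphism A -> B})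
    (N1 N : lmodType A) (N1' N' : lmodType B) (al : {linear N1 -> N}) (be : {linear N1' -> N'})
    (f1 : N1 -> N1') (f : N -> N') :
  (injective al /\ forall n, exists m, al m = n) ->
  (injective be /\ forall n, exists m, be m = n) ->
  semilinear phi f -> (forall n, f (al n) = be (f1 n)) ->
  mod_base_change phi f1 -> mod_base_change phi f.
Proof.
move=> [ai aS] [bi bS] fl e b1.
apply: (@cokernel_base_change _ _ phi N1 N1 N N1' N1' N' (\0) al (\0) be f1 f1 f) => //.
- by move=> x /=; case: b1 => h _; exact: semilin0 h.
- by move=> x; rewrite linear0.
- by move=> x x0; exists 0; apply: bi; rewrite x0; exact: linear0.
Qed.

Lemma mod_base_change_id (B : comPzRingType) (N : lmodType B) :
  mod_base_change (idfun : {rmorphism B -> B}) (fun n : N => n).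
Proof.
have sl : semilinear (idfun : {rmorphism B -> B}) (fun n : N => n) by [].
have hb := semilinear_balanced sl; split=> //; split=> // [g|t t0].
  by exists (bc_tens _ g 1); rewrite bc_liftE // scale1r.
suff -> : t = bc_tens idfun (bc_lift idfun (fun (n : N) r => r *: n) t) 1.
  by rewrite t0; exact: tens0l.
elim/bc_tens_ind: {t0} t => [|n r|s t {1}-> {1}->].
- by rewrite bc_lift0 //; symmetry; exact: tens0l.
- rewrite bc_liftE // [RHS](@tensZ B N (restr idfun B^o)); congr (tens _ _).
  by rewrite -[RHS]/(r * 1) mulr1.
- by rewrite bc_liftD //; symmetry; exact: tensDl.
Qed.

Lemma mod_base_change_eq (A B : comPzRingType) (phi1 phi : {rmorphism A -> B})
    (N : lmodType A) (N' : lmodType B) (f : N -> N') :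
  phi =1 phi1 -> mod_base_change phi1 f -> mod_base_change phi f.
Proof.
move=> e h.
exact: (@base_change_comp A B B phi1 idfun phi e N N' N' f id f (fun=> erefl) h
  (mod_base_change_id N')).
Qed.

Variables (k : comPzRingType) (X : rspace k).

Definition om_bij (M N : omodule X) (u : omhom M N) : Prop :=
  forall x, injective (u x) /\ forall n, exists m, u x m = n.

Lemma quasi_coherent_iso (M N : omodule X) (u : omhom M N) : om_bij u ->
  quasi_coherent M -> quasi_coherent N.
Proof.
move=> ub /quasi_coherent_base_change qc; apply: base_change_quasi_coherent => x y h.
apply: (mod_base_change_iso (ub x) (ub y)) (qc x y h); first exact: mres_lin.
by move=> n; rewrite hfun_res.
Qed.

Lemma om_inv (M N : omodule X) (u : omhom M N) : om_bij u ->
  exists v : omhom N M, (forall x n, u x (v x n) = n) /\ om_bij v.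
Proof.
move=> ub; pose v x n := projT1 (cid ((ub x).2 n)).
have vK x n : u x (v x n) = n := projT2 (cid ((ub x).2 n)).
have uK x m : v x (u x m) = m by apply: (ub x).1; rewrite vK.
have vl x : linear (v x).
  by move=> a m n; apply: (ub x).1; rewrite linearP !vK.
have vr (x y : X) (h : le x y) n : mres M h (linpack (vl x) n) = linpack (vl y) (mres N h n).
  by apply: (ub y).1; rewrite -hfun_res /= !vK.
exists (OMHom vr); split=> [x n|x]; first exact: vK.
split=> [m n e|m]; last by exists (u x m); exact: uK.
by rewrite -(vK x m) -(vK x n); congr (u x _).
Qed.

Lemma zero_quasi_coherent (M : omodule X) : zero_module M -> quasi_coherent M.
Proof.
move=> M0; apply: base_change_quasi_coherent => x y h.
have B := semilinear_balanced (mres_lin (o := M) h).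
split; first exact: mres_lin.
split=> // [g|t _]; first by exists 0; rewrite bc_lift0 // [g]M0.
elim/bc_tens_ind: t => [//|n r|s t -> ->]; last by rewrite addr0.
rewrite [n]M0; exact: tens0l.
Qed.

Lemma quasi_coherent_zero (M : omodule X) (x y : X) (h : le x y) : quasi_coherent M ->
  (forall m : M x, m = 0) -> forall m : M y, m = 0.
Proof.
move=> /quasi_coherent_base_change/(_ x y h) [sl [B S _]] M0 m.
have [t <-] := S m; elim/bc_tens_ind: t => [|n r|s t]; first exact: bc_lift0.
  by rewrite bc_liftE // [n]M0 mres0 scaler0.
by rewrite bc_liftD // => -> ->; rewrite addr0.
Qed.
End QuasiCoherentIso.

Section SemiSeparatedSchematic.
Variables (k : comPzRingType) (X : rspace k).

Lemma semi_separated_schematic : semi_separated X -> schematic X.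
Proof.
move=> [qc [E E0]]; exists E => -[|i]; last by apply: zero_quasi_coherent; exact: E0.
exact: quasi_coherent_iso (Rpush0_bij (diag X) E) qc.
Qed.

Lemma Rpush0_quasi_coherent (E : injective_resolution (struct_module X)) :
  quasi_coherent (Rpush (diag X) E 0) ->
  quasi_coherent (pushforward (diag X) (struct_module X)).
Proof.
move=> qc; have [v [_ vb]] := om_inv (Rpush0_bij (diag X) E).
exact: quasi_coherent_iso vb qc.
Qed.
End SemiSeparatedSchematic.

Section SubspaceTransfer.
Variables (k : comPzRingType) (X : rspace k) (U : {set X}) (Uop : is_open U).
Let Y := subspace U.

Section RestrictMap.
Variables (M N : omodule X) (u : omhom M N).
Lemma om_restr_res (x y : Y) (h : le x y) (m : mod_restr M U x) :
  mres (mod_restr N U) h ((u (val x) : {linear mod_restr M U x -> mod_restr N U x}) m) =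
  (u (val y) : {linear mod_restr M U y -> mod_restr N U y}) (mres (mod_restr M U) h m).
Proof. exact: (hfun_res u). Qed.
Definition om_restr : omhom (mod_restr M U) (mod_restr N U) :=
  OMHom (hfun := fun x : Y => u (val x) : {linear mod_restr M U x -> mod_restr N U x}) om_restr_res.
End RestrictMap.

Section RestrictResolution.
Variable E : injective_resolution (struct_module X).
Lemma restr_aug_res (x y : Y) (h : le x y) (m : struct_module Y x) :
  mres (mod_restr (ir_obj E 0) U) h
    ((ir_aug E (val x) : {linear struct_module Y x -> mod_restr (ir_obj E 0) U x}) m) =
  (ir_aug E (val y) : {linear struct_module Y y -> mod_restr (ir_obj E 0) U y})
    (mres (struct_module Y) h m).
Proof. exact: (hfun_res (ir_aug E)). Qed.
Definition restr_aug : omhom (struct_module Y) (mod_restr (ir_obj E 0) U) :=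
  OMHom (hfun := fun x : Y =>
    ir_aug E (val x) : {linear struct_module Y x -> mod_restr (ir_obj E 0) U x}) restr_aug_res.
Definition restr_res : resolution (struct_module Y) := {|
  rs_obj := fun n => mod_restr (ir_obj E n) U;
  rs_d := fun n => om_restr (ir_d E n);
  rs_aug := restr_aug;
  rs_mono := fun (p : Y) => @ir_mono k X _ E (val p);
  rs_exact0 := fun (p : Y) => @ir_exact0 k X _ E (val p);
  rs_exact := fun n (p : Y) => @ir_exact k X _ E n (val p)
|}.

Lemma rel_inj_restr (M : omodule X) : rel_inj M -> rel_inj (mod_restr M U).
Proof.
case=> r rK.
have repU (x : Y) z (hz : le (val x) z && isrep z) : z \in U.
  exact: Uop (cof_le hz) (valP x).
have up (x : Y) z (hz : le (val x) z && isrep z) :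
    le x (rep (Sub z (repU x z hz) : Y)) && isrep (rep (Sub z (repU x z hz) : Y)).
  rewrite isrep_rep andbT.
  exact: (@le_trans _ Y (Sub z (repU x z hz)) _ _ (cof_le hz) (le_rep _)).
pose ext (x : Y) (m : god (mod_restr M U) x) : god M (val x) := fun z hz =>
  mres M (rep_le (Sub z (repU x z hz) : Y)) (m _ (up x z hz)).
pose s (x : Y) (m : god (mod_restr M U) x) : mod_restr M U x := r (val x) (ext x m).
have sl (x : Y) : linear (s x).
  move=> a m n; rewrite /s -[RHS](linearP (r (val x))); congr (r (val x) _).
  apply: cofam_ext => z hz; rewrite /ext cofam_linE mres_lin cofam_linE; congr (_ *: _ + _).
  exact: (@res_comp k X).
have sr (x y : Y) (h : le x y) m :
    mres (mod_restr M U) h (linpack (sl x) m) = linpack (sl y) (mres (god (mod_restr M U)) h m).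
  rewrite [LHS](hfun_res r); congr (r (val y) _); apply: cofam_ext => z hz.
  rewrite [LHS]/= /cofam_res /ext.
  move: (up x z _).
  rewrite (bool_irrelevance (repU x z _) (repU y z hz)) => u1.
  by rewrite (bool_irrelevance u1 (cof_up h (up y z hz))).
exists (OMHom sr) => x m; rewrite -[RHS](rK (val x)); congr (r (val x) _).
apply: cofam_ext => z hz; exact: (mres_comp _ _ (cof_le hz)).
Qed.
End RestrictResolution.

Section RestrictSections.
Variables (V : {set X}) (V' : {set Y}).
Hypothesis VU : {subset V <= U}.
Hypothesis VV : forall a : Y, (a \in V') = (val a \in V).

Lemma rsub_in (a : Y) : a \in V' -> val a \in V. Proof. by rewrite VV. Qed.
Lemma rsub_Sub x (hx : x \in V) : (Sub x (VU hx) : Y) \in V'. Proof. by rewrite VV SubK. Qed.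

Section One.
Variable M : omodule X.
Lemma rsec_sub_res (s : sections M V) (a b : Y) (h : le a b) (ha : a \in V') (hb : b \in V') :
  mres (mod_restr M U) h (s (val a) (rsub_in ha)) = s (val b) (rsub_in hb).
Proof. exact: (@sec_res k X M V s (val a) (val b) h). Qed.
Definition rsec_sub (s : sections M V) : sections (mod_restr M U) V' := Sections (rsec_sub_res s).
Lemma rsec_subE s x (hx : x \in V) (h : (Sub x (VU hx) : Y) \in V') :
  rsec_sub s (Sub x (VU hx)) h = s x hx.
Proof. exact: (sec_irr s). Qed.
Lemma rsec_sub_inj : injective rsec_sub.
Proof.
move=> s t e; apply: sections_ext => x hx.
by rewrite -(rsec_subE s (rsub_Sub hx)) e rsec_subE.
Qed.
Lemma rsec_sub_surj t : exists s, rsec_sub s = t.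
Proof.
have sres (p q : X) (h : le p q) (hp : p \in V) (hq : q \in V) :
    mres M h (t (Sub p (VU hp)) (rsub_Sub hp)) = t (Sub q (VU hq)) (rsub_Sub hq).
  exact: (@sec_res _ _ _ _ t (Sub p (VU hp)) (Sub q (VU hq)) h).
exists (Sections sres); apply: sections_ext => -[x xU] hx /=.
move: (rsub_in hx) => hx'; move: (VU hx') (rsub_Sub hx') => /= xU'.
rewrite (bool_irrelevance xU' xU) => h.
by rewrite (bool_irrelevance hx (h : exist (fun y => y \in U) x xU \in V')).
Qed.
Lemma rsec_subD s t : rsec_sub (s + t) = rsec_sub s + rsec_sub t.
Proof. exact: sections_ext. Qed.
End One.

Hypothesis V'op : is_open V'.

Lemma exact_pos_subspace (E : injective_resolution (struct_module X))
    (Ep : injective_resolution (struct_module Y)) :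
  exact_pos (sdif (ir_d E) (U := V)) <-> exact_pos (sdif (ir_d Ep) (U := V')).
Proof.
have [f [fd fq]] := resolution_compare (F := restr_res E) Ep
  (fun n => rel_inj_restr (om_injective_rel_inj (@ir_inj _ _ _ E n))).
rewrite -(sections_exact_pos fd (fq V' V'op)).
apply: (exact_pos_quasi_iso (f := fun n s => rsec_sub (M := ir_obj E n) s)).
- by move=> n s t; exact: rsec_subD.
- by move=> n s t; apply: sections_ext => x hx; exact: (linearD (ir_d E n (val x))).
- by move=> n s; apply: sections_ext.
apply: bij_quasi_iso.
- by move=> n s t; exact: rsec_subD.
- by move=> n s t; apply: sections_ext => x hx; exact: (linearD (ir_d E n (val x))).
- by move=> n s; apply: sections_ext.
- by move=> n; exact: rsec_sub_inj.
- by move=> n; exact: rsec_sub_surj.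
Qed.
End RestrictSections.
End SubspaceTransfer.

Section DiagonalOpens.
Variables (k : comPzRingType) (X : rspace k).

Lemma in_diag (y : prod_space X X) x : (x \in pre_open (diag X) y) = le y.1 x && le y.2 x.
Proof. by rewrite inE. Qed.
Lemma diag_open (y : prod_space X X) : is_open (pre_open (diag X) y).
Proof.
move=> a b ab; rewrite !in_diag => /andP[h1 h2].
by rewrite (le_trans h1 ab) (le_trans h2 ab).
Qed.

Variable p : X.
Let U := min_open p.
Let Y := subspace U.

Lemma sub_le (a : Y) : le p (val a). Proof. by have := valP a; rewrite inE. Qed.
Lemma sub_in (x : X) : le p x -> x \in U. Proof. by rewrite inE. Qed.
Definition sub_pt (x : X) (h : le p x) : Y := Sub x (sub_in h).

Lemma diag_subU (a b : Y) :
  {subset pre_open (diag X) ((val a, val b) : prod_space X X) <= U}.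
Proof.
by move=> x; rewrite in_diag /= => /andP[h _]; rewrite inE; exact: le_trans (sub_le a) h.
Qed.
End DiagonalOpens.

Section SchematicLocal.
Variables (k : comPzRingType) (X : rspace k).

Lemma in_diag_sub (p : X) (a b c : subspace (min_open p)) :
  (c \in pre_open (diag (subspace (min_open p))) ((a, b) : prod_space _ _)) =
  (val c \in pre_open (diag X) ((val a, val b) : prod_space X X)).
Proof. by rewrite !inE. Qed.

Lemma diag_exact (E : injective_resolution (struct_module X)) (p : X) :
  exact_pos (sdif (ir_d E) (U := pre_open (diag X) ((p, p) : prod_space X X))).
Proof.
move=> i s s0.
have pp : p \in pre_open (diag X) ((p, p) : prod_space X X) by rewrite in_diag /= le_refl.
have [y yE] := proj1 (@ir_exact _ _ _ E i p (s p pp)) (sec_eq s0 pp).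
have ple x (hx : x \in pre_open (diag X) ((p, p) : prod_space X X)) : le p x.
  by move: hx; rewrite in_diag /= andbb.
have tres (a b : X) (h : le a b) (ha : a \in pre_open (diag X) ((p, p) : prod_space X X))
    (hb : b \in pre_open (diag X) ((p, p) : prod_space X X)) :
    mres (ir_obj E i) h (mres (ir_obj E i) (ple a ha) y) = mres (ir_obj E i) (ple b hb) y.
  exact: mres_comp.
exists (Sections tres); apply: sections_ext => x hx.
by rewrite /= -hfun_res yE; exact: sec_res.
Qed.

Lemma res_prod_sub (p : X) (y z : prod_space (subspace (min_open p)) (subspace (min_open p)))
    (h : le y z)
    (h' : @le _ (prod_space X X) (val y.1, val y.2) (val z.1, val z.2)) r :
  @res _ (prod_space X X) _ _ h' r = @res _ (prod_space (subspace (min_open p)) _) y z h r.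
Proof.
elim/rtensor_ind: r => [|a b|r s IH IH']; first by rewrite !rmorph0.
  rewrite [LHS](prod_resE (X := X) (Y := X)) [RHS](prod_resE (X := subspace (min_open p))).
  congr (rtens _ _ _ _).
    exact: (congr1 (fun e => @res k X (val y.1) (val z.1) e a) (bool_irrelevance _ _)).
  exact: (congr1 (fun e => @res k X (val y.2) (val z.2) e b) (bool_irrelevance _ _)).
by rewrite !rmorphD IH IH'.
Qed.

Section DiagSections.
Variable p : X.
Let Y := subspace (min_open p).
Variables (a b : Y).

Definition id_restr : omhom (mod_restr (struct_module X) (min_open p)) (struct_module Y) :=
  @OMHom k Y (mod_restr (struct_module X) (min_open p)) (struct_module Y)
    (fun x => idfun : {linear mod_restr (struct_module X) (min_open p) x -> struct_module Y x})
    (fun x y h m => erefl).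

Definition dsec (s : pushforward (diag X) (struct_module X) ((val a, val b) : prod_space X X)) :
  pushforward (diag Y) (struct_module Y) ((a, b) : prod_space Y Y) :=
  sec_map id_restr (rsec_sub (in_diag_sub a b) s).

Lemma dsecE s c (hc : c \in pre_open (diag Y) ((a, b) : prod_space Y Y))
    (hc' : val c \in pre_open (diag X) ((val a, val b) : prod_space X X)) :
  sec (dsec s) hc = sec s hc'.
Proof. exact: (sec_irr (s : sections _ _)). Qed.

Lemma dsec_lin : linear
  (dsec : @pushforward k X _ (diag X) (struct_module X) ((val a, val b) : prod_space X X) ->
   @pushforward k Y _ (diag Y) (struct_module Y) ((a, b) : prod_space Y Y)).
Proof.
move=> r s t; apply: sections_ext => c hc.
have hc' : val c \in pre_open (diag X) ((val a, val b) : prod_space X X) by rewrite -in_diag_sub.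
rewrite (dsecE _ hc hc').
rewrite -[LHS]/(rmap_st (diag X) (val c) (res (sharp_le hc') r) * sec s hc' + sec t hc').
rewrite -[RHS]/(rmap_st (diag Y) c (res (sharp_le hc) r) * sec (dsec s) hc + sec (dsec t) hc).
rewrite !(dsecE _ hc hc'); congr (_ * _ + _); congr (diag_st _ _).
exact: (@res_prod_sub p ((a, b) : prod_space Y Y) ((c, c) : prod_space Y Y)).
Qed.

Lemma id_restr_iso (V : {set Y}) : iso_on V id_restr.
Proof. by move=> x _; split=> [m n //|n]; exists n. Qed.

Lemma dsec_bij : injective dsec /\ forall t, exists s, dsec s = t.
Proof.
have [i S] := iso_on_sections (@id_restr_iso (pre_open (diag Y) ((a, b) : prod_space Y Y))).
split.
  by move=> s t /i; apply: (rsec_sub_inj (diag_subU (a := a) (b := b))).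
move=> t; have [s <-] := S t.
have [r <-] := rsec_sub_surj (diag_subU (a := a) (b := b)) (in_diag_sub a b) s.
by exists r.
Qed.
End DiagSections.

Lemma schematic_local : schematic X -> forall p : X, semi_separated (subspace (min_open p)).
Proof.
move=> [E qcE] p; have Uop := @min_open_open _ X p.
split; last first.
  exists (ires (struct_module (subspace (min_open p)))) => i i0 [a b].
  move: i i0; apply/Rpush_zeroP.
  apply: (proj1 (exact_pos_subspace Uop (diag_subU (a := a) (b := b)) (in_diag_sub a b)
    (@diag_open _ _ _) E _)).
  apply/Rpush_zeroP => i i0.
  have h : @le _ (prod_space X X) (p, p) (val a, val b).
    by apply/andP; split; exact: sub_le.
  apply: (quasi_coherent_zero h (qcE i)).
  move: i i0; apply/Rpush_zeroP; exact: diag_exact.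
apply: base_change_quasi_coherent => -[a b] [a' b'] h.
have qc0 := quasi_coherent_base_change (Rpush0_quasi_coherent (qcE 0%N)).
have h' : @le _ (prod_space X X) (val a, val b) (val a', val b') by exact: h.
have fl := mres_lin (o := pushforward (diag (subspace (min_open p)))
  (struct_module (subspace (min_open p)))) h.
apply: (@mod_base_change_iso _ _ _ _ _ _ _ (linpack (@dsec_lin p a b))
  (linpack (@dsec_lin p a' b')) (mres (pushforward (diag X) (struct_module X)) h') _ _ _ fl _ _).
- exact: dsec_bij.
- exact: dsec_bij.
- move=> s; apply: sections_ext => c hc.
  have hc' : val c \in pre_open (diag X) ((val a', val b') : prod_space X X) by rewrite -in_diag_sub.
  rewrite [RHS](dsecE _ hc hc').
  exact: (dsecE s (pre_open_sub h hc) (pre_open_sub h' hc')).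
apply: mod_base_change_eq (qc0 _ _ h').
by move=> r; symmetry; exact: (@res_prod_sub p (a, b) (a', b')).
Qed.
End SchematicLocal.

Section LocalBaseChange.
Variables (k : comPzRingType) (X : rspace k) (p : X).
Let Y := subspace (min_open p).
Hypothesis ss : semi_separated Y.
Variables (p' x : X) (pp : le p p') (px : le p x).
Let W := min_open p'.
Let O := struct_module X.
Let sp : Y := sub_pt (le_refl p).
Let sp' : Y := sub_pt pp.
Let sx : Y := sub_pt px.

Lemma jW_diag (q y : X) : jW (min_open q) y = pre_open (diag X) ((q, y) : prod_space X X).
Proof. by apply/setP => z; rewrite !inE. Qed.

Lemma local_exact (E : injective_resolution O) : exact_pos (sdif (ir_d E) (U := jW W x)).
Proof.
have [_ [Ep E0]] := ss.
rewrite jW_diag.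
apply: (proj2 (exact_pos_subspace (@min_open_open _ X p) (diag_subU (a := sp') (b := sx))
  (in_diag_sub sp' sx) (@diag_open _ _ _) E Ep)).
by apply/Rpush_zeroP => i i0; exact: E0.
Qed.

Let N := pushforward (diag Y) (struct_module Y).
Let y0 : prod_space Y Y := (sp, sp).
Let y1 : prod_space Y Y := (sp', sx).
Let y01 : le y0 y1. Proof. by apply/andP; split; [exact: pp|exact: px]. Qed.
Let sp_in : sp \in pre_open (diag Y) y0. Proof. by rewrite in_diag !le_refl. Qed.
Let np (n : N y0) : stalk p := sec n sp_in.

Let NA : lmodType (stalk p) := restr (res px) (stalk x)^o.
Let P := tensor NA (restr (res pp) (stalk p')^o).
Let hb (n : N y0) (c : stalk p') (d : stalk x) : P := bc_tens (res pp) (N := NA) (d * res px (np n)) c.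

Let hb_bal n : rbalanced (kst p') (kst x) (hb n).
Proof.
split=> [c c' d|c d d'|z c d]; rewrite /hb.
- exact: (@tensDr _ NA (restr (res pp) (stalk p')^o)).
- by rewrite mulrDl; exact: (@tensDl _ NA (restr (res pp) (stalk p')^o)).
- rewrite -(kst_res px z) -(kst_res pp z) -mulrA.
  symmetry; exact: (@tensZ _ NA (restr (res pp) (stalk p')^o) (kst p z)).
Qed.
Let h (n : N y0) (r : @stalk _ (prod_space Y Y) y1) : P := rlift (hb n) r.

Let npD m n : np (m + n) = np m + np n. Proof. by []. Qed.

Let h_bal : bc_balanced (res y01) h.
Proof.
split=> [m m' r|m r r'|a m r].
- rewrite /h; elim/rtensor_ind: r => [|c d|r r' IH IH'].
  + by rewrite !(rlift0 (hb_bal _)) addr0.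
  + rewrite !(rliftE (hb_bal _)) /hb npD rmorphD mulrDr.
    exact: (@tensDl _ NA (restr (res pp) (stalk p')^o)).
  + by rewrite !(rliftD (hb_bal _)) IH IH' addrACA.
- exact: (rliftD (hb_bal m)).
- rewrite -[a *: r]/(res y01 a * (r : @stalk _ (prod_space Y Y) y1)) /h.
  have npZ : np (a *: m) = diag_st sp a * np m.
    rewrite -[LHS]/(diag_st sp (res (sharp_le sp_in) a) * np m); congr (diag_st _ _ * _).
    exact: (@res_id _ (prod_space Y Y) y0).
  elim/rtensor_ind: r => [|c d|r r' IH IH'].
  + by rewrite mulr0 !(rlift0 (hb_bal _)).
  + rewrite !(rliftE (hb_bal _)) /hb npZ.
    elim/rtensor_ind: a {npZ} => [|a b|a a' IH IH'].
    * rewrite !rmorph0 !mul0r (rlift0 (hb_bal _)) rmorph0 mulr0.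
      exact: (@tens0l _ NA (restr (res pp) (stalk p')^o)).
    * rewrite [res y01 _](prod_resE (X := Y) (Y := Y)) rtensM (rliftE (hb_bal _)) /hb.
      rewrite (diag_stE (X := Y) (x := sp)).
      have -> : @res k Y sp sp' (le2l y01) a = @res k X p p' pp a.
        exact: (congr1 (fun e => @res k X p p' e a) (bool_irrelevance _ _)).
      have -> : @res k Y sp sx (le2r y01) b = @res k X p x px b.
        exact: (congr1 (fun e => @res k X p x e b) (bool_irrelevance _ _)).
      rewrite -[bc_tens _ _ (res pp a * c)](@tensZ _ NA (restr (res pp) (stalk p')^o) a).
      congr (tens _ _); rewrite -[RHS]/(res px a * (res px b * d * res px (np m))).
      by rewrite !rmorphM; ring.
    * rewrite !rmorphD !mulrDl (rliftD (hb_bal _)) -IH -IH' rmorphD mulrDr.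
      exact: (@tensDl _ NA (restr (res pp) (stalk p')^o)).
  + by rewrite mulrDr !(rliftD (hb_bal _)) IH IH'.
Qed.

Let beta (m : NA) (r : stalk p') : jext W O x := @jtimes k X p' r x (m : O x).
Let beta_bal : bc_balanced (res pp) (N := NA) beta.
Proof.
split=> [m m' r|m r r'|a m r]; rewrite /beta.
- exact: linearD.
- by apply: sections_ext => z hz; rewrite jsecD /= rmorphD mulrDl.
- apply: sections_ext => z hz.
  rewrite -[LHS]/(res (jW_p' hz) r * res (jW_le hz) (res px a * m)).
  rewrite -[RHS]/(res (jW_p' hz) (res pp a * r) * res (jW_le hz) m).
  rewrite !rmorphM !(res_comp _ _ (le_trans px (jW_le hz))); ring.
Qed.

Let jW_diag_in c : c \in pre_open (diag Y) y1 -> val c \in jW W x.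
Proof. by rewrite in_diag_sub jW_diag. Qed.

Let compat (t : tensor (N y0) (restr (res y01) (@stalk _ (prod_space Y Y) y1)^o)) c
    (hc : c \in pre_open (diag Y) y1) (hc' : val c \in jW W x) :
  sec (bc_lift (res y01) (fun n r => r *: mres N y01 n) t) hc =
  sec (bc_lift (res pp) (N := NA) beta (bc_lift (res y01) h t)) hc'.
Proof.
have fb := semilinear_balanced (mres_lin (o := N) y01).
elim/bc_tens_ind: t => [|n r|s t IH IH'].
- by rewrite !bc_lift0.
- rewrite !bc_liftE // /h; elim/rtensor_ind: r => [|u d|r r' IH IH'].
  + by rewrite (rlift0 (hb_bal _)) bc_lift0 // scale0r.
  + rewrite (rliftE (hb_bal _)) /hb bc_liftE // /beta.
    rewrite -[LHS]/(diag_st c (res (sharp_le hc) (rtens (kst p') (kst x) u d)) *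
      sec n (pre_open_sub y01 hc)).
    rewrite [res _ _](prod_resE (X := Y) (Y := Y)) (diag_stE (X := Y) (x := c)).
    rewrite -[RHS]/(res (jW_p' hc') u * res (jW_le hc') (d * res px (np n))).
    have spc : le p (val c) := sub_le c.
    have -> : sec n (pre_open_sub y01 hc) = @res k X p (val c) spc (np n).
      exact/esym/(sec_res (n : sections (struct_module Y) _) (spc : @le _ Y sp c)).
    rewrite rmorphM (@res_comp k X p x (val c) px (jW_le hc') spc) mulrA; congr (_ * _ * _).
      exact: (congr1 (fun e => @res k X p' (val c) e u) (bool_irrelevance _ _)).
    exact: (congr1 (fun e => @res k X x (val c) e d) (bool_irrelevance _ _)).
  + by rewrite scalerDl (rliftD (hb_bal _)) bc_liftD // jsecD -IH -IH'.
- by rewrite !bc_liftD // jsecD -IH -IH'.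
Qed.

Lemma local_base_change : base_change (res pp) (N := NA) beta.
Proof.
have [qc _] := ss; have [_ [_ S I]] := quasi_coherent_base_change qc y01.
split=> // [g|s s0].
  have gres (a b : Y) (ab : le a b) (ha : a \in pre_open (diag Y) y1) (hb_ : b \in pre_open (diag Y) y1) :
      mres (struct_module Y) ab (sec g (jW_diag_in ha)) = sec g (jW_diag_in hb_).
    exact: (@sec_res k X O _ g (val a) (val b) ab).
  have [t tE] := S (Sections gres).
  exists (bc_lift (res y01) h t); apply: sections_ext => z hz.
  have pz : le p z by exact: le_trans px (jW_le hz).
  have cz : sub_pt pz \in pre_open (diag Y) y1 by rewrite in_diag_sub -jW_diag.
  rewrite -(compat t cz hz) tE /=; exact: (sec_irr g).
have [t tE] : exists t, bc_lift (res y01) h t = s.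
  elim/bc_tens_ind: {s0} s => [|m r|s s' [t <-] [t' <-]].
  - by exists 0; rewrite bc_lift0.
  - exists (bc_tens (res y01) (N := N y0) (1 : osec (pre_open (diag Y) y0)) (rtens (kst p') (kst x) r m)).
    rewrite bc_liftE // /h (rliftE (hb_bal _)) /hb -[np _]/(1 : stalk p).
    by rewrite rmorph1 mulr1.
  - by exists (t + t'); rewrite bc_liftD.
rewrite -tE (I t) ?bc_lift0 //; apply: sections_ext => c hc.
by rewrite (compat t hc (jW_diag_in hc)) tE s0.
Qed.
End LocalBaseChange.

Section RpushStep.
Variables (k : comPzRingType) (X : rspace k).
Hypothesis Xfin : finite_space X.
Let O := struct_module X.
Variables (E : injective_resolution O) (i : nat).
Variables (p p' : X) (pp : le p p').
Hypothesis ss : semi_separated (subspace (min_open p)).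
Variables (y y' : prod_space X X) (yy : le y y').
Let V := pre_open (diag X) y.
Let V' := pre_open (diag X) y'.
Hypothesis Vp : forall x, x \in V -> le p x.
Hypothesis Vp' : forall x, x \in V' -> le p' x.
Hypothesis VV : V' = V :&: min_open p'.
Variables (al : {rmorphism stalk p -> stalk y}) (al' : {rmorphism stalk p' -> stalk y'}).
Hypothesis alE : forall a, sharp (diag X) (al a) = asec Vp a.
Hypothesis alE' : forall a, sharp (diag X) (al' a) = asec Vp' a.

Hypothesis alC : forall a, res yy (al a) = al' (res pp a).

Lemma Rpush_step : base_change (res pp) (N := restr al (Rpush (diag X) E i y))
  (fun (n : Rpush (diag X) E i y) (r : stalk p') => al' r *: mres (Rpush (diag X) E i) yy n).
Proof.
have Vop : is_open V by exact: diag_open.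
have sub' : {subset V' <= V} by move=> x; exact: pre_open_sub.
have cast : forall (V2 : {set X}) (e : V' = V2) (h2 : forall x, x \in V2 -> le p' x)
    (s2 : {subset V2 <= V}), exists cls2 : sections (ir_obj E i) V2 -> Rpush (diag X) E i y',
    is_coh (sdif (ir_d E) (U := V2)) cls2 /\
    forall r z, cls2 (asec h2 r *: srestr s2 z) =
      rclass (f := diag X) (asec Vp' r *: srestr sub' z : sections (ir_obj E i) V').
  move=> V2 e; case: V2 / e => h2 s2; exists (@rclass _ _ _ (diag X) _ E i y'); split.
    exact: rclass_is_coh.
  by move=> r z; rewrite (Prop_irrelevance Vp' h2) (Prop_irrelevance sub' s2).
have [cls' [coh' clsE']] := cast _ VV (@inVW _ _ p' V) (@subVW _ _ p' V).
have sl := mres_lin (o := Rpush (diag X) E i) yy.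
have RZ a z : sec_map (ir_d E i) z = 0 ->
    rclass (f := diag X) (E := E) (asec Vp a *: z) = al a *: rclass (f := diag X) (E := E) z.
  by move=> z0; rewrite -rclassZ // alE.
apply: (@open_base_change _ _ Xfin p p' pp V Vop Vp _ E _ i
  (restr al (Rpush (diag X) E i y)) (@rclass _ _ _ (diag X) _ E i y) _ _ _ cls' coh').
- by move=> x hx; exact: local_base_change.
- by move=> x hx; apply: (local_exact ss pp (Vp hx)).
- exact: rclass_is_coh.
- exact: RZ.
- split=> [m m' r|m r r'|a m r].
  + by rewrite (semilinD sl) scalerDr.
  + by rewrite rmorphD scalerDl.
  + rewrite -[a *: m]/(al a *: (m : Rpush (diag X) E i y)) (semilinZ sl) scalerA alC.
    by rewrite -rmorphM mulrC.
- move=> z r z0; rewrite clsE' rclass_res // -rclassZ; last first.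
    by apply: sections_ext => x hx; exact: (sec_eq z0 (pre_open_sub yy hx)).
  rewrite alE'; congr (rclass (_ *: _)).
  by apply: sections_ext => x hx; exact: (sec_irr z).
Qed.
End RpushStep.

Section LocalSchematic.
Variables (k : comPzRingType) (X : rspace k).
Hypothesis Xfin : finite_space X.
Hypothesis ss : forall p : X, semi_separated (subspace (min_open p)).
Variables (E : injective_resolution (struct_module X)) (i : nat).
Let XX := prod_space X X.
Let F := Rpush (diag X) E i.

Let stepl (p p' q : X) (pp : le p p') (h : @le _ XX (p, q) (p', q)) :
  mod_base_change (res h) (mres F h).
Proof.
split; first exact: mres_lin.
have Vp x : x \in pre_open (diag X) ((p, q) : XX) -> le p x by rewrite in_diag => /andP[].
have Vp' x : x \in pre_open (diag X) ((p', q) : XX) -> le p' x by rewrite in_diag => /andP[].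
apply: (@ring_change_up _ _ _ _ (res pp) (res h) (rinl (kst p) (kst q)) (rinl (kst p') (kst q))).
- apply: rtensor_pushoutl; first by move=> c; exact: kst_res.
  move=> a c; rewrite [LHS](prod_resE (X := X) (Y := X)); congr (rtens _ _ _ _).
    by congr (res _ a); exact: bool_irrelevance.
  exact: res_id.
- exact: mres_lin.
apply: (@Rpush_step _ _ Xfin E i p p' pp (@ss p) (p, q) (p', q) h Vp Vp').
- apply/setP => x; rewrite finset.in_setI !in_diag inE /=.
  case: (boolP (le p' x)) => [px|]; last by rewrite andbF.
  by rewrite (le_trans pp px) andbT.
- move=> a; apply: sections_ext => x hx.
  rewrite -[LHS]/(diag_st x (res (sharp_le hx) (rtens (kst p) (kst q) a 1))).
  rewrite [res _ _](prod_resE (X := X) (Y := X)) diag_stE rmorph1 mulr1.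
  by congr (res _ a); exact: bool_irrelevance.
- move=> a; apply: sections_ext => x hx.
  rewrite -[LHS]/(diag_st x (res (sharp_le hx) (rtens (kst p') (kst q) a 1))).
  rewrite [res _ _](prod_resE (X := X) (Y := X)) diag_stE rmorph1 mulr1.
  by congr (res _ a); exact: bool_irrelevance.
- move=> a; rewrite [LHS](prod_resE (X := X) (Y := X)) rmorph1.
  by congr (rtens _ _ (res _ a) _); exact: bool_irrelevance.
Qed.

Let stepr (p q q' : X) (qq : le q q') (h : @le _ XX (p, q) (p, q')) :
  mod_base_change (res h) (mres F h).
Proof.
split; first exact: mres_lin.
have Vp x : x \in pre_open (diag X) ((p, q) : XX) -> le q x by rewrite in_diag => /andP[].
have Vp' x : x \in pre_open (diag X) ((p, q') : XX) -> le q' x by rewrite in_diag => /andP[].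
apply: (@ring_change_up _ _ _ _ (res qq) (res h) (rinr (kst p) (kst q)) (rinr (kst p) (kst q'))).
- apply: rtensor_pushoutr; first by move=> c; exact: kst_res.
  move=> c a; rewrite [LHS](prod_resE (X := X) (Y := X)); congr (rtens _ _ _ _).
    exact: res_id.
  by congr (res _ a); exact: bool_irrelevance.
- exact: mres_lin.
apply: (@Rpush_step _ _ Xfin E i q q' qq (@ss q) (p, q) (p, q') h Vp Vp').
- apply/setP => x; rewrite finset.in_setI !in_diag inE /=.
  case: (boolP (le q' x)) => [px|]; last by rewrite !andbF.
  by rewrite (le_trans qq px) !andbT.
- move=> a; apply: sections_ext => x hx.
  rewrite -[LHS]/(diag_st x (res (sharp_le hx) (rtens (kst p) (kst q) 1 a))).
  rewrite [res _ _](prod_resE (X := X) (Y := X)) diag_stE rmorph1 mul1r.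
  by congr (res _ a); exact: bool_irrelevance.
- move=> a; apply: sections_ext => x hx.
  rewrite -[LHS]/(diag_st x (res (sharp_le hx) (rtens (kst p) (kst q') 1 a))).
  rewrite [res _ _](prod_resE (X := X) (Y := X)) diag_stE rmorph1 mul1r.
  by congr (res _ a); exact: bool_irrelevance.
- move=> a; rewrite [LHS](prod_resE (X := X) (Y := X)) rmorph1.
  by congr (rtens _ _ _ (res _ a)); exact: bool_irrelevance.
Qed.

Lemma local_quasi_coherent : quasi_coherent F.
Proof.
apply: base_change_quasi_coherent => -[p q] [p' q'] h.
have [pp qq] : le p p' /\ le q q' by exact/andP.
have h1 : @le _ XX (p, q) (p', q) by apply/andP; rewrite pp le_refl.
have h2 : @le _ XX (p', q) (p', q') by apply/andP; rewrite qq le_refl.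
apply: (base_change_comp _ _ (stepl pp h1) (stepr qq h2)) => [a|n]; symmetry.
  exact: res_comp.
exact: mres_comp.
Qed.
End LocalSchematic.

Lemma local_schematic (k : comPzRingType) (X : rspace k) : finite_space X ->
  (forall p : X, semi_separated (subspace (min_open p))) -> schematic X.
Proof.
move=> Xfin ss; exists (ires (struct_module X)) => i.
exact: local_quasi_coherent.
Qed.

(** * Affine spaces *)

Section Dimension.
Variables (k : comPzRingType) (X : rspace k) (M : omodule X).

Lemma gquon_eq0 n (x : X) : (#|[set z | le x z && isrep z]| <= n)%N ->
  forall m : gquon n M x, m = 0.
Proof.
elim: n x => [|n IH] x.
  rewrite leqn0 cards_eq0 => /eqP e.
  have : rep x \in [set z | le x z && isrep z] by rewrite inE rep_up.
  by rewrite e finset.in_set0.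
move=> hx m; apply: gquo_ext => y h.
case: (eqVneq y (rep x)) => [e|ne].
  by move: h; rewrite e => h; rewrite !gquo_rep.
have yn : (#|[set z | le y z && isrep z]| <= n)%N.
  rewrite -ltnS; apply: leq_trans hx; apply/proper_card/properP; split.
    by apply/fintype.subsetP => z; rewrite !inE => /andP[yz ->]; rewrite (le_trans (cof_le h) yz).
  exists (rep x); rewrite !inE ?rep_up // isrep_rep andbT; apply: contra ne => yx.
  have ry : rep y == y by case/andP: h.
  rewrite -(eqP ry) -(rep_rep x); apply/eqP/rep_eq => //.
  exact: le_trans (rep_le x) (cof_le h).
by rewrite [LHS]IH // [RHS]IH.
Qed.
End Dimension.

Section FreeAcyclic.
Variables (k : comPzRingType) (X : rspace k) (I : Type).
Let F := free_module X I.
Let O := struct_module X.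

Lemma gquon_map_comp (M N P : omodule X) (u : omhom M N) (v : omhom N P) (w : omhom M P) :
  (forall x m, w x m = v x (u x m)) ->
  forall n x m, gquon_map n w x m = gquon_map n v x (gquon_map n u x m).
Proof.
move=> e; elim=> [|n IH] //= x m; apply: gquo_ext => y h.
by rewrite /= /god_map_fun IH.
Qed.

Lemma free_inj_lin i (x : X) : linear (fun a : O x => single i (a : stalk x) : F x).
Proof. by move=> a b c; rewrite singleD -singleZ. Qed.
Lemma free_inj_res i (x y : X) (h : le x y) (a : O x) :
  mres F h (linpack (free_inj_lin i (x := x)) a) = linpack (free_inj_lin i (x := y)) (mres O h a).
Proof. exact: free_res_single. Qed.
Definition free_inj (i : I) : omhom O F := OMHom (free_inj_res i).

Lemma free_proj_lin i (x : X) : linear (fun f : F x => free_val f i : O x).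
Proof. by []. Qed.
Lemma free_proj_res i (x y : X) (h : le x y) (f : F x) :
  mres O h (linpack (free_proj_lin i (x := x)) f) = linpack (free_proj_lin i (x := y)) (mres F h f).
Proof. by []. Qed.
Definition free_proj (i : I) : omhom F O := OMHom (free_proj_res i).

Let ep i : omhom F F := om_comp (free_inj i) (free_proj i).

Lemma gquon_free_sum n (x : X) (z : gquon n F x) : exists s : seq {classic I},
  forall s', uniq s' -> {subset s <= s'} -> z = \sum_(i <- s') gquon_map n (ep i) x z.
Proof.
elim: n x z => [|n IH] x z.
  exists (supp z) => s' us' sub.
  have e : z = fsum (fun i r => single i r) z by exact: single_sum.
  rewrite [LHS]e (fsum_sub (F := fun i (r : stalk x) => single i r) _ us' sub); last first.
    by move=> i a b; exact: singleD.
  by apply: eq_bigr.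
pose good y (h : le x y && isrep y) (s : seq {classic I}) := forall s', uniq s' ->
  {subset s <= s'} -> gquo_val z y h = \sum_(i <- s') gquon_map n (ep i) y (gquo_val z y h).
have ex y : exists s, forall h : le x y && isrep y, good y h s.
  case: (pselect (le x y && isrep y)) => [h|nh]; last by exists [::].
  by have [s hs] := IH y (gquo_val z y h); exists s => h'; rewrite (bool_irrelevance h' h).
pose S y := projT1 (cid (ex y)).
have SP y h : good y h (S y) by exact: (projT2 (cid (ex y))).
exists (flatten [seq S y | y <- enum X]) => s' us' sub; apply: gquo_ext => y h.
rewrite [RHS](big_morph (fun q : gquo_st (gquon n F) x => gquo_val q y h) (id1 := 0) (op1 := +%R)) //.
apply: SP => // i hi; apply: sub; apply/flatten_mapP; exists y => //.
by rewrite mem_enum.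
Qed.

Lemma free_acyc (V : {set X}) : acyc V O -> acyc V F.
Proof.
move=> hO n s.
have ex x : exists l : seq {classic I}, forall hx : x \in V, forall s', uniq s' ->
    {subset l <= s'} -> s x hx = \sum_(i <- s') gquon_map n.+1 (ep i) x (s x hx).
  case: (pselect (x \in V)) => [h|nh]; last by exists [::].
  have [l hl] := @gquon_free_sum n.+1 x (s x h).
  by exists l => h'; rewrite (bool_irrelevance h' h).
pose S x := projT1 (cid (ex x)).
pose L := undup (flatten [seq S y | y <- enum X]).
have sE x hx : s x hx = \sum_(i <- L) gquon_map n.+1 (ep i) x (s x hx).
  apply: (projT2 (cid (ex x)) hx); first exact: undup_uniq.
  move=> i hi; rewrite mem_undup; apply/flatten_mapP; exists x => //.
  by rewrite mem_enum.
have ext i := hO n (sec_map (gquo_map (gquon_map n (free_proj i))) s).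
pose t i := projT1 (cid (ext i)).
have tE i : sec_map (gproj (gquon n O)) (t i) = sec_map (gquo_map (gquon_map n (free_proj i))) s
  := projT2 (cid (ext i)).
exists (\sum_(i <- L) sec_map (god_map (gquon_map n (free_inj i))) (t i)).
apply: sections_ext => x hx; rewrite [RHS]sE.
rewrite (raddf_sum (sec_map (gproj (gquon n F)) (U := V))) /=.
rewrite (big_morph (fun q : sections (gquo (gquon n F)) V => q x hx) (id1 := 0) (op1 := +%R)) //.
apply: eq_bigr => i _; rewrite -sec_map_gquo tE.
symmetry; exact: (@gquon_map_comp _ _ _ (free_proj i) (free_inj i) (ep i) _ n.+1).
Qed.
End FreeAcyclic.

Section QuasiCoherentSub.
Variables (k : comPzRingType) (X : rspace k).
Hypothesis Xfin : finite_space X.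
Variables (F M : omodule X) (v : omhom F M).
Hypothesis Fqc : quasi_coherent F.
Hypothesis Mqc : quasi_coherent M.

Lemma imag_quasi_coherent : quasi_coherent (imag v).
Proof.
apply: base_change_quasi_coherent => x y h.
have [fl [fB fS fI]] := quasi_coherent_base_change Fqc h.
have [ml [mB mS mI]] := quasi_coherent_base_change Mqc h.
have il := mres_lin (o := imag v) h; have iB := semilinear_balanced il.
split=> //; split=> // [m|t t0].
  have [f <-] := imag_cor_surj m; have [t <-] := fS f.
  exists (bc_map (res h) (imag_cor v x) t).
  apply: bc_lift_map => // [a b|a r]; first exact: linearD.
  by rewrite linearZ -hfun_res.
apply: (flat_mono (@Xfin x y h) (u := imag_inc v x)); first exact: sub_inc_inj.
apply: mI; rewrite -/(bc_map (res h) (imag_inc v x) t).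
by rewrite (bc_lift_map (e := imag_inc v y) _ iB mB) ?t0 ?linear0.
Qed.

Hypothesis vS : forall x m, exists f, v x f = m.

Lemma kern_quasi_coherent : quasi_coherent (kern v).
Proof.
apply: base_change_quasi_coherent => x y h.
have [fl [fB fS fI]] := quasi_coherent_base_change Fqc h.
have [ml [mB mS mI]] := quasi_coherent_base_change Mqc h.
have kl := mres_lin (o := kern v) h; have kB := semilinear_balanced kl.
have cmp t : bc_lift (res h) (fun n r => r *: mres F h n) (bc_map (res h) (kern_inc v x) t) =
    kern_inc v y (bc_lift (res h) (fun n r => r *: mres (kern v) h n) t).
  by apply: bc_lift_map.
split=> //; split=> // [m|t t0].
  have [t tE] := fS (kern_inc v y m).
  have vt : bc_map (res h) (v x) t = 0.
    apply: mI; rewrite (bc_lift_map (e := v y) _ fB mB) ?tE; first exact: (sub_incP m).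
      exact: linearD.
    by move=> a r; rewrite linearZ hfun_res.
  have vk a : v x a = 0 -> exists b, kern_inc v x b = a by move=> a0; exact: sub_incS.
  have [s sE] := mapl_right_exact (@vS x) vk vt.
  exists s; apply: (@sub_inc_inj _ _ _ _ (ker_closed v) (ker_res (u := v))).
  by rewrite -tE -sE -cmp.
apply: (flat_mono (@Xfin x y h) (u := kern_inc v x)); first exact: sub_inc_inj.
by apply: fI; rewrite -/(bc_map (res h) (kern_inc v x) t) cmp t0 linear0.
Qed.
End QuasiCoherentSub.

Lemma free_quasi_coherent (k : comPzRingType) (X : rspace k) (I : Type) :
  quasi_coherent (free_module X I).
Proof. apply: base_change_quasi_coherent => x y h; exact: free_base_change. Qed.

Section Affine.
Variables (k : comPzRingType) (X : rspace k).
Hypothesis Xfin : finite_space X.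
Hypothesis Xaff : affine X.
Let O := struct_module X.

Lemma affine_faithful (M N : omodule X) (u v : omhom M N) :
  quasi_coherent M -> quasi_coherent N ->
  sec_map u (U := [set: X]) =1 sec_map v (U := [set: X]) -> forall x, u x =1 v x.
Proof.
move=> Mqc Nqc e x m.
have [_ [G [[t [t' [tn t't tt']]] _]]] := Xaff.
pose a := QCModule Mqc; pose b := QCModule Nqc.
have e' : @fmap _ _ (global_sections X) a b u = @fmap _ _ (global_sections X) a b v.
  by apply: linear_ext => s; exact: e.
have key (w : @hom (QCoh X) a b) : w = compm (t b) (compm (fmap G (fmap (global_sections X) w)) (t' a)).
  rewrite compmA; have -> := tn a b w.
  by rewrite -compmA tt' compm1.
have -> : u = v by rewrite [LHS](key u) [RHS](key v) e'.
by [].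
Qed.

Lemma affine_conservative (M N : omodule X) (u : omhom M N) :
  quasi_coherent M -> quasi_coherent N ->
  injective (sec_map u (U := [set: X])) ->
  (forall s, exists r, sec_map u (U := [set: X]) r = s) -> om_bij u.
Proof.
move=> Mqc Nqc ui us.
have [_ [G [[t [t' [tn t't tt']]] _]]] := Xaff.
pose a : QCoh X := QCModule Mqc; pose b : QCoh X := QCModule Nqc.
pose g s := projT1 (cid (us s)).
have gK s : sec_map u (g s) = s := projT2 (cid (us s)).
have gl : linear g.
  move=> c s r; apply: ui; rewrite gK; apply: sections_ext => x hx.
  rewrite /= linearP; congr (_ *: _ + _); apply/esym; [exact: (sec_eq (gK s) hx)|exact: (sec_eq (gK r) hx)].
pose Gm : hom (global_sections X b) (global_sections X a) := linpack gl.
pose w : hom b a := compm (t a) (compm (fmap G Gm) (t' b)).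
pose u' : hom a b := u.
have gu : compm Gm (fmap (global_sections X) u') = idm _.
  by apply: linear_ext => s; apply: ui; exact: gK.
have ug : compm (fmap (global_sections X) u') Gm = idm _.
  by apply: linear_ext => s; exact: gK.
have key (c d : QCoh X) (f : hom c d) :
    f = compm (t d) (compm (fmap G (fmap (global_sections X) f)) (t' c)).
  rewrite compmA; have -> := tn c d f.
  by rewrite -compmA tt' compm1.
have uw : compm u' w = idm b.
  rewrite (key _ _ u') /w.
  rewrite -!compmA (compmA (t' a)) t't comp1m (compmA (fmap G _) (fmap G Gm)) -fmap_comp ug fmap_id.
  by rewrite comp1m tt'.
have wu : compm w u' = idm a.
  rewrite (key _ _ u') /w.
  rewrite -!compmA (compmA (t' b)) t't comp1m (compmA (fmap G Gm)) -fmap_comp gu fmap_id.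
  by rewrite comp1m tt'.
move=> x; split.
  move=> m n e.
  have h z : (w : omhom N M) x (u x z) = z := congr1 (fun f : omhom M M => f x z) wu.
  by rewrite -(h m) -(h n) e.
move=> n; exists ((w : omhom N M) x n).
exact: (congr1 (fun f : omhom N N => f x n) uw).
Qed.

Let Top : is_open [set: X]. Proof. by move=> x y _ _; rewrite inE. Qed.

Lemma affine_struct_acyc : acyc [set: X] O.
Proof.
have [[E E0] _] := Xaff.
have Eex : exact_pos (sdif (ir_d E) (U := [set: X])).
  move=> i z z0.
  have [_ _ K] := hclass_is_coh (fun n => sec_map (ir_d E n) (U := [set: X])
    : {linear sections (ir_obj E n) [set: X] -> sections (ir_obj E n.+1) [set: X]}) i.+1.
  by apply/(K z z0); exact: (E0 i.+1).
have [f [fd fq]] := resolution_compare E (@gres_rel_inj _ _ O).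
have ex := proj2 (sections_exact_pos fd (fq _ Top)) Eex.
move=> n s.
have [|t tE] := ex n (sec_map (unit (gquon n.+1 O)) s).
  apply: sections_ext => x hx; rewrite /= gproj_unit.
  exact: (linear0 (unit (gquon n.+2 O) x)).
exists t; apply: (sec_inj (u := unit (gquon n.+1 O))); first by move=> x _; exact: unit_inj.
by rewrite -tE; exact: sections_ext.
Qed.

Section Generated.
Variables (M : omodule X) (Mqc : quasi_coherent M).

Let I : Type := sections M [set: X].
Let nv (s : I) (x : X) : M x := s x (finset.in_setT x).
Let nv_res (s : I) (x y : X) (h : le x y) : mres M h (nv s x) = nv s y.
Proof. exact: sec_res. Qed.

Lemma affine_generated : forall x m, exists f, free_hom nv_res x f = m.
Proof.
have iqc := imag_quasi_coherent Xfin (free_hom nv_res) (@free_quasi_coherent _ X I) Mqc.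
have ib : om_bij (imag_inc (free_hom nv_res)).
  apply: affine_conservative => // [s t|s].
    by apply: sec_inj => x _; exact: sub_inc_inj.
  apply: sec_lift => x hx; first exact: sub_inc_inj.
  apply: sub_incS; exists (single s 1).
  rewrite [LHS]fcomb_single scale1r; exact: (sec_irr s).
move=> x m; have [_ /(_ m) [n <-]] := ib x.
by have [f <-] := imag_cor_surj n; exists f.
Qed.

Lemma affine_presentation : exists (K F : omodule X) (u : omhom K F) (v : omhom F M),
  [/\ quasi_coherent K, acyc [set: X] F & ses [set: X] u v].
Proof.
exists (kern (free_hom nv_res)), (free_module X I), (kern_inc (free_hom nv_res)), (free_hom nv_res).
split.
- apply: kern_quasi_coherent => //; first exact: free_quasi_coherent.
  exact: affine_generated.
- by apply: free_acyc; exact: affine_struct_acyc.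
- split=> x hx.
  + exact: sub_inc_inj.
  + exact: sub_incP.
  + by move=> b; exact: sub_incS.
  + exact: affine_generated.
Qed.
End Generated.

Lemma affine_quasi_coherent_acyc (M : omodule X) : quasi_coherent M -> acyc [set: X] M.
Proof.
move=> Mqc n.
have big m : (#|X| <= m)%N -> h1 [set: X] (gquon m M).
  move=> hm; apply: (h1_zero Top) => x _; apply: gquon_eq0.
  exact: leq_trans (max_card _) hm.
have : forall d m, (#|X| - d <= m)%N -> forall M', quasi_coherent M' -> h1 [set: X] (gquon m M').
  elim=> [|d IH] m hm M' qc'.
    apply: (h1_zero Top) => x _; apply: gquon_eq0.
    by apply: leq_trans (max_card _) _; rewrite subn0 in hm.
  have [K [F [u [v [Kqc Fac uv]]]]] := affine_presentation qc'.
  apply: (h1_coker Top (gquon_ses Top m uv)); last exact: Fac.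
  apply: (IH m.+1) => //; apply: leq_trans (_ : (#|X| - d.+1).+1 <= _)%N; last by rewrite ltnS.
  by rewrite subnS; case: (#|X| - d)%N.
by move/(_ #|X| n); apply=> //; rewrite subnn.
Qed.
End Affine.

Section Leray.
Variables (k : comPzRingType) (X : rspace k) (V : {set X}) (Vop : is_open V).
Variables (J : nat -> omodule X) (d : forall n, omhom (J n) (J n.+1)).
Hypothesis dd : forall n x (m : J n x), d n.+1 x (d n x m) = 0.
Hypothesis Jac : forall n, acyc V (J n).
Variables (H : nat -> omodule X) (c : forall n, omhom (kern (d n)) (H n)).
Hypothesis cS : forall n x h, exists z, c n x z = h.
Hypothesis cK : forall n x z, c n x z = 0 <->
  bnd (C := fun n => J n x) (fun n => d n x) (kern_inc (d n) x z).
Hypothesis Hac : forall n, acyc V (H n).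

Let im_ker n x (m : imag (d n) x) : d n.+1 x (imag_inc (d n) x m) = 0.
Proof. by have [z <-] := sub_incP m; exact: dd. Qed.
Let ik n : omhom (imag (d n)) (kern (d n.+1)) :=
  sub_cor (ker_closed (d n.+1)) (ker_res (u := d n.+1)) (u := imag_inc (d n)) (@im_ker n).

Let ses_im n : ses V (kern_inc (d n)) (imag_cor (d n)).
Proof.
split=> x hx.
- exact: sub_inc_inj.
- by move=> a; apply/val_inj; exact: (sub_incP a).
- by move=> b e; apply: sub_incS; exact: (congr1 val e).
- exact: imag_cor_surj.
Qed.

Let ses_coh n : ses V (ik n) (c n.+1).
Proof.
split=> x hx.
- by move=> a b /(congr1 val) e; apply/val_inj.
- move=> a; apply/cK; exact: (sub_incP a).
- move=> b /cK [y yE]; exists (imag_cor (d n) x y); apply/val_inj; exact: yE.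
- exact: cS.
Qed.

Let kern0_acyc : acyc V (kern (d 0)).
Proof.
have s : ses V (kern_inc (c 0)) (c 0).
  split=> x hx; [exact: sub_inc_inj|exact: sub_incP|by move=> b; exact: sub_incS|exact: cS].
apply: (acyc_mid Vop s) => [|n]; last exact: Hac.
apply: (acyc_zero Vop) => x _ m; apply/val_inj/val_inj.
exact: (proj1 (cK _) (sub_incP m)).
Qed.

Let kern_acyc n : acyc V (kern (d n)).
Proof.
elim: n => [|n IH]; first exact kern0_acyc.
have im_acyc : acyc V (imag (d n)) by exact (acyc_coker Vop (ses_im n) IH (@Jac n)).
exact (acyc_mid Vop (ses_coh n) im_acyc (@Hac n.+1)).
Qed.

Lemma leray_zero : exact_pos (sdif d (U := V)) ->
  forall n (s : sections (H n.+1) V), s = 0.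
Proof.
move=> ex n s.
have im_acyc : acyc V (imag (d n)) by exact (acyc_coker Vop (ses_im n) (@kern_acyc n) (@Jac n)).
have [z zE] := acyc_epi Vop (ses_coh n) im_acyc s.
have [|y yE] := ex n (sec_map (kern_inc (d n.+1)) z).
  by apply: sections_ext => x hx; exact: (sub_incP (z x hx)).
apply: sections_ext => x hx; rewrite -zE; apply/cK; exists (y x hx).
exact: (sec_eq yE hx).
Qed.
End Leray.

Section Slice.
Variables (k : comPzRingType) (X : rspace k) (p : X).
Let XX := prod_space X X.

Lemma slice_le (x y : X) : le x y -> @le _ XX (p, x) (p, y).
Proof. by move=> h; apply/andP; split; [exact: le_refl|exact: h]. Qed.

Lemma slice_rinr (x y : X) (h : le x y) (a : stalk x) :
  @res _ XX _ _ (slice_le h) (rinr (kst p) (kst x) a) = rinr (kst p) (kst y) (res h a).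
Proof.
rewrite [LHS](prod_resE (X := X) (Y := X)); congr (rtens _ _ _ _); first exact: rmorph1.
by congr (res _ a); exact: bool_irrelevance.
Qed.

Section Obj.
Variable M : omodule XX.
Definition slice_st (x : X) : lmodType (stalk x) := restr (rinr (kst p) (kst x)) (M (p, x)).
Definition slice_res (x y : X) (h : le x y) (m : slice_st x) : slice_st y := mres M (slice_le h) m.
Lemma slice_res_lin (x y : X) (h : le x y) : semilinear (res h) (slice_res h).
Proof.
move=> a m n; rewrite /slice_res -[_ *: m]/(rinr (kst p) (kst x) a *: (m : M (p, x))).
by rewrite mres_lin slice_rinr.
Qed.
Lemma slice_res_id (x : X) (h : le x x) m : slice_res h m = m.
Proof. exact: mres_id. Qed.
Lemma slice_res_comp (x y z : X) (h : le x y) (h' : le y z) (h'' : le x z) m :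
  slice_res h' (slice_res h m) = slice_res h'' m.
Proof. exact: mres_comp. Qed.

(* The restriction of [M] to [p x X], as a module over [X] through the second projection. *)
Definition slice : omodule X := {|
  mst := slice_st; mres := slice_res; mres_lin := slice_res_lin;
  mres_id := slice_res_id; mres_comp := slice_res_comp
|}.

Lemma slice_quasi_coherent : quasi_coherent M -> quasi_coherent slice.
Proof.
move=> qc; apply: base_change_quasi_coherent => x y h; split; first exact: mres_lin.
apply: (@ring_change_down _ _ _ _ (res h) (@res _ XX _ _ (slice_le h))
  (rinr (kst p) (kst x)) (rinr (kst p) (kst y)) _ (M (p, x)) (M (p, y)) (mres M (slice_le h))).
- apply: rtensor_pushoutr; first by move=> c; exact: kst_res.
  move=> c a; rewrite [LHS](prod_resE (X := X) (Y := X)); congr (rtens _ _ _ _).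
    exact: res_id.
  by congr (res _ a); exact: bool_irrelevance.
- exact: mres_lin.
- by have [] := quasi_coherent_base_change qc (slice_le h).
Qed.
End Obj.

Section Map.
Variables (M N : omodule XX) (u : omhom M N).
Definition slice_fun (x : X) (m : slice M x) : slice N x := u (p, x) m.
Lemma slice_fun_lin x : linear (@slice_fun x).
Proof. move=> a m n; exact: (linearP (u (p, x))). Qed.
HB.instance Definition _ x := GRing.isLinear.Build (stalk x) (slice M x) (slice N x) _
  (@slice_fun x) (@slice_fun_lin x).
Lemma slice_map_res (x y : X) (h : le x y) m :
  mres (slice N) h (@slice_fun x m) = slice_fun (mres (slice M) h m).
Proof. exact: (hfun_res u). Qed.
Definition slice_map : omhom (slice M) (slice N) :=
  OMHom (hfun := fun x => @slice_fun x : {linear slice M x -> slice N x}) slice_map_res.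
End Map.

Section PushSlice.
Variable M : omodule X.
Let J := slice (pushforward (diag X) M).

Lemma jW_pre_open x : {subset jW (min_open p) x <= pre_open (diag X) ((p, x) : XX)}.
Proof. by move=> z; rewrite jW_diag. Qed.
Lemma pre_open_jW x : {subset pre_open (diag X) ((p, x) : XX) <= jW (min_open p) x}.
Proof. by move=> z; rewrite jW_diag. Qed.

Let f x (s : J x) : jext (min_open p) M x := srestr (@jW_pre_open x) s.
Let g x (s : jext (min_open p) M x) : J x := srestr (@pre_open_jW x) s.

Let diag_rinr x z (h : @le _ XX (p, x) (z, z)) (h' : le x z) (a : stalk x) :
  diag_st z (@res _ XX _ _ h (rinr (kst p) (kst x) a)) = res h' a.
Proof.
rewrite [res _ _](prod_resE (X := X) (Y := X)) diag_stE rmorph1 mul1r.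
by congr (res _ a); exact: bool_irrelevance.
Qed.

Let f_lin x : linear (@f x).
Proof.
move=> a s t; apply: sections_ext => z hz.
have e := diag_rinr (sharp_le (jW_pre_open hz)) (jW_le hz) a.
rewrite -[RHS]/(res (jW_le hz) a *: sec s (jW_pre_open hz) + sec t (jW_pre_open hz)).
by rewrite -e.
Qed.
Let g_lin x : linear (@g x).
Proof.
move=> a s t; apply: sections_ext => z hz.
have e := diag_rinr (sharp_le hz) (jW_le (pre_open_jW hz)) a.
rewrite -[LHS]/(res (jW_le (pre_open_jW hz)) a *: sec s (pre_open_jW hz) + sec t (pre_open_jW hz)).
by rewrite -e.
Qed.

Lemma rel_inj_push_slice : rel_inj M -> rel_inj J.
Proof.
move=> /(rel_inj_jext (@min_open_open _ X p)).
have fr (x y : X) (h : le x y) s :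
    mres (jext (min_open p) M) h (linpack (@f_lin x) s) = linpack (@f_lin y) (mres J h s).
  by apply: sections_ext => z hz; exact: (sec_irr (s : sections M (pre_open (diag X) ((p, x) : XX)))).
have gr (x y : X) (h : le x y) s :
    mres J h (linpack (@g_lin x) s) = linpack (@g_lin y) (mres (jext (min_open p) M) h s).
  by apply: sections_ext => z hz; exact: (sec_irr (s : sections M (jW (min_open p) x))).
apply: (rel_inj_retract (i := OMHom fr) (r := OMHom gr)) => x s.
by apply: sections_ext => z hz; exact: (sec_irr (s : sections M (pre_open (diag X) ((p, x) : XX)))).
Qed.
End PushSlice.

Section Vanishing.
Variable E : injective_resolution (struct_module X).
Let J n := slice (pushforward (diag X) (ir_obj E n)).
Let d n : omhom (J n) (J n.+1) := slice_map (push_map (diag X) (ir_d E n)).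
Let H n := slice (Rpush (diag X) E n).

Let c_fun n x (z : kern (d n) x) : H n x :=
  rclass (f := diag X) (E := E) (y := (p, x)) (kern_inc (d n) x z).
Let c_lin n x : linear (@c_fun n x).
Proof.
move=> a y z.
have h (w : kern (d n) x) : push_map (diag X) (ir_d E n) (p, x) (kern_inc (d n) x w) = 0.
  exact: (sub_incP w).
rewrite /c_fun linearP.
exact: (hclass_lin (d := fun n => push_map (diag X) (ir_d E n) (p, x)) (rinr (kst p) (kst x) a)
  (h y) (h z)).
Qed.
Let c_res n (x y : X) (h : le x y) m :
  mres (H n) h (linpack (@c_lin n x) m) = linpack (@c_lin n y) (mres (kern (d n)) h m).
Proof.
rewrite [LHS](rclass_res (slice_le h)); last exact: (sub_incP m).
by congr (rclass _); exact: (hfun_res (kern_inc (d n))).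
Qed.
Let c n : omhom (kern (d n)) (H n) := OMHom (@c_res n).

Let c_surj n x h : exists z, c n x z = h.
Proof.
have [_ S _] := rclass_is_coh (diag X) E n (p, x).
have [z z0 <-] := S h.
have [w <-] : exists w, kern_inc (d n) x w = z by exact: sub_incS.
by exists w.
Qed.

Let c_bnd n x z : c n x z = 0 <->
  bnd (C := fun n => J n x) (fun n => d n x) (kern_inc (d n) x z).
Proof.
have [_ _ K] := rclass_is_coh (diag X) E n (p, x).
rewrite [c n x z = 0](K _ (sub_incP z)).
by case: n z {K} => z.
Qed.

Let sections_exact : exact_pos (sdif d (U := [set: X])).
Proof.
move=> i s s0.
have inT (x : X) : x \in [set: X] by rewrite inE.
pose sx (x : X) : sections (ir_obj E i.+1) (pre_open (diag X) ((p, x) : XX)) := s x (inT x).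
have [|y yE] := @diag_exact _ _ E p i (sx p); first exact: (sec_eq s0 (inT p)).
have sub x : {subset pre_open (diag X) ((p, x) : XX) <= pre_open (diag X) ((p, p) : XX)}.
  by move=> z; rewrite !in_diag => /andP[/= -> _].
have sxE x x' (h : le x x') z hz hz' : sec (sx x) (p := z) hz = sec (sx x') hz'.
  by rewrite /sx -(sec_res s h (inT x) (inT x')); exact: sec_irr.
have tres (a b : X) (h : le a b) (ha : a \in [set: X]) (hb : b \in [set: X]) :
    mres (J i) h (srestr (@sub a) y : J i a) = srestr (@sub b) y.
  by apply: sections_ext => z hz; exact: (sec_irr y).
exists (Sections tres); apply: sections_ext => x hx; apply: sections_ext => z hz.
have /andP[/= pz xz] : le p z && le x z by rewrite -(in_diag ((p, x) : XX)).
have zz : z \in pre_open (diag X) ((p, z) : XX) by rewrite in_diag pz /= le_refl.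
rewrite (sec_irr s hx (inT x)) -[RHS]/(sec (sx x) hz).
rewrite (sxE _ _ xz _ _ zz) -(sxE _ _ pz _ (sub x z hz)).
exact: (sec_eq yE (sub x z hz)).
Qed.

Lemma affine_Rpush_zero : finite_space X -> affine X ->
  (forall i, quasi_coherent (Rpush (diag X) E i)) ->
  forall i x (m : Rpush (diag X) E i.+1 (p, x)), m = 0.
Proof.
move=> Xfin Xaff qc i x m.
have Top : is_open [set: X] by move=> a b _ _; rewrite inE.
have Hqc n : quasi_coherent (H n) by exact (slice_quasi_coherent (qc n)).
have Jac n : acyc [set: X] (J n).
  apply: (rel_inj_acyc Top); apply: rel_inj_push_slice.
  exact: (om_injective_rel_inj (@ir_inj _ _ _ E n)).
have Hac n : acyc [set: X] (H n) by exact (affine_quasi_coherent_acyc Xfin Xaff (Hqc n)).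
have dd n y (z : J n y) : d n.+1 y (d n y z) = 0.
  apply: sections_ext => w hw; apply/(ir_exact (i := E)); by eexists.
have secs0 := leray_zero Top dd Jac c_surj c_bnd Hac sections_exact.
apply: (@affine_faithful _ _ Xaff _ _ (om_id (H i.+1)) (om0 (H i.+1) (H i.+1))) => // s.
by rewrite [s]secs0; exact: sections_ext.
Qed.
End Vanishing.
End Slice.

Lemma affine_schematic_semi_separated (k : comPzRingType) (X : rspace k) :
  finite_space X -> affine X -> schematic X -> semi_separated X.
Proof.
move=> Xfin Xaff [E qc]; split; first exact: Rpush0_quasi_coherent (qc 0%N).
exists E => -[//|i] _ [p x] m; exact: (affine_Rpush_zero Xfin Xaff qc).
Qed.

Theorem proposition4p10 (k : comPzRingType) :
  (forall X : rspace k, finite_space X -> affine X ->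
     (schematic X <-> semi_separated X)) /\
  (forall X : rspace k, finite_space X ->
     (schematic X <-> forall p : X, semi_separated (subspace (min_open p)))).
Proof.
split=> X Xfin.
  move=> Xaff; split; first exact: affine_schematic_semi_separated.
  exact: semi_separated_schematic.
split; first exact: schematic_local.
exact: local_schematic.
Qed.
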